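(* Let $(M,\omega)$ be a symplectic manifold and $C\subset(M,\omega)$ a compact coisotropic submanifold with characteristic foliation $\mathcal{F}$ and Gotay local model $(U,\Omega_G)$. Assume that $\alpha_t$ is a smooth curve in $\mathrm{Def}_{\mathcal{F}}^{U}(C)$ passing through $C$ at time $t=0$, i.e. $\alpha_0=0$. Then the infinitesimal deformation $\dot{\alpha}_0:=\left.\frac{d}{dt}\right|_{t=0}\alpha_t\in\Omega^1(\mathcal{F})$ satisfies: (i) $d_{\mathcal{F}}\dot{\alpha}_0=0$; (ii) $\Phi(\dot{\alpha}_0)$ is exact in $\big(\Omega^{\bullet}(\mathcal{F};G),d_{\nabla}\big)$.
   Context: Everything is smooth. A submanifold $C\subset(M,\omega)$ is coisotropic if $TC^{\omega}\subset TC$, where $TC^{\omega}=\{v\in TM|_C:\omega(v,w)=0\ \forall w\in TC\}$. Let $\omega_C$ be the pullback of $\omega$ to $C$; it is closed of constant rank, and the characteristic foliation is defined by $T\mathcal{F}=\ker\omega_C$. Gotay local model: fix a complement $G$ to $T\mathcal{F}$ in $TC$. Let $j:T^{*}\mathcal{F}\hookrightarrow T^{*}C$ be extension by zero on $G$ (also denoting the induced map $\Omega^{\bullet}(\mathcal{F})\hookrightarrow\Omega^{\bullet}(C)$), $p:T^{*}\mathcal{F}\to C$ the projection, $\omega_{can}=-d\theta_{can}$ the canonical symplectic form on $T^*C$. Then $\Omega_G:=p^{*}\omega_C+j^{*}\omega_{can}$ is symplectic on a neighborhood $U$ of the zero section $C\subset T^{*}\mathcal{F}$. $\Gamma(U)$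 denotes sections of $T^*\mathcal{F}$ with image in $U$. $\mathrm{Def}^{U}_{\mathcal{F}}(C)$ is the set of $\alpha\in\Gamma(U)$ such that $\mathrm{Graph}(\alpha)$ is coisotropic in $(U,\Omega_G)$ and there is a foliated diffeomorphism $(C,\ker\omega_C)\to(C,\ker(\omega_C-d(j(\alpha))))$. A path $\alpha_t$ in it is smooth if there is a smooth path of embeddings $\Phi_t:C\hookrightarrow U$ such that $\mathrm{Graph}(\alpha_t)=\Phi_t(C)$ and $p\circ\Phi_t:(C,\ker\omega_C)\to(C,\ker(\omega_C-d(j(\alpha_t))))$ is a foliated diffeomorphism. $\Omega^{k}(\mathcal{F})=\Gamma(\wedge^kT^{*}\mathcal{F})$, with leafwise de Rham differential $d_{\mathcal{F}}$. Identify $G\cong N\mathcal{F}=TC/T\mathcal{F}$; the Bott connection becomes the flat $T\mathcal{F}$-connection $\nabla_XY=\mathrm{pr}_G[X,Y]$ on $G$ ($X\in\Gamma(T\mathcal{F})$, $Y\in\Gamma(G)$, $\mathrm{pr}_G:TC\to G$ the projection with kernel $T\mathcal{F}$), and $d_{\nabla}$ is the associated Koszul-type differential on $\Omega^{k}(\mathcal{F};G)=\Gamma(\wedge^kT^{*}\mathcal{F}\otimes G)$. The form $\omega_C$ gives an isomorphism $\omega_C^{\flat}:G\to G^{*}$, $Y\mapsto\omega_C(Y,\cdot)$. The map $\Phi:\Gamma(\wedge^{k}T^{*}\mathcal{F})\to\Gamma(\wedge^{k}T^{*}\mathcal{F}\otimes G)$ is defined by $\langle\Phi(\alpha)(V_1,\ldots,V_k),\beta\rangle=d(j(\alpha))\big(V_1,\ldots,V_k,(\omega_C^{\flat})^{-1}(\beta)\big)$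 for $\beta\in\Gamma(G^{*})$ and $V_i\in\Gamma(T\mathcal{F})$. *)

(* Defs.v *)
From mathcomp Require Import all_boot all_order all_algebra.
From mathcomp Require Import all_classical all_reals all_analysis.

Set Implicit Arguments.
Unset Strict Implicit.
Unset Printing Implicit Defensive.

Import Order.TTheory GRing.Theory Num.Theory.
Import numFieldNormedType.Exports.

Local Open Scope classical_set_scope.
Local Open Scope ring_scope.

Section Euclidean.
Variable R : realType.

Fixpoint Ck (k n : nat) (A : set 'rV[R]_n) (f : 'rV[R]_n -> R) : Prop :=
  (forall x, A x -> {for x, continuous f}) /\
  match k with
  | 0 => True
  | k'.+1 => forall i : 'I_n,
      (forall x, A x -> derivable f x (delta_mx 0 i)) /\
      Ck k' A (fun x => 'D_(delta_mx 0 i) f x)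
  end.

(* To be used on open sets only. *)
Definition Cinfty (n : nat) (A : set 'rV[R]_n) (f : 'rV[R]_n -> R) : Prop :=
  forall k, Ck k A f.

End Euclidean.

(* Everything below (smooth maps, tangent vectors as derivations, vector
   fields, forms) depends on a manifold only through its algebra of smooth
   functions.  This lets the manifolds C and M, the total spaces of vector
   bundles over C, and the product of C with an interval be handled alike. *)
Record dspace (R : realType) := DSpace {
  dpoint :> Type;
  smooth : set (dpoint -> R) }.

Arguments smooth {R} d _.

Section DSpaces.
Variable R : realType.
Implicit Types X Y : dspace R.

Definition box (X : Type) (m : nat) (g : 'I_m -> X -> R) (x : X) (e : R) :
  set X := [set y | forall i, `|g i y - g i x| < e].

(* Open sets of the initial topology of the smooth functions; on a manifold
   and on the total space of a vector bundle this is the usual topology. *)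
Definition dopen X (A : set X) : Prop :=
  forall x, A x -> exists (m : nat) (g : 'I_m -> X -> R) (e : R),
    [/\ forall i, smooth X (g i), 0 < e & box g x e `<=` A].

(* The functions that locally are smooth functions of finitely many members of
   S. *)
Definition generated (T : Type) (S : set (T -> R)) : set (T -> R) :=
  [set f | forall x, exists (m : nat) (g : 'I_m -> T -> R) (e : R)
      (F : 'rV[R]_m -> R),
    [/\ forall i, S (g i), 0 < e, Cinfty setT F &
        forall y, box g x e y -> f y = F (\row_i g i y)]].

Definition smooth_map X Y (phi : X -> Y) : Prop :=
  forall g, smooth Y g -> smooth X (g \o phi).

Definition diffeo X Y (phi : X -> Y) : Prop :=
  smooth_map phi /\
  exists psi : Y -> X, [/\ smooth_map psi, cancel phi psi & cancel psi phi].

(* The product of X with a subset of R.  A function on it is smooth when it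
   locally extends to a smooth function near J x X, so J may contain its
   endpoints. *)
Definition cylinder (J : set R) X : dspace R :=
  @DSpace R ({t : R | J t} * X)%type
    (generated ([set fun q => sval q.1] `|`
                [set h | exists2 f, smooth X f & h = f \o snd])).

Definition smooth_family (J : set R) X Y (Phi : R -> X -> Y) : Prop :=
  @smooth_map (cylinder J X) Y (fun q => Phi (sval q.1) q.2).

Definition functional (X : Type) := (X -> R) -> R.

(* Derivations at x of the algebra of smooth functions, set to 0 on non-smooth
   functions so that equality of tangent vectors is Leibniz equality. *)
Definition tangent X (x : X) : set (functional X) :=
  [set v | [/\
    forall (a : R) f g, smooth X f -> smooth X g ->
      v (fun y => a * f y + g y) = a * v f + v g,
    forall f g, smooth X f -> smooth X g ->
      v (fun y => f y * g y) = f x * v g + g x * v f &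
    forall f, ~ smooth X f -> v f = 0]].

Definition push X Y (phi : X -> Y) (v : functional X) : functional Y :=
  fun g => if `[< smooth Y g >] then v (g \o phi) else 0.

Definition tdistribution X := forall x : X, set (functional X).

Definition is_vfield X (V : X -> functional X) : Prop :=
  (forall x, tangent x (V x)) /\
  (forall f, smooth X f -> smooth X (fun x => V x f)).

Definition dsection X (D : tdistribution X) (V : X -> functional X) : Prop :=
  is_vfield V /\ forall x, D x (V x).

Definition bracket X (V W : X -> functional X) : X -> functional X :=
  fun x f => V x (fun y => W y f) - W x (fun y => V y f).

Definition subbundle X (D : tdistribution X) : Prop :=
  [/\ forall x, D x `<=` tangent x,
      forall x, D x 0 /\
        forall (a : R) v w, D x v -> D x w -> D x (a *: v + w) &
      forall x, exists (r : nat) (V : 'I_r -> X -> functional X) (A : set X),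
        [/\ dopen A, A x, forall i, dsection D (V i) &
          forall y, A y ->
            (forall v, D y v -> exists c : 'I_r -> R,
               v = \sum_(i < r) c i *: V i y) /\
            (forall c : 'I_r -> R,
               \sum_(i < r) c i *: V i y = 0 -> forall i, c i = 0)]].

(* Forms are only ever evaluated on tangent vectors. *)
Definition form1 X := X -> functional X -> R.
Definition form2 X := X -> functional X -> functional X -> R.

Definition is_form2 X (s : form2 X) : Prop :=
  [/\ forall x (a : R) u v w, tangent x u -> tangent x v -> tangent x w ->
        s x (a *: u + v) w = a * s x u w + s x v w,
      forall x v w, tangent x v -> tangent x w -> s x v w = - s x w v &
      forall V W, is_vfield V -> is_vfield W ->
        smooth X (fun x => s x (V x) (W x))].

Definition closed2_at X (s : form2 X) (x : X) : Prop :=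
  forall V1 V2 V3, is_vfield V1 -> is_vfield V2 -> is_vfield V3 ->
    V1 x (fun y => s y (V2 y) (V3 y)) + V2 x (fun y => s y (V3 y) (V1 y))
    + V3 x (fun y => s y (V1 y) (V2 y))
    - s x (bracket V1 V2 x) (V3 x) - s x (bracket V2 V3 x) (V1 x)
    - s x (bracket V3 V1 x) (V2 x) = 0.

Definition kernel2 X (s : form2 X) : tdistribution X :=
  fun x => [set v | tangent x v /\ forall w, tangent x w -> s x v w = 0].

Definition symplectic_on X (A : set X) (s : form2 X) : Prop :=
  [/\ is_form2 s, forall x, A x -> closed2_at s x &
      forall x, A x -> kernel2 s x `<=` [set 0]].

Definition koszul1 X (th : form1 X) (V W : X -> functional X) (x : X) : R :=
  V x (fun y => th y (W y)) - W x (fun y => th y (V y))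
  - th x (bracket V W x).

(* The exterior derivative as a pointwise 2-form: extend the two vectors to
   vector fields; the value does not depend on the extensions. *)
Definition dext X (th : form1 X) : form2 X := fun x v w =>
  xget 0 [set r | exists V W, [/\ is_vfield V, is_vfield W, V x = v, W x = w &
                               r = koszul1 th V W x]].

Definition pullback2 X Y (phi : X -> Y) (s : form2 Y) : form2 X :=
  fun x v w => s (phi x) (push phi v) (push phi w).

Definition embedding X Y (phi : X -> Y) : Prop :=
  [/\ smooth_map phi, injective phi,
      forall x v w, tangent x v -> tangent x w ->
        push phi v = push phi w -> v = w &
      forall A : set X, dopen A ->
        exists2 B : set Y, dopen B & A = phi @^-1` B].

(* The image of the embedding phi is coisotropic for s. *)
Definition coisotropic X Y (s : form2 Y) (phi : X -> Y) : Prop :=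
  forall x v, tangent (phi x) v ->
    (forall w, tangent x w -> s (phi x) v (push phi w) = 0) ->
    exists2 u, tangent x u & v = push phi u.

Definition foliated_diffeo X (D D' : tdistribution X) (phi : X -> X) : Prop :=
  diffeo phi /\ forall x, push phi @` D x = D' (phi x).

(* Linear functionals on the subspace E, set to 0 outside E. *)
Definition is_covector X (E : set (functional X)) (l : functional X -> R) :=
  (forall (a : R) v w, E v -> E w -> l (a *: v + w) = a * l v + l w) /\
  (forall v, ~ E v -> l v = 0).

Definition copoint X (D : tdistribution X) : Type :=
  {q : X * (functional X -> R) | is_covector (D q.1) q.2}.

(* The total space of the dual D^* of a subbundle D of TX.  Its manifold
   structure is generated by the pullbacks of smooth functions on X and by the
   evaluations on the sections of D: base coordinates together with evaluations
   on a local frame of D are the usual bundle coordinates. *)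
Definition dual_bundle X (D : tdistribution X) : dspace R :=
  @DSpace R (copoint D)
    (generated
      ([set h | exists2 f, smooth X f & h = fun e => f (sval e).1] `|`
       [set h | exists2 V, dsection D V &
                  h = fun e => (sval e).2 (V (sval e).1)])).

Definition base X (D : tdistribution X) (e : dual_bundle D) : X := (sval e).1.
Definition cov X (D : tdistribution X) (e : dual_bundle D) :
  functional X -> R := (sval e).2.

Definition cotangent X : dspace R := dual_bundle (@tangent X).

Definition is_section X (D : tdistribution X) (a : X -> dual_bundle D) : Prop :=
  smooth_map a /\ forall x, base (a x) = x.

Definition form_of X (D : tdistribution X) (a : X -> dual_bundle D) : form1 X :=
  fun x => cov (a x).

Definition theta_can X : form1 (cotangent X) :=
  fun e v => cov e (push (@base X (@tangent X)) v).

Definition omega_can X : form2 (cotangent X) :=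
  fun e v w => - dext (@theta_can X) e v w.

Definition complement X (D G : tdistribution X) : Prop :=
  [/\ subbundle G,
      forall x v, tangent x v ->
        exists u w, [/\ D x u, G x w & v = u + w] &
      forall x v, D x v -> G x v -> v = 0].

Definition proj_along X (D G : tdistribution X) (x : X) (v : functional X) :
  functional X := xget 0 [set g | G x g /\ D x (v - g)].

Definition extension_by_zero X (D G : tdistribution X)
  (j : dual_bundle D -> cotangent X) : Prop :=
  forall e, [/\ base (j e) = base e,
                forall v, D (base e) v -> cov (j e) v = cov e v &
                forall v, G (base e) v -> cov (j e) v = 0].

End DSpaces.

Arguments theta_can {R} X.
Arguments omega_can {R} X.

Record chart (R : realType) (T : Type) (n : nat) := Chart {
  chart_dom : set T;
  chart_map : T -> 'rV[R]_n;
  chart_inv : 'rV[R]_n -> T }.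

Record manifold (R : realType) := Manifold {
  mtop : topologicalType;
  mdim : nat;
  atlas : set (chart R mtop mdim);
  _ : hausdorff_space mtop;
  _ : @second_countable mtop;
  _ : forall x, exists2 c, atlas c & chart_dom c x;
  _ : forall c, atlas c ->
        [/\ open (chart_dom c),
            open (chart_map c @` chart_dom c),
            {in chart_dom c, cancel (chart_map c) (chart_inv c)},
            {within chart_dom c, continuous (chart_map c)} &
            {within chart_map c @` chart_dom c, continuous (chart_inv c)}];
  _ : forall c c', atlas c -> atlas c' -> forall i : 'I_mdim,
        Cinfty (chart_map c @` (chart_dom c `&` chart_dom c'))
               (fun u => chart_map c' (chart_inv c u) 0 i) }.

Definition mspace (R : realType) (M : manifold R) : dspace R :=
  @DSpace R (mtop M)
    [set f : mtop M -> R | forall c, @atlas R M c ->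
       Cinfty (chart_map c @` chart_dom c) (f \o chart_inv c)].

Coercion mspace : manifold >-> dspace.

Section Gotay.
Variables (R : realType) (C : dspace R).
Variable wC : form2 C.

Local Notation TF := (kernel2 wC).
Local Notation TdualF := (dual_bundle (kernel2 wC)).

Variables (G : tdistribution C) (j : TdualF -> cotangent C) (U : set TdualF).

Definition gotay_form : form2 TdualF := fun e v w =>
  pullback2 (@base R C TF) wC e v w + pullback2 j (omega_can C) e v w.

Definition zero_section : set TdualF := [set e | forall v, cov e v = 0].

Definition local_model : Prop :=
  [/\ dopen U, zero_section `<=` U & symplectic_on U gotay_form].

Definition jform (a : C -> TdualF) : form1 C := form_of (j \o a).

(* The distribution ker (omega_C - d(j(a))). *)
Definition twisted_kernel (a : C -> TdualF) : tdistribution C :=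
  kernel2 (fun x v w => wC x v w - dext (jform a) x v w).

Definition Def_F (a : C -> TdualF) : Prop :=
  [/\ is_section a, range a `<=` U, coisotropic gotay_form a &
      exists phi : C -> C, foliated_diffeo TF (twisted_kernel a) phi].

Definition smooth_path (J : set R) (a : R -> C -> TdualF) : Prop :=
  (forall t, J t -> Def_F (a t)) /\
  exists Phi : R -> C -> TdualF,
    smooth_family J Phi /\
    forall t, J t ->
      [/\ embedding (Phi t), range (Phi t) `<=` U,
          range (a t) = range (Phi t) &
          foliated_diffeo TF (twisted_kernel (a t))
            (@base R C TF \o Phi t)].

(* adot is the time derivative of a_t at t = 0 (one-sided if 0 is an endpoint
   of J). *)
Definition derivative_at_0 (J : set R) (a : R -> C -> TdualF)
  (adot : C -> TdualF) : Prop :=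
  forall x v, TF x v ->
    t^-1 * (form_of (a t) x v - form_of (a 0) x v)
      @[t --> within J 0^'] --> form_of adot x v.

(* d_F a = 0 *)
Definition leafwise_closed (a : C -> TdualF) : Prop :=
  forall V W, dsection TF V -> dsection TF W ->
    forall x, koszul1 (form_of a) V W x = 0.

(* (omega_C^flat)^-1 : G^* -> G *)
Definition wC_sharp (x : C) (b : functional R C -> R) : functional R C :=
  xget 0 [set Y | G x Y /\ forall Z, G x Z -> wC x Y Z = b Z].

(* The map Phi on 1-forms: the element of G_x whose pairing with every b in
   G_x^* is d(j(a))(v, (omega_C^flat)^-1 b). *)
Definition PhiG (a : C -> TdualF) (x : C) (v : functional R C) : functional R C :=
  xget 0 [set Y | G x Y /\ forall b, is_covector (G x) b ->
                    b Y = dext (jform a) x v (wC_sharp x b)].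

Definition nabla (V Y : C -> functional R C) : C -> functional R C :=
  fun x => proj_along TF G x (bracket V Y x).

(* A is exact in Omega^1(F; G): A = d_nabla Y for some Y in Gamma(G), where
   (d_nabla Y)(V) = nabla_V Y. *)
Definition nabla_exact (A : C -> functional R C -> functional R C) : Prop :=
  exists2 Y, dsection G Y &
    forall V, dsection TF V -> forall x, A x (V x) = nabla V Y x.

End Gotay.

(* Main.v *)
(* Put phi_t = p o Phi_t, so that alpha_t o phi_t = Phi_t, and let Z be the
   velocity of phi_t at t = 0.  Since phi_t maps the leaves to
   ker (omega_C - d j(alpha_t)), the form phi_t^*(omega_C - d j(alpha_t)) is
   killed by T F for all t.  Differentiating at t = 0 gives
   i_V d j(adot) = i_V d(i_Z omega_C) for V tangent to F, and the right-hand side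
   is omega_C([V, Z], -) because i_V omega_C = 0.  On T F this is (i); on G it
   says that Phi(adot)(V) = - nabla_V (pr_G Z), which is (ii).

   No inverse function theorem is needed to differentiate alpha_t: evaluated on
   a section of T F, Phi_t is t times a continuous function near t = 0, and
   phi_t^{-1} is continuous in t at 0 because C is compact.

   Tangent vectors being derivations, everything is computed in local
   coordinates f_i : C -> R with dual global vector fields; the chain rule for
   derivations is Hadamard's lemma. *)
From HB Require Import structures.
Require Import Defs.
From mathcomp Require Import all_boot all_order all_algebra.
From mathcomp Require Import all_classical all_reals all_analysis.
From mathcomp Require Import ring lra.

Set Implicit Arguments.
Unset Strict Implicit.
Unset Printing Implicit Defensive.

Import Order.TTheory GRing.Theory Num.Theory.
Import numFieldNormedType.Exports.

Local Open Scope classical_set_scope.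
Local Open Scope ring_scope.

(** * Functions of class C^k *)

(** The map phi_0 need not be the identity, since Phi_0 is only some parametrization of the zero
    section. Hence Z is really the velocity of phi_t o phi_0^{-1}, and one first needs that phi_0
    preserves T F, which holds because alpha_0 = 0. The same vanishing explains why the moving base
    point adds nothing on the side of d j(alpha_t): in the product rule every term with alpha_t
    undifferentiated is 0 at t = 0. The derivative of the omega_C side is computed as the Lie
    derivative L_Z omega_C, and closedness of omega_C enters through the involutivity of its kernel.

    What shapes the proof is that a [dspace] knows only globally defined functions and fields, with
    no restriction to open sets. Local statements are therefore phrased with a smooth function that
    does not vanish at the point, and charts are replaced by cut-off coordinates; this is the reason
    for the bump functions. The time 0 may be an endpoint of [J], so rates are limits within [J],
    but the functions provided by [generated] are smooth on all of R^m, so two-sided calculus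
    applies to them. *)

Section Calculus.
Variable R : realType.

Lemma near_eq_cvg_to (T : Type) (F : set_system T) (f g : T -> R) (l : R) :
  Filter F -> (\forall y \near F, f y = g y) -> f @ F --> l -> g @ F --> l.
Proof. by move=> FF fg fl; exact: cvg_trans (near_eq_cvg fg) fl. Qed.

Lemma Ck_sub k n (A B : set 'rV[R]_n) (f : 'rV[R]_n -> R) :
  B `<=` A -> Ck k A f -> Ck k B f.
Proof.
elim: k f => [|k IH] f BA /= [cf hf]; split=> //.
- by move=> x /BA/cf.
- by move=> x /BA/cf.
move=> i; have [d c] := hf i; split; last exact: IH.
by move=> x /BA/d.
Qed.

Lemma Ck_local k n (A : set 'rV[R]_n) (f : 'rV[R]_n -> R) :
  (forall x, A x -> exists2 B, B x & Ck k B f) -> Ck k A f.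
Proof.
elim: k f => [|k IH] f hA; split=> //.
- move=> x /hA[B Bx [cf _]]. exact: (cf _ Bx).
- by move=> x /hA[B Bx [cf _]]; exact: (cf _ Bx).
move=> i; split; first by move=> x /hA[B Bx [_ /(_ i)[df _]]]; exact: df.
by apply: IH => x /hA[B Bx [_ /(_ i)[_ ?]]]; exists B.
Qed.

(** Openness of [A] turns agreement on [A] into agreement of germs, which is what ambient
    derivatives see. *)
Lemma Ck_eq k n (A : set 'rV[R]_n) (f g : 'rV[R]_n -> R) :
  open A -> (forall x, A x -> f x = g x) -> Ck k A f -> Ck k A g.
Proof.
elim: k f g => [|k IH] f g oA fg /= [cf hf].
  split=> // x Ax; have nfg : \near x, f x = g x.
    by apply: filterS (open_nbhs_nbhs (conj oA Ax)) => y /fg.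
  rewrite /prop_for /continuous_at -(fg _ Ax).
  exact: near_eq_cvg_to nfg (cf _ Ax).
have nfg x : A x -> \near x, f x = g x.
  by move=> Ax; apply: filterS (open_nbhs_nbhs (conj oA Ax)) => y /fg.
split=> [x Ax|i].
  rewrite /prop_for /continuous_at -(fg _ Ax).
  exact: near_eq_cvg_to (nfg _ Ax) (cf _ Ax).
have [d c] := hf i; split=> [x Ax|].
  by apply: near_eq_derivable (d _ Ax); exact: nfg.
by apply: IH c => // x Ax; apply: near_eq_derive; exact: nfg.
Qed.

Lemma Ck_le k l n (A : set 'rV[R]_n) f : (l <= k)%N -> Ck k A f -> Ck l A f.
Proof.
elim: k l f => [|k IH] [|l] f //= lk [cf hf]; split=> // i.
by have [d c] := hf i; split=> //; exact: IH c.
Qed.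

Lemma Ck_cst k n (A : set 'rV[R]_n) (c : R) : Ck k A (fun=> c).
Proof.
elim: k c => [|k IH] c; split=> //.
- by move=> x _; exact: cst_continuous.
- by move=> x _; exact: cst_continuous.
move=> i; split=> [x _|]; first exact: derivable_cst.
have -> : 'D_(delta_mx 0 i) (fun=> c) = (fun=> 0) :> ('rV[R]_n -> R).
  by apply/funext => x; exact: derive_cst.
exact: IH.
Qed.

Lemma Ck_add k n (A : set 'rV[R]_n) f g :
  open A -> Ck k A f -> Ck k A g -> Ck k A (fun x => f x + g x).
Proof.
elim: k f g => [|k IH] f g oA [cf hf] [cg hg]; split=> //.
- by move=> x Ax; exact: (continuousD (cf _ Ax) (cg _ Ax)).
- by move=> x Ax; exact: (continuousD (cf _ Ax) (cg _ Ax)).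
move=> i; have [df c1] := hf i; have [dg c2] := hg i; split=> [x Ax|].
  by apply: derivableD; [exact: df | exact: dg].
apply: Ck_eq (IH _ _ oA c1 c2) => // x Ax.
by rewrite -deriveD //; [exact: df | exact: dg].
Qed.

Lemma Ck_mul k n (A : set 'rV[R]_n) f g :
  open A -> Ck k A f -> Ck k A g -> Ck k A (fun x => f x * g x).
Proof.
elim: k f g => [|k IH] f g oA hhf hhg; move: (hhf) (hhg) => [cf hf] [cg hg]; split=> //.
- by move=> x Ax; exact: (continuousM (cf _ Ax) (cg _ Ax)).
- by move=> x Ax; exact: (continuousM (cf _ Ax) (cg _ Ax)).
move=> i; have [df c1] := hf i; have [dg c2] := hg i; split=> [x Ax|].
  by apply: derivableM; [exact: df | exact: dg].
have h1 := IH _ _ oA (Ck_le (leqnSn k) hhf) c2.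
have h2 := IH _ _ oA (Ck_le (leqnSn k) hhg) c1.
apply: Ck_eq (Ck_add oA h1 h2) => // x Ax.
have := @deriveM R _ f g x (delta_mx 0 i) (df _ Ax) (dg _ Ax).
by move=> ->.
Qed.

Lemma Ck_sum k n (A : set 'rV[R]_n) m (f : 'I_m -> 'rV[R]_n -> R) :
  open A -> (forall i, Ck k A (f i)) -> Ck k A (fun x => \sum_i f i x).
Proof.
move=> oA; elim: m f => [|m IH] f hf.
  apply: Ck_eq (Ck_cst k A 0) => // x _; by rewrite big_ord0.
apply: Ck_eq (Ck_add oA (hf ord0) (IH _ (fun i => hf (lift ord0 i)))) => // x _.
by rewrite big_ord_recl.
Qed.

Lemma derive_coord n (i j : 'I_n) (x : 'rV[R]_n) :
  is_derive x (delta_mx 0 i) (fun y : 'rV[R]_n => y 0 j) (i == j)%:R.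
Proof.
have dx : differentiable (fun y : 'rV[R]_n => y 0 j) x by exact: differentiable_coord.
apply: DeriveDef; first exact: diff_derivable.
apply/cvg_lim => //.
apply: near_eq_cvg_to (cvg_cst ((i == j)%:R : R)); near=> h.
rewrite /= !mxE eqxx /= addrK eq_sym [RHS]mulKf //.
near: h; exact: nbhs_dnbhs_neq.
Unshelve. all: by end_near. Qed.

Lemma Ck_coord k n (A : set 'rV[R]_n) (i : 'I_n) : open A -> Ck k A (fun x => x 0 i).
Proof.
move=> oA; case: k => [|k]; split=> //.
- by move=> x _; exact: coord_continuous.
- by move=> x _; exact: coord_continuous.
move=> j; split=> [x _|]; first by have := derive_coord j i x; case.
apply: Ck_eq (Ck_cst k A ((j == i)%:R)) => // x _.
by have := derive_coord j i x; case=> _ ->.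
Qed.

End Calculus.

(** * The chain rule *)

Section Chain.
Variable R : realType.

Lemma is_derive_line (V : normedModType R) (f : V -> R) (y v : V) (s : R) :
  derivable f (y + s *: v) v ->
  is_derive s 1 (fun s => f (y + s *: v)) ('D_v f (y + s *: v)).
Proof.
move=> df.
have E : (fun h : R => h^-1 *: (f (y + (h *: 1 + s) *: v) - f (y + s *: v))) =
         (fun h : R => h^-1 *: (f (h *: v + (y + s *: v)) - f (y + s *: v))).
  apply/funext => h; congr (_ *: (f _ - _)).
  by rewrite scalerDl addrCA [h *: 1]mulr1.
by apply: DeriveDef; rewrite /derivable /derive E.
Qed.

(** Both signs of [a] reduce to the one-dimensional theorem on the segment between 0 and [a]. Of the
    position of [xi] only its size is recorded, which is all that the later estimates use. *)
Lemma mvt_line (V : normedModType R) (f : V -> R) (y v : V) (a : R) :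
  (forall s : R, `|s| <= `|a| -> derivable f (y + s *: v) v) ->
  exists2 xi, `|xi| <= `|a| & f (y + a *: v) - f y = a * 'D_v f (y + xi *: v).
Proof.
move=> df; pose phi (s : R) := f (y + s *: v).
have dphi (s : R) : `|s| <= `|a| -> is_derive s 1 phi ('D_v f (y + s *: v)).
  by move=> /df; exact: is_derive_line.
have cphi (s : R) : `|s| <= `|a| -> {for s, continuous phi}.
  move=> /dphi ds; apply: differentiable_continuous.
  by apply/derivable1_diffP; case: ds.
have -> : f y = phi 0 by rewrite /phi scale0r addr0.
rewrite -/(phi a).
have [a0|a0] := leP 0 a.
  have H (s : R) : s \in `[0, a] -> `|s| <= `|a|.
    by rewrite in_itv /= => /andP[s0 sa]; rewrite !ger0_norm.
  have [||xi xi0 ->] := @MVT_segment R phi (fun s => 'D_v f (y + s *: v)) 0 a a0.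
  - by move=> s sa; apply: dphi; apply: H; apply: subset_itv_oo_cc sa.
  - apply: continuous_in_subspaceT => s /set_mem /= sa; apply: cphi; exact: H.
  by exists xi; [exact: H | rewrite subr0 mulrC].
have H (s : R) : s \in `[a, 0] -> `|s| <= `|a|.
  by rewrite in_itv /= => /andP[s0 sa]; rewrite !ler0_norm ?lerN2 // ltW.
have [||xi xi0 E] := @MVT_segment R phi (fun s => 'D_v f (y + s *: v)) a 0 (ltW a0).
- by move=> s sa; apply: dphi; apply: H; apply: subset_itv_oo_cc sa.
- apply: continuous_in_subspaceT => s /set_mem /= sa; apply: cphi; exact: H.
by exists xi; [exact: H | rewrite -opprB E sub0r mulrN opprK mulrC].
Qed.

Lemma coord_le_norm n (w : 'rV[R]_n) l : `|w 0 l| <= `|w|.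
Proof.
rewrite [leRHS]/Num.Def.normr /= mx_normrE.
by apply: (le_bigmax _ (fun i => `|w i.1 i.2|) (0, l)).
Qed.

(** The corners of the staircase from 0 to [w] that changes one coordinate at a time. *)
Definition trunc_row n (w : 'rV[R]_n) (k : nat) : 'rV[R]_n :=
  \row_i (if (i < k)%N then w 0 i else 0).

Lemma trunc_row_norm n (w : 'rV[R]_n) (k : 'I_n) xi :
  `|xi| <= `|w 0 k| -> `|trunc_row w k + xi *: delta_mx 0 k| <= `|w|.
Proof.
move=> hxi; rewrite [leLHS]/Num.Def.normr /= mx_normrE.
apply: bigmax_le => // -[i j] _; rewrite !mxE /= ord1 eqxx /=.
have [->|jk] := eqVneq j k; first by rewrite ltnn mulr1 add0r (le_trans hxi) ?coord_le_norm.
by rewrite mulr0 addr0; case: ifP => _; rewrite ?normr0 ?coord_le_norm.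
Qed.

Lemma littleo_differentiable (V W : normedModType R) (f : V -> W) (x : V)
  (df : {linear V -> W}) : continuous df ->
  (forall e : R, 0 < e -> \forall h \near (0 : V), `|f (h + x) - f x - df h| <= e * `|h|) ->
  differentiable f x.
Proof.
move=> cdf H.
have key : f \o shift x = cst (f x) + df +o_ 0 id.
  apply/eqaddoP => e e0; near=> h.
  have -> : (f \o shift x - (cst (f x) + df)) h = f (h + x) - f x - df h.
    by rewrite -addrA -opprD.
  by near: h; exact: H.
by apply/diff_locallyP; rewrite (diff_unique cdf key).
Unshelve. all: by end_near. Qed.

(** The increment is split along the staircase of [trunc_row]; on each edge the mean value theorem
    trades it for a partial derivative at a nearby point, which is close to the one at [z] by
    continuity. *)
Lemma C1_differentiable n (f : 'rV[R]_n -> R) (z : 'rV[R]_n) :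
  (forall i : 'I_n, \forall y \near z, derivable f y (delta_mx 0 i)) ->
  (forall i : 'I_n, {for z, continuous ('D_(delta_mx 0 i) f)}) ->
  differentiable f z.
Proof.
move=> df cf.
pose L (w : 'rV[R]_n) := \sum_i w 0 i * 'D_(delta_mx 0 i) f z.
have Ll : linear L.
  move=> a u v; rewrite /L scaler_sumr -big_split /=; apply: eq_bigr => i _.
  by rewrite !mxE mulrDl -mulrA.
pose df' : {linear 'rV[R]_n -> R} := HB.pack L (GRing.isLinear.Build _ _ _ _ L Ll).
have cL : continuous df'.
  have [cL _] : Ck 0 setT L.
    by apply: Ck_sum => [|i]; first exact: openT; apply: Ck_mul;
      [exact: openT | apply: Ck_coord; exact: openT | exact: Ck_cst].
  by move=> x; apply: cL.
apply: (littleo_differentiable cL) => e e0.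
  (* The tolerance is shared among [n] edges; [n.+1] also covers [n = 0]. *)
  have n0 : 0 < n.+1%:R :> R by [].
  have de : 0 < e / n.+1%:R by rewrite divr_gt0.
  pose P (i : 'I_n) := [set y | derivable f y (delta_mx 0 i) /\
      `|'D_(delta_mx 0 i) f z - 'D_(delta_mx 0 i) f y| <= e / n.+1%:R].
  have near1 : nbhs z (fun y => forall i : 'I_n, P i y).
    refine (filter_forall (nbhs_filter z) _) => i.
    have h2 := (@cvgrPdist_le _ _ _ _ (nbhs_filter z) _ _).1 (cf i) _ de.
    exact: (filterI (df i) h2).
  have [d d0 hd] := (nbhs_ballP _ _).1 near1.
  apply/nbhs_ballP; exists d => //= w; rewrite mx_norm_ball /ball_ /= sub0r normrN => wd.
  have inb (xi : R) (k : 'I_n) : `|xi| <= `|w 0 k| -> forall i : 'I_n,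
      derivable f (z + trunc_row w k + xi *: delta_mx 0 k) (delta_mx 0 i) /\
      `|'D_(delta_mx 0 i) f z - 'D_(delta_mx 0 i) f (z + trunc_row w k + xi *: delta_mx 0 k)| <= e / n.+1%:R.
    move=> hxi; apply: hd; rewrite mx_norm_ball /ball_ /= -addrA opprD addrA subrr sub0r normrN.
    exact: le_lt_trans (trunc_row_norm hxi) wd.
  have step (k : 'I_n) :
    `|f (z + trunc_row w k.+1) - f (z + trunc_row w k) - w 0 k * 'D_(delta_mx 0 k) f z|
      <= `|w| * (e / n.+1%:R).
    have -> : z + trunc_row w k.+1 = z + trunc_row w k + w 0 k *: delta_mx 0 k.
      rewrite -addrA; congr (_ + _); apply/rowP => i; rewrite !mxE eqxx /= ltnS leq_eqVlt.
      have [->|ik] := eqVneq i k; first by rewrite eqxx ltnn add0r mulr1.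
      by rewrite (negbTE (ik : val i != val k)) /= mulr0 addr0.
    have [xi hxi ->] := @mvt_line _ f (z + trunc_row w k) (delta_mx 0 k) (w 0 k)
      (fun s hs => (inb s k hs k).1).
    rewrite -mulrBr normrM ler_pM // ?coord_le_norm // distrC.
    exact: (inb xi k hxi k).2.
  rewrite /=.
  have -> : f (w + z) - f z - L w =
     \sum_(k < n) (f (z + trunc_row w k.+1) - f (z + trunc_row w k) - w 0 k * 'D_(delta_mx 0 k) f z).
    rewrite sumrB -[X in _ - X]/(L w).
    rewrite -(big_mkord xpredT (fun k => f (z + trunc_row w k.+1) - f (z + trunc_row w k))).
    rewrite telescope_sumr //.
    have -> : trunc_row w n = w by apply/rowP => i; rewrite mxE ltn_ord.
    have -> : trunc_row w 0 = 0 by apply/rowP => i; rewrite !mxE.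
    by rewrite addr0 [w + z]addrC.
  apply: le_trans (ler_norm_sum _ _ _) _.
  apply: (@le_trans _ _ (\sum_(k < n) `|w| * (e / n.+1%:R))); first exact: ler_sum.
  rewrite sumr_const card_ord -mulrnAr [leRHS]mulrC.
  by rewrite ler_wpM2l // -mulr_natr -mulrA ger_pMr // mulrC ler_pdivrMr // mul1r ler_nat.
Unshelve. all: by end_near. Qed.

Lemma diff_coords n (f : 'rV[R]_n -> R) z w : differentiable f z ->
  'd f z w = \sum_i w 0 i * 'D_(delta_mx 0 i) f z.
Proof.
move=> df; rewrite {1}[w]row_sum_delta linear_sum; apply: eq_bigr => i _.
by rewrite linearZ /= deriveE.
Qed.

(** Only the line through [x] in direction [v] matters: restricted to it the composite is [f] after
    a curve [p], so derivability of the [g i] along [v] suffices. *)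
Lemma chain_rule (V : normedModType R) n (f : 'rV[R]_n -> R) (g : 'I_n -> V -> R) (x v : V) :
  differentiable f (\row_i g i x) -> (forall i, derivable (g i) x v) ->
  is_derive x v (fun y => f (\row_i g i y)) (\sum_i 'D_v (g i) x * 'D_(delta_mx 0 i) f (\row_i g i x)).
Proof.
move=> df dg.
pose p (h : R) : 'rV[R]_n := \row_i g i (x + h *: v).
have p0 : p 0 = \row_i g i x by apply/rowP => i; rewrite !mxE scale0r addr0.
have dgi i : is_derive (0:R) 1 (fun h : R => g i (x + h *: v)) ('D_v (g i) x).
  have := @is_derive_line _ (g i) x v 0; rewrite scale0r addr0; apply; exact: dg.
have dp : derivable p 0 1.
  apply/derivable_mxP => i j; rewrite /p.
  have -> : (fun h => (\row_i g i (x + h *: v)) i j) = (fun h : R => g j (x + h *: v)).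
    by apply/funext => h; rewrite mxE.
  by case: (dgi j).
have Dp : 'D_1 p 0 = \row_i 'D_v (g i) x.
  rewrite derive_mx //; apply/rowP => i; rewrite !mxE.
  have -> : (fun h => p h 0 i) = (fun h : R => g i (x + h *: v)).
    by apply/funext => h; rewrite mxE.
  by case: (dgi i).
have ddp : differentiable p 0 by apply/derivable1_diffP.
have df0 : differentiable f (p 0) by rewrite p0.
have dfp : differentiable (f \o p) 0 by apply: differentiable_comp.
have E : (fun h : R => h^-1 *: (f (\row_i g i (h *: v + x)) - f (\row_i g i x))) =
         (fun h : R => h^-1 *: ((f \o p) (h *: 1 + 0) - (f \o p) 0)).
  apply/funext => h; rewrite /= p0; congr (_ *: (f _ - _)).
  by apply/rowP => i; rewrite !mxE addr0 addrC [h *: 1]mulr1.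
have D1 : derivable (f \o p) 0 1 by apply: diff_derivable.
apply: DeriveDef; rewrite /derivable /derive E //.
rewrite -[LHS]/('D_1 (f \o p) 0) deriveE // diff_comp // /=.
rewrite diff_coords // -deriveE // Dp p0; apply: eq_bigr => i _; by rewrite mxE.
Qed.

End Chain.

(** * Compositions, inverses and families stable under differentiation *)

Section Composition.
Variable R : realType.

Lemma cvg_row (T : Type) (F : set_system T) (FF : Filter F) m (g : 'I_m -> T -> R) (l : 'I_m -> R) :
  (forall i, g i @ F --> l i) -> (fun x => \row_i g i x : 'rV[R]_m) @ F --> (\row_i l i : 'rV[R]_m).
Proof.
move=> gl; apply/cvgrPdist_lt => e e0.
pose P (i : 'I_m) := [set x | `|l i - g i x| < e].
have H : F (fun x => forall i, P i x).
  apply: filter_forall => i.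
  exact: (@cvgrPdist_lt _ _ _ _ FF _ _).1 (gl i) _ e0.
apply: filterS H => x Px; rewrite [ltLHS]/Num.Def.normr /= mx_normrE.
by apply: bigmax_lt => // -[i j] _; rewrite !mxE; exact: Px.
Qed.

Lemma Ck1_differentiable k n (A : set 'rV[R]_n) (f : 'rV[R]_n -> R) x :
  open A -> A x -> Ck k.+1 A f -> differentiable f x.
Proof.
move=> oA Ax [_ hf]; apply: C1_differentiable => i.
  apply: filterS (open_nbhs_nbhs (conj oA Ax)) => y Ay.
  exact: (hf i).1.
have [_ c] := hf i.
by have [c0 _] := Ck_le (leq0n k) c; exact: c0.
Qed.

Lemma Ck_comp k n m (A : set 'rV[R]_n) (B : set 'rV[R]_m) (f : 'rV[R]_m -> R)
  (g : 'I_m -> 'rV[R]_n -> R) :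
  open A -> open B -> (forall i, Ck k A (g i)) -> Ck k B f ->
  (forall x, A x -> B (\row_i g i x)) -> Ck k A (fun x => f (\row_i g i x)).
Proof.
move=> oA oB; elim: k f g => [|k IH] f g hg hf AB.
  split=> // x Ax.
  have c1 : {for x, continuous (fun x => \row_i g i x : 'rV[R]_m)}.
    by apply: (@cvg_row _ (nbhs x) (nbhs_filter x) _ g (g^~ x)) => i; have [c _] := hg i; exact: c.
  apply: (@continuous_comp _ _ _ (fun x => \row_i g i x : 'rV[R]_m) f) => //.
  by have [c _] := hf; apply: c; exact: AB.
have h0 := IH f g (fun i => Ck_le (leqnSn k) (hg i)) (Ck_le (leqnSn k) hf) AB.
have D x j : A x -> is_derive x (delta_mx 0 j) (fun x => f (\row_i g i x))
    (\sum_i 'D_(delta_mx 0 j) (g i) x * 'D_(delta_mx 0 i) f (\row_i g i x)).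
  move=> Ax; apply: chain_rule; first exact: Ck1_differentiable oB (AB _ Ax) hf.
  by move=> i; have [_ /(_ j)[d _]] := hg i; exact: d.
split; first by have [c _] := Ck_le (leq0n k) h0.
move=> j; split=> [x Ax|]; first by case: (D x j Ax).
have S : Ck k A (fun x => \sum_i 'D_(delta_mx 0 j) (g i) x * 'D_(delta_mx 0 i) f (\row_i g i x)).
  refine (Ck_sum oA _) => i; apply: Ck_mul => //; first by have [_ /(_ j)[]] := hg i.
  refine (IH ('D_(delta_mx 0 i) f) g _ _ AB); first by move=> l; exact: Ck_le (leqnSn k) (hg l).
  by have [_ /(_ i)[]] := hf.
by apply: Ck_eq S => // x Ax; case: (D x j Ax).
Qed.

Lemma Ck_inv k n (A : set 'rV[R]_n) (f : 'rV[R]_n -> R) :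
  open A -> (forall x, A x -> f x != 0) -> Ck k A f -> Ck k A (fun x => (f x)^-1).
Proof.
move=> oA f0; elim: k => [|k IH] hf.
  by split=> // x Ax; have [c _] := hf; apply: continuousV; [exact: f0|exact: c].
have h0 := IH (Ck_le (leqnSn k) hf).
split; first by have [c _] := Ck_le (leq0n k) h0.
move=> j; have [_ /(_ j)[d c]] := hf; split=> [x Ax|].
  by apply: derivableV; [exact: f0|exact: d].
have S := Ck_mul oA (Ck_mul oA (Ck_cst k A (-1)) (Ck_mul oA h0 h0)) c.
apply: Ck_eq S => // x Ax.
rewrite deriveV; [|exact: f0|exact: d].
by rewrite -mulrA mulN1r -invfM -expr2 -mulNr.
Qed.

(** If the derivative of each member of a family is again in the family, all members are smooth and
    no formula for higher derivatives is needed; the induction therefore runs over all indices [l]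
    at once. *)
Lemma Ck_family k n (A : set 'rV[R]_n) (i : 'I_n) (I : Type) (f : I -> R -> R) (d : I -> I) (l : I) :
  open A -> (forall l (s : R), is_derive s 1 (f l) (f (d l) s)) ->
  Ck k A (fun x => f l (x 0 i)).
Proof.
move=> oA hf.
have df l' s : differentiable (f l') s by apply/derivable1_diffP; case: (hf l' s).
have D l' x j : is_derive x (delta_mx 0 j) (fun x : 'rV[R]_n => f l' (x 0 i)) ((j == i)%:R * f (d l') (x 0 i)).
  have dc : differentiable (fun y : 'rV[R]_n => y 0 i) x by exact: differentiable_coord.
  have dd : differentiable (f l' \o (fun y : 'rV[R]_n => y 0 i)) x by exact: differentiable_comp.
  apply: DeriveDef; first exact: diff_derivable.
  rewrite deriveE // -[fun x => _]/(f l' \o (fun y : 'rV[R]_n => y 0 i)) diff_comp //=.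
  have -> : 'd (fun y : 'rV[R]_n => y 0 i) x (delta_mx 0 j) = (j == i)%:R.
    by rewrite -deriveE //; case: (derive_coord j i x).
  rewrite -[(j == i)%:R in LHS]mulr1 linearZ /= -deriveE //.
  by have [_ ->] := hf l' (x 0 i).
have C l' : {in A, continuous (fun x : 'rV[R]_n => f l' (x 0 i))}.
  move=> x _; apply: (@continuous_comp _ _ _ (fun y : 'rV[R]_n => y 0 i)).
    exact: coord_continuous.
  exact: differentiable_continuous.
elim: k l => [|k IH] l; split=> //.
- by move=> x /mem_set; exact: C.
- by move=> x /mem_set; exact: C.
move=> j; split=> [x Ax|]; first by case: (D l x j).
apply: Ck_eq (Ck_mul oA (Ck_cst k A (j == i)%:R) (IH (d l))) => // x _.
by case: (D l x j).
Qed.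

End Composition.

(** * Bump functions *)

Section Bump.
Variable R : realType.

(* The functions p(1/s) e^{-1/s} extended by 0 to s <= 0 are closed under
   differentiation. *)
Definition flat (p : {poly R}) (s : R) : R :=
  if 0 < s then p.[s^-1] * expR (- s^-1) else 0.

(** With w = 1/s one has d/ds = - w^2 d/dw, which sends p(w) e^{-w} to w^2 (p - dp/dw)(w) e^{-w}. *)
Definition flat_deriv (p : {poly R}) : {poly R} := 'X^2 * (p - p^`()).

(** Monomial by monomial, from w^(i+2) / (i+2)! <= e^w. The two extra powers make [flat p]
    quadratically small at 0, hence differentiable there with derivative 0. *)
Lemma poly_expR_bound (p : {poly R}) :
  exists2 K, 0 <= K & forall w : R, 0 < w -> `|p.[w] * expR (- w)| <= K / w ^+ 2.
Proof.
pose K := \sum_(i < size p) `|p`_i| * (i.+2)`!%:R.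
have K0 : 0 <= K by apply: sumr_ge0 => i _; rewrite mulr_ge0.
exists K => // w w0; rewrite horner_coef mulr_suml /K mulr_suml.
apply: le_trans (ler_norm_sum _ _ _) _; apply: ler_sum => i _.
rewrite -!mulrA normrM ler_wpM2l // normrM gtr0_norm ?exprn_gt0 // gtr0_norm ?expR_gt0 //.
rewrite expRN ler_pdivrMr ?expR_gt0 // mulrAC ler_pdivlMr ?exprn_gt0 // -exprD.
have := expR_ge1Dxn i.+1 (ltW w0).
rewrite addn2 => h; rewrite -ler_pdivrMl ?ltr0n ?fact_gt0 // mulrC.
by apply: le_trans _ h; rewrite lerDr.
Qed.

Lemma flat_small (p : {poly R}) :
  exists2 K, 0 <= K & forall s : R, `|flat p s| <= K * s ^+ 2.
Proof.
have [K K0 hK] := poly_expR_bound p; exists K => // s; rewrite /flat.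
case: ifP => s0; last by rewrite normr0 mulr_ge0 // sqr_ge0.
by have := hK s^-1; rewrite invr_gt0 exprVn invrK; apply.
Qed.

Lemma is_derive_flat (p : {poly R}) (s : R) : is_derive s 1 (flat p) (flat (flat_deriv p) s).
Proof.
have [s0|s0|s0] := ltgtP 0 s.
- have d1 : is_derive s 1 (fun y : R => y^-1) (- s ^- 2 *: 1).
    by apply: is_deriveV; rewrite gt_eqF.
  have d2 : is_derive s 1 (horner p \o (fun y : R => y^-1)) (p^`().[s^-1] * (- s ^- 2 *: 1)).
    exact: is_derive1_comp.
  have d3 : is_derive s 1 (fun y : R => - y^-1) (s ^- 2).
    have := is_deriveN d1; rewrite scaleNr opprK [_ *: 1]mulr1; exact.
  have d4 : is_derive s 1 (expR \o (fun y : R => - y^-1)) (expR (- s^-1) * (s ^- 2)).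
    exact: is_derive1_comp.
  have d5 := is_deriveM d2 d4.
  have near_flat : \forall y \near s, p.[y^-1] * expR (- y^-1) = flat p y.
    apply: filterS (lt_nbhsr s0) => y; by rewrite /flat /= => ->.
  apply: near_eq_is_derive near_flat _.
  apply: is_derive_eq d5 _.
  rewrite /flat s0 /flat_deriv !hornerE /= /GRing.scale /= exprVn; ring.
- have near_flat : \forall y \near s, 0 = flat p y.
    apply: filterS (lt_nbhsl s0) => y /= y0; by rewrite /flat ltNge ltW.
  apply: near_eq_is_derive near_flat _.
  rewrite /flat ltNge ltW //=; exact: is_derive_cst.
(* At 0 the difference quotient is at most K |h|; dividing by [K + 1] below guards against K = 0. *)
- subst s; have [K K0 hK] := flat_small p.
  rewrite {2}/flat ltxx.
  have L : h^-1 *: (flat p (h *: 1 + 0) - flat p 0) @[h --> 0^'] --> (0 : R).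
    apply/cvgrPdist_le => e e0.
    have de : 0 < e / (K + 1) by rewrite divr_gt0 // ltr_wpDl.
    near=> h.
    have h0 : h != 0 by near: h; exact: nbhs_dnbhs_neq.
    rewrite sub0r normrN addr0 {2}/flat ltxx subr0 [h *: 1]mulr1 normrM normfV.
    rewrite mulrC ler_pdivrMr ?normr_gt0 //.
    apply: le_trans (hK h) _; rewrite -[h ^+ 2]ger0_norm ?sqr_ge0 // normrX.
    rewrite expr2 mulrA ler_wpM2r //.
    have hle : `|h| <= e / (K + 1) by near: h; exact: dnbhs0_le.
    apply: le_trans (ler_wpM2l K0 hle) _.
    by rewrite mulrCA ger_pMr // ler_pdivrMr ?mul1r ?lerDl // ltr_wpDl.
  by apply: DeriveDef; [apply/cvg_ex; exists 0 | apply/cvg_lim].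
Unshelve. all: by end_near. Qed.

Definition flat1 (s : R) : R := if 0 < s then expR (- s^-1) else 0.

Lemma flat1_gt0 s : 0 < s -> 0 < flat1 s.
Proof. by move=> s0; rewrite /flat1 s0 expR_gt0. Qed.

Lemma flat1_ge0 s : 0 <= flat1 s.
Proof. by rewrite /flat1; case: ifP => // _; exact: expR_ge0. Qed.

Lemma flat1_eq0 s : s <= 0 -> flat1 s = 0.
Proof. by rewrite /flat1 leNgt; case: ifP. Qed.

Lemma Ck_flat1 k n (f : 'rV[R]_n -> R) : Ck k setT f -> Ck k setT (fun x => flat1 (f x)).
Proof.
move=> hf.
have h1 : Ck k setT (fun x : 'rV[R]_1 => flat 1%:P (x 0 0)).
  exact: (Ck_family _ _ _ openT is_derive_flat).
have := @Ck_comp R k n 1 setT setT _ (fun=> f) openT openT (fun=> hf) h1 (fun _ _ => I).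
apply: Ck_eq openT _ => x _; rewrite mxE /flat /flat1 hornerC mul1r //.
Qed.

(** With q the squared distance to [u], the numerator vanishes for q >= 4c = r^2, and for q <= c the
    second summand of the denominator vanishes, so the quotient is 1. At every point one of the two
    summands is positive. *)
Lemma bump n (u : 'rV[R]_n) (r : R) : 0 < r ->
  exists (b : 'rV[R]_n -> R) (r1 : R), [/\ Cinfty setT b, 0 < r1,
    forall x : 'rV[R]_n, (forall i, `|x 0 i - u 0 i| < r1) -> b x = 1 &
    forall x : 'rV[R]_n, b x != 0 -> forall i, `|x 0 i - u 0 i| < r].
Proof.
move=> r0.
pose q (x : 'rV[R]_n) := \sum_i ((x 0 i - u 0 i) * (x 0 i - u 0 i)).
pose c := r ^+ 2 / 4.
have c0 : 0 < c by rewrite divr_gt0 ?exprn_gt0.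
have q0 (x : 'rV[R]_n) i : (x 0 i - u 0 i) ^+ 2 <= q x.
  rewrite /q (bigD1 i) //= -expr2 lerDl; apply: sumr_ge0 => j _.
  by rewrite -expr2 sqr_ge0.
have dpos (x : 'rV[R]_n) : 0 < flat1 (4 * c - q x) + flat1 (q x - c).
  have [h|h] := ltP c (q x).
    by rewrite ltr_wpDl ?flat1_ge0 // flat1_gt0 // subr_gt0.
  by rewrite ltr_wpDr ?flat1_ge0 // flat1_gt0 //; lra.
exists (fun x => flat1 (4 * c - q x) * (flat1 (4 * c - q x) + flat1 (q x - c))^-1).
have n1 : 0 < n.+1%:R :> R by [].
(* If all coordinates are within this radius, q is at most n r^2 / (4 (n+1)^2) <= r^2 / 4 = c. *)
exists (r / (2 * n.+1%:R)); split.
- move=> k.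
  have hq : Ck k setT q.
    refine (Ck_sum openT _) => i.
    have hi : Ck k setT (fun x => x 0 i - u 0 i).
      exact: Ck_add openT (Ck_coord _ _ openT) (Ck_cst _ _ _).
    exact: (Ck_mul openT hi hi).
  have hqN : Ck k setT (fun x => - q x).
    apply: Ck_eq (Ck_mul openT (Ck_cst k setT (-1)) hq); first exact: openT.
    by move=> x _; rewrite mulN1r.
  have h1 : Ck k setT (fun x => flat1 (4 * c - q x)).
    exact: Ck_flat1 (Ck_add openT (Ck_cst _ _ _) hqN).
  have h2 : Ck k setT (fun x => flat1 (q x - c)).
    exact: Ck_flat1 (Ck_add openT hq (Ck_cst _ _ _)).
  apply: Ck_mul openT h1 (Ck_inv openT _ (Ck_add openT h1 h2)) => x _.
  by rewrite gt_eqF.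
- by rewrite divr_gt0 // mulr_gt0.
- move=> x hx.
  have qc : q x <= c.
    apply: (@le_trans _ _ (\sum_(i < n) (r / (2 * n.+1%:R)) ^+ 2)).
      apply: ler_sum => i _; rewrite -expr2 -[leLHS]ger0_norm ?sqr_ge0 // normrX.
      have hi := ltW (hx i).
      by rewrite lerXn2r // nnegrE; apply: le_trans hi.
    rewrite sumr_const card_ord /c -[_ *+ n]mulr_natr expr_div_n exprMn -mulrA.
    apply: ler_wpM2l; first exact: sqr_ge0.
    rewrite invfM -mulrA; have -> : 2 ^+ 2 = 4 :> R by rewrite -natrX.
    rewrite ger_pMr ?invr_gt0 // mulrC ler_pdivrMr ?exprn_gt0 // mul1r.
    rewrite -natrX ler_nat; apply: leq_trans (leqnSn n) _; by rewrite -{1}[n.+1]expn1 leq_pexp2l.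
  rewrite (flat1_eq0 (s := q x - c)) ?subr_le0 // addr0 divff // gt_eqF // flat1_gt0 //.
  lra.
- move=> x; rewrite mulf_eq0 negb_or => /andP[+ _] i.
  have [h|h] := ltP (q x) (4 * c); last by rewrite flat1_eq0 ?eqxx // subr_le0.
  have := le_lt_trans (q0 x i) h; rewrite /c mulrC divfK // => h2 _.
  have : `|x 0 i - u 0 i| ^+ 2 < r ^+ 2 by rewrite -normrX ger0_norm ?sqr_ge0.
  by rewrite ltr_pXn2r // nnegrE ltW.
Qed.

(** [generated] wants functions that are smooth on the whole space, so 1/z is multiplied by 1 - b
    with b a bump at 0 that vanishes outside radius |z0| / 2: the product is 0 near the pole and
    equals 1/z near [z0]. *)
Lemma Cinfty_inv_germ (z0 : R) : z0 != 0 ->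
  exists2 F : 'rV[R]_1 -> R, Cinfty setT F &
    exists2 e, 0 < e & forall z : 'rV[R]_1, `|z 0 0 - z0| < e -> F z = (z 0 0)^-1.
Proof.
move=> z00; have r0 : 0 < `|z0| / 2 by rewrite divr_gt0 ?normr_gt0.
have [b [r1 [hb r10 b1 b0]]] := bump (0 : 'rV[R]_1) r0.
exists (fun z => (1 - b z) * (z 0 0)^-1); last first.
  exists (`|z0| / 2) => // z hz.
  have [->|bz] := eqVneq (b z) 0; first by rewrite subr0 mul1r.
  have := b0 _ bz 0; rewrite mxE subr0 => h.
  have := ler_normB (z 0 0) (z 0 0 - z0); rewrite subKr => h2; lra.
move=> k; apply: Ck_local => z _.
have hN : Ck k setT (fun z => 1 - b z).
  apply: Ck_add openT (Ck_cst _ _ _) _.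
  apply: Ck_eq (Ck_mul openT (Ck_cst k setT (-1)) (hb k)); first exact: openT.
  by move=> x _; rewrite mulN1r.
have [z1|z1] := eqVneq (z 0 0) 0.
  pose B := [set x : 'rV[R]_1 | `|x 0 0| < r1].
  have oB : open B.
    rewrite openE => x /= Bx; apply/nbhs_ballP; exists (r1 - `|x 0 0|) => /=.
      by rewrite subr_gt0.
    move=> y; rewrite mx_norm_ball /ball_ /= => hy.
    have := le_lt_trans (coord_le_norm (x - y) 0) hy; rewrite !mxE => h.
    rewrite /B /=; have := ler_normB (x 0 0) (x 0 0 - y 0 0); rewrite subKr; lra.
  exists B; first by rewrite /B /= z1 normr0.
  apply: Ck_eq oB _ (Ck_cst k B 0) => x Bx; rewrite b1 ?subrr ?mul0r //.
  by move=> i; rewrite mxE subr0 ord1.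
pose B := [set x : 'rV[R]_1 | x 0 0 != 0].
have oB : open B.
  rewrite openE => x /= Bx; apply/nbhs_ballP; exists (`|x 0 0|) => /=.
    by rewrite normr_gt0.
  move=> y; rewrite mx_norm_ball /ball_ /= => hy.
  have := le_lt_trans (coord_le_norm (x - y) 0) hy; rewrite !mxE => h.
  by rewrite /B /=; apply/eqP => y0; move: h; rewrite y0 subr0 ltxx.
exists B => //; apply: Ck_mul oB (Ck_sub (@subsetT _ _) hN) (Ck_inv oB _ (Ck_coord _ _ oB)).
by move=> x.
Qed.

End Bump.

(** * Hadamard's lemma *)

Section Hadamard.
Variable R : realType.

Let I01 : set R := `[0%R, 1%R]%classic.
Definition int01 (f : R -> R) : R := (\int[@lebesgue_measure R]_(s in I01) f s)%R.

Lemma continuous_scale (c : R) (f : R -> R) : continuous f -> continuous (fun s : R => c * f s).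
Proof. by move=> cf s; apply: continuousM; [exact: cst_continuous|exact: cf]. Qed.

Lemma continuous_add (f g : R -> R) : continuous f -> continuous g ->
  continuous (fun s : R => f s + g s).
Proof. by move=> cf cg s; apply: continuousD; [exact: cf|exact: cg]. Qed.

Lemma int01_integrable (f : R -> R) : continuous f ->
  (@lebesgue_measure R).-integrable I01 (EFin \o f).
Proof.
move=> cf; apply: continuous_compact_integrable; first exact: segment_compact.
exact: continuous_subspaceT.
Qed.

Lemma int01_measurable : measurable I01. Proof. exact: measurable_itv. Qed.

Lemma int01_cst (c : R) : int01 (fun=> c) = c.
Proof.
rewrite /int01 Rintegral_cst; last exact: int01_measurable.
have h := @lebesgue_measure_itv R `[0, 1].
rewrite [X in fine X](_ : _ = 1%E) ?mulr1 //.
by apply: etrans h _; rewrite /= lte_fin ltr01 oppr0 adde0.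
Qed.

Lemma int01D (f g : R -> R) : continuous f -> continuous g ->
  int01 (fun s => f s + g s) = int01 f + int01 g.
Proof.
move=> cf cg; apply: RintegralD; [exact: int01_measurable| |]; exact: int01_integrable.
Qed.

Lemma int01Zl (c : R) (f : R -> R) : continuous f -> int01 (fun s => c * f s) = c * int01 f.
Proof. move=> cf; apply: RintegralZl; [exact: int01_measurable|exact: int01_integrable]. Qed.

(** Uniform estimates on [0, 1], supplied by [ray_tube], stand in for dominated convergence. *)
Lemma int01_close (f g : R -> R) (e : R) : continuous f -> continuous g ->
  (forall s, 0 <= s <= 1 -> `|f s - g s| <= e) -> `|int01 f - int01 g| <= e.
Proof.
move=> cf cg fg.
have cfg : continuous (fun s : R => f s - g s) by move=> s; apply: continuousB; [exact: cf|exact: cg].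
have cn : continuous (fun s : R => `|f s - g s|).
  by move=> s; apply: (continuous_comp (cfg s)); exact: norm_continuous.
have -> : int01 f - int01 g = int01 (fun s => f s - g s).
  by rewrite /int01 RintegralB; [|exact: int01_measurable|exact: int01_integrable|exact: int01_integrable].
have h : `|int01 (fun s => f s - g s)| <= int01 (fun s => `|f s - g s|).
  by apply: le_normr_Rintegral; [exact: int01_measurable|exact: int01_integrable].
apply: (le_trans h); rewrite -[leRHS]int01_cst; apply: le_Rintegral; first exact: int01_measurable.
- exact: int01_integrable.
- by apply: int01_integrable => s; exact: cst_continuous.
- by move=> s; rewrite /I01 /= in_itv /=; exact: fg.
Qed.

Lemma int01_FTC (F f : R -> R) : continuous f -> (forall s : R, is_derive s 1 F (f s)) ->
  int01 f = F 1 - F 0.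
Proof.
move=> cf dF; rewrite /int01 /Rintegral.
have cF : continuous F.
  move=> s; apply: differentiable_continuous; apply/derivable1_diffP.
  by case: (dF s).
have -> : (\int[lebesgue_measure]_(x in I01) (f x)%:E)%E = ((F 1)%:E - (F 0)%:E)%E; last by [].
apply: continuous_FTC2.
- exact: ltr01.
- exact: continuous_subspaceT.
- split; [by move=> s _; case: (dF s)| |].
  + exact: (cvg_at_right_filter (cF 0)).
  + exact: (cvg_at_left_filter (cF 1)).
- by move=> s _; rewrite derive1E; case: (dF s).
Qed.

Variables (n : nat) (a : 'rV[R]_n).

Definition ray (z : 'rV[R]_n) (s : R) : 'rV[R]_n := a + s *: (z - a).

Lemma ray_continuous2 (G : 'rV[R]_n -> R) (z : 'rV[R]_n) (s : R) : continuous G ->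
  (fun p : R * 'rV[R]_n => G (ray p.2 p.1)) @ (s, z) --> G (ray z s).
Proof.
move=> cG; apply: (@cvg_comp _ _ _ (fun p : R * 'rV[R]_n => ray p.2 p.1) G); last exact: cG.
apply: cvgD; first exact: cvg_cst.
apply: cvgZ; first exact: cvg_fst.
by apply: cvgB; [exact: cvg_snd | exact: cvg_cst].
Qed.

Lemma ray_continuous (G : 'rV[R]_n -> R) (z : 'rV[R]_n) : continuous G ->
  continuous (fun s : R => G (ray z s)).
Proof.
move=> cG s; apply: (@cvg_comp _ _ _ (ray z) G); last exact: cG.
apply: cvgD; first exact: cvg_cst.
by apply: cvgZr_tmp; exact: cvg_id.
Qed.

(** Compactness of [0, 1] makes the neighbourhood of [z] independent of [s]. Locally in [s] both
    values are compared with the one at a fixed centre, whence the two halves of [e]. *)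
Lemma ray_tube (G : 'rV[R]_n -> R) (z : 'rV[R]_n) (e : R) : continuous G -> 0 < e ->
  \forall z' \near z, forall s, 0 <= s <= 1 -> `|G (ray z' s) - G (ray z s)| <= e.
Proof.
move=> cG e0.
have cK := (compact_near_coveringP I01).1 (@segment_compact _ 0 1).
have H : nbhs z (fun z' => I01 `<=` (fun s => `|G (ray z' s) - G (ray z s)| <= e)).
  apply: (cK _ (nbhs z) (fun z' s => `|G (ray z' s) - G (ray z s)| <= e) (nbhs_filter z)) => s _.
  have e2 : 0 < e / 2 by rewrite divr_gt0.
  have h1 := (@cvgrPdist_le _ _ _ _ (nbhs_filter _) _ _).1 (@ray_continuous2 G z s cG) _ e2.
  have h2 : \forall p \near (s, z), `|G (ray z s) - G (ray z p.1)| <= e / 2.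
    have h := (@cvgrPdist_le _ _ _ _ (nbhs_filter _) _ _).1 (@ray_continuous G z cG s) _ e2.
    have c1 : fst @ nbhs ((s, z) : R * 'rV[R]_n) --> nbhs s by exact: cvg_fst.
    exact: (c1 _ h).
  near=> p.
  have -> : G (ray p.2 p.1) - G (ray z p.1) = (G (ray z s) - G (ray z p.1)) - (G (ray z s) - G (ray p.2 p.1)) by ring.
  rewrite (le_trans (ler_normB _ _)) // [e]splitr lerD //; near: p; [exact: h2|exact: h1].
apply: (@filterS _ (nbhs z) (nbhs_filter z) _ _ _ H) => z' hz' s hs.
by apply: hz'; rewrite /I01 /= in_itv.
Unshelve. all: by end_near. Qed.

(* The factor s ^+ l makes the family closed under differentiation. *)
Definition ray_mean (l : nat) (g : 'rV[R]_n -> R) (z : 'rV[R]_n) : R :=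
  int01 (fun s => s ^+ l * g (ray z s)).

Lemma ray_mean_continuous_integrand l (g : 'rV[R]_n -> R) z : continuous g ->
  continuous (fun s : R => s ^+ l * g (ray z s)).
Proof.
move=> cg s; apply: (@continuousM _ _ (fun s : R => s ^+ l)); first exact: exprn_continuous.
exact: ray_continuous.
Qed.

Lemma exprn01 (l : nat) (s : R) : 0 <= s <= 1 -> `|s ^+ l| <= 1.
Proof. by move=> /andP[s0 s1]; rewrite normrX ger0_norm // exprn_ile1. Qed.

Lemma ray_mean_continuous l g : continuous g -> continuous (ray_mean l g).
Proof.
move=> cg z; apply/(@cvgrPdist_le _ _ _ _ (nbhs_filter z)) => e e0.
apply: filterS (ray_tube z cg e0) => z' hz'.
apply: int01_close; do ?exact: ray_mean_continuous_integrand.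
move=> s hs; rewrite -mulrBr normrM distrC -[e]mul1r ler_pM //.
- exact: exprn01.
- exact: hz'.
Qed.

(** A point at parameter [s] moves only [s] times as far as the end point; the extra power of [s] in
    the derivative of [ray_mean] comes from here. *)
Lemma ray_shift z j (xi s : R) :
  ray (z + xi *: delta_mx 0 j) s = ray z s + (s * xi) *: delta_mx 0 j.
Proof. by rewrite /ray addrAC scalerDr addrA scalerA. Qed.

Lemma ray_mean_derive l (g : 'rV[R]_n -> R) (j : 'I_n) z :
  continuous g -> (forall y, derivable g y (delta_mx 0 j)) ->
  continuous ('D_(delta_mx 0 j) g) ->
  is_derive z (delta_mx 0 j) (ray_mean l g) (ray_mean l.+1 ('D_(delta_mx 0 j) g) z).
Proof.
move=> cg dg cdg.
suff L : h^-1 *: (ray_mean l g (h *: delta_mx 0 j + z) - ray_mean l g z) @[h --> 0^'] -->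
    ray_mean l.+1 ('D_(delta_mx 0 j) g) z.
  by apply: DeriveDef; [apply/cvg_ex; eexists; exact: L | apply/cvg_lim].
apply/cvgrPdist_le => e e0.
have [d /= d0 hd] := (nbhs_ballP _ _).1 (ray_tube z cdg e0).
near=> h.
have h0 : h != 0 by near: h; exact: nbhs_dnbhs_neq.
have hh : `|h| < d by near: h; exact: dnbhs0_lt.
have ci := ray_mean_continuous_integrand.
rewrite distrC -[_ *: _]/(h^-1 * _).
have -> : h^-1 * (ray_mean l g (h *: delta_mx 0 j + z) - ray_mean l g z) =
  int01 (fun s => h^-1 * (s ^+ l * g (ray (z + h *: delta_mx 0 j) s) + (-1) * (s ^+ l * g (ray z s)))).
  have cN : continuous (fun s : R => (-1) * (s ^+ l * g (ray z s))).
    by apply: continuous_scale; exact: ci.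
  rewrite int01Zl; last by apply: continuous_add => //; exact: ci.
  rewrite int01D; [|exact: ci|exact: cN].
  rewrite int01Zl; last exact: ci.
  by rewrite mulN1r [h *: _ + z]addrC.
apply: int01_close; [|exact: (ci l.+1 _ z cdg)|].
  by apply: continuous_scale; apply: continuous_add; last apply: continuous_scale; exact: ci.
move=> s hs; rewrite mulN1r -mulrBr ray_shift.
have [xi hxi ->] := @mvt_line R _ g (ray z s) (delta_mx 0 j) (s * h) (fun _ _ => dg _).
(* The intermediate point is rewritten as a point on a ray with shifted end point, to which [hd]
   applies; for s = 0 the shift is taken to be 0. *)
have [xi' hxi' ->] : exists2 xi', `|xi'| <= `|h| & xi = s * xi'.
  have [s0|s0] := eqVneq s 0.
    exists 0; first by rewrite normr0.
    rewrite mulr0; apply/eqP; by move: hxi; rewrite s0 mul0r normr0 normr_le0.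
  exists (xi / s); last by rewrite mulrC divfK.
  by rewrite normrM normfV ler_pdivrMr ?normr_gt0 // mulrC -normrM.
rewrite -ray_shift.
have -> : h^-1 * (s ^+ l * (s * h * 'D_(delta_mx 0 j) g (ray (z + xi' *: delta_mx 0 j) s))) =
  s ^+ l.+1 * 'D_(delta_mx 0 j) g (ray (z + xi' *: delta_mx 0 j) s).
  by rewrite exprSr; field.
rewrite -mulrBr normrM -[e]mul1r ler_pM //; first exact: exprn01.
apply: hd => //; rewrite mx_norm_ball /ball_ /= opprD addrA subrr sub0r normrN.
apply: le_lt_trans hh; apply: le_trans _ hxi'.
rewrite [leLHS]/Num.Def.normr /= mx_normrE; apply: bigmax_le => // i _.
by rewrite !mxE; case: (_ && _); rewrite ?mulr1 // mulr0 normr0.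
Unshelve. all: by end_near. Qed.

Lemma Ck_continuous k (g : 'rV[R]_n -> R) : Ck k setT g -> continuous g.
Proof. by move=> /(Ck_le (leq0n k))[c _] x; exact: c. Qed.

Lemma Ck_ray_mean k l (g : 'rV[R]_n -> R) : Ck k setT g -> Ck k setT (ray_mean l g).
Proof.
elim: k l g => [|k IH] l g hg.
  by split=> // x _; apply: ray_mean_continuous; exact: Ck_continuous hg.
have cg := Ck_continuous hg; have [_ hd] := hg.
have D j z : is_derive z (delta_mx 0 j) (ray_mean l g) (ray_mean l.+1 ('D_(delta_mx 0 j) g) z).
  apply: ray_mean_derive => //; first by move=> y; exact: (hd j).1.
  exact: Ck_continuous (hd j).2.
split=> [x _|j]; first exact: ray_mean_continuous.
split=> [x _|]; first by case: (D j x).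
apply: Ck_eq openT _ (IH l.+1 _ (hd j).2) => x _.
by case: (D j x).
Qed.

(** The fundamental theorem of calculus along the segment from [a] to [z]: [Q i] is the mean of the
    i-th partial derivative over it, smooth by [Ck_ray_mean]. *)
Lemma hadamard (F : 'rV[R]_n -> R) : Cinfty setT F ->
  exists2 Q : 'I_n -> 'rV[R]_n -> R, (forall i, Cinfty setT (Q i)) &
    forall z, F z = F a + \sum_i (z 0 i - a 0 i) * Q i z.
Proof.
move=> hF; exists (fun i => ray_mean 0 ('D_(delta_mx 0 i) F)).
  by move=> i k; apply: Ck_ray_mean; have [_ /(_ i)[]] := hF k.+1.
move=> z.
have cD i : continuous ('D_(delta_mx 0 i) F).
  have [_ /(_ i)[_ c]] := hF 1%N; exact: (@Ck_continuous 0 _ c).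
have dF y : differentiable F y by exact: Ck1_differentiable openT I (hF 1%N).
have D (s : R) : is_derive s 1 (fun s => F (ray z s)) (\sum_i (z 0 i - a 0 i) * 'D_(delta_mx 0 i) F (ray z s)).
  have Dv : 'D_(z - a) F (ray z s) = \sum_i (z 0 i - a 0 i) * 'D_(delta_mx 0 i) F (ray z s).
    by rewrite deriveE // diff_coords //; apply: eq_bigr => i _; rewrite !mxE.
  rewrite -Dv; apply: is_derive_line; apply: diff_derivable; exact: dF.
(* The reindexing [P] lets the number of summands vary in the induction while the dimension [n]
   stays fixed. *)
have cS m (P : 'I_m -> 'I_n) : continuous (fun s : R => \sum_i (z 0 (P i) - a 0 (P i)) * 'D_(delta_mx 0 (P i)) F (ray z s)).
  elim: m P => [|m IH] P.
    under eq_fun do rewrite big_ord0; move=> s; exact: cst_continuous.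
  under eq_fun do rewrite big_ord_recl; 
  apply: continuous_add; last exact: (IH (P \o lift ord0)).
  by apply: continuous_scale; exact: (@ray_continuous _ z (cD _)).
have E := int01_FTC (cS n id) D.
have ES m (P : 'I_m -> 'I_n) : int01 (fun s => \sum_i (z 0 (P i) - a 0 (P i)) * 'D_(delta_mx 0 (P i)) F (ray z s)) =
   \sum_i (z 0 (P i) - a 0 (P i)) * ray_mean 0 ('D_(delta_mx 0 (P i)) F) z.
  elim: m P => [|m IH] P.
    by under eq_fun do rewrite big_ord0; rewrite int01_cst big_ord0.
  under eq_fun do rewrite big_ord_recl.
  have c1 : continuous (fun s : R => 'D_(delta_mx 0 (P ord0)) F (ray z s)) by exact: (@ray_continuous _ z (cD _)).
  rewrite int01D; last exact: (cS m (P \o lift ord0)).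
    rewrite big_ord_recl -(IH (P \o lift ord0)) int01Zl // /ray_mean.
    by under [in RHS]eq_fun do rewrite expr0 mul1r.
  exact: continuous_scale c1.
rewrite -(ES n id) E /ray scale1r scale0r addr0 addrC subrK.
by rewrite addrC subrK.
Qed.

(** Meant for z = a, where the last sum vanishes. With [G] constant it identifies [Q j] at [a] as a
    partial derivative; with [G] one of the functions [Q l] it yields second derivatives. *)
Lemma derive_remainder (F G : 'rV[R]_n -> R) (Q : 'I_n -> 'rV[R]_n -> R) :
  Cinfty setT G -> (forall i, Cinfty setT (Q i)) ->
  (forall z, F z = G z + \sum_i (z 0 i - a 0 i) * Q i z) ->
  forall z j, 'D_(delta_mx 0 j) F z = 'D_(delta_mx 0 j) G z + Q j z +
    \sum_i (z 0 i - a 0 i) * 'D_(delta_mx 0 j) (Q i) z.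
Proof.
move=> hG hQ E z j.
have dQ i : is_derive z (delta_mx 0 j) (Q i) ('D_(delta_mx 0 j) (Q i) z).
  by apply: derivableP; have [_ /(_ j)[d _]] := hQ i 1%N; exact: d.
have dG : is_derive z (delta_mx 0 j) G ('D_(delta_mx 0 j) G z).
  by apply: derivableP; have [_ /(_ j)[d _]] := hG 1%N; exact: d.
have dz i : is_derive z (delta_mx 0 j) (fun z : 'rV[R]_n => z 0 i - a 0 i) ((j == i)%:R).
  have := is_deriveB (derive_coord j i z) (is_derive_cst (a 0 i) z (delta_mx 0 j)).
  by rewrite subr0.
have dT i := is_deriveM (dz i) (dQ i).
have [_] := is_deriveD dG (is_derive_sum dT).
have -> : G + \sum_i ((fun z : 'rV[R]_n => z 0 i - a 0 i) * Q i) = F.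
  by apply/funext => y; rewrite E -[LHS]/(G y + (\sum_i _) y) fct_sumE.
move=> ->; rewrite big_split /= -addrA; congr (_ + _); rewrite addrC; congr (_ + _).
rewrite (bigD1 j) //= eqxx /GRing.scale /= mulr1 big1 ?addr0 // => i ij.
by rewrite eq_sym (negbTE ij) mulr0.
Qed.

End Hadamard.

(** Differentiating the Hadamard expansion twice gives D_k D_l F(a) = D_k Q_l(a) + D_l Q_k(a), which
    is symmetric in k and l. *)
Lemma clairaut (R : realType) n (F : 'rV[R]_n -> R) (a : 'rV[R]_n) (i j : 'I_n) :
  Cinfty setT F ->
  'D_(delta_mx 0 i) ('D_(delta_mx 0 j) F) a = 'D_(delta_mx 0 j) ('D_(delta_mx 0 i) F) a.
Proof.
move=> hF; have [Q hQ EQ] := hadamard a hF.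
have DQ k : Cinfty setT (Q k) by [].
have D z l : 'D_(delta_mx 0 l) F z = Q l z + \sum_i (z 0 i - a 0 i) * 'D_(delta_mx 0 l) (Q i) z.
  rewrite (derive_remainder (fun k => Ck_cst k setT (F a)) hQ EQ) derive_cst add0r //.
have key k l : 'D_(delta_mx 0 k) ('D_(delta_mx 0 l) F) a =
    'D_(delta_mx 0 k) (Q l) a + 'D_(delta_mx 0 l) (Q k) a.
  have hD p : Cinfty setT ('D_(delta_mx 0 l) (Q p)).
    by move=> m; have [_ /(_ l)[]] := hQ p m.+1.
  rewrite (derive_remainder (hQ l) hD (D ^~ l)) big1 ?addr0 // => m _.
  by rewrite subrr mul0r.
by rewrite !key addrC.
Qed.

(** * Differential spaces and local coordinates *)

Section Differential_spaces.
Variables (R : realType) (X : dspace R).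

(* The axiom of Sikorski's differential spaces. *)
Definition Cinfty_closed : Prop := generated (smooth X) `<=` smooth X.

Definition nonzero (chi : X -> R) : set X := [set y | chi y != 0].

(* On a manifold the sets where a smooth function does not vanish form a basis
   of the topology. *)
Definition near_pt (x : X) (P : X -> Prop) : Prop :=
  exists2 chi, smooth X chi /\ chi x != 0 & nonzero chi `<=` P.

Lemma near_pt_self x P : near_pt x P -> P x.
Proof. by case=> chi [_ ?]; exact. Qed.

Lemma near_pt_sub x (P Q : X -> Prop) : (forall y, P y -> Q y) -> near_pt x P -> near_pt x Q.
Proof. by move=> PQ [chi h hP]; exists chi => // y /hP/PQ. Qed.

Hypothesis HX : Cinfty_closed.

Lemma smooth_comp m (g : 'I_m -> X -> R) (F : 'rV[R]_m -> R) :
  (forall i, smooth X (g i)) -> Cinfty setT F -> smooth X (fun y => F (\row_i g i y)).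
Proof. by move=> hg hF; apply: HX => x; exists m, g, 1, F; split. Qed.

Lemma smooth_cst (c : R) : smooth X (fun=> c).
Proof.
by apply: (@smooth_comp 0 (fun _ => fun=> 0) (fun=> c)) => [[]//|k]; exact: Ck_cst.
Qed.

Lemma smooth_comp2 (f g : X -> R) (F : R -> R -> R) : smooth X f -> smooth X g ->
  Cinfty setT (fun z : 'rV[R]_2 => F (z 0 0) (z 0 1)) -> smooth X (fun y => F (f y) (g y)).
Proof.
move=> hf hg hF.
pose h (i : 'I_2) := if i == 0 then f else g.
have -> : (fun y => F (f y) (g y)) = (fun y => F ((\row_i h i y : 'rV[R]_2) 0 0) ((\row_i h i y : 'rV[R]_2) 0 1)).
  by apply: funext => y; rewrite !mxE.
by apply: (smooth_comp (g := h) _ hF) => i; rewrite /h; case: ifP.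
Qed.

Lemma smoothD (f g : X -> R) : smooth X f -> smooth X g -> smooth X (fun y => f y + g y).
Proof.
move=> hf hg; apply: (smooth_comp2 (F := fun a b => a + b)) => // k.
by apply: Ck_add; [exact: openT|apply: Ck_coord; exact: openT|apply: Ck_coord; exact: openT].
Qed.

Lemma smoothM (f g : X -> R) : smooth X f -> smooth X g -> smooth X (fun y => f y * g y).
Proof.
move=> hf hg; apply: (smooth_comp2 (F := fun a b => a * b)) => // k.
by apply: Ck_mul; [exact: openT|apply: Ck_coord; exact: openT|apply: Ck_coord; exact: openT].
Qed.

Lemma smoothN (f : X -> R) : smooth X f -> smooth X (fun y => - f y).
Proof.
move=> hf; under eq_fun do rewrite -mulN1r.
by apply: smoothM => //; exact: smooth_cst.
Qed.

Lemma smoothB (f g : X -> R) : smooth X f -> smooth X g -> smooth X (fun y => f y - g y).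
Proof. by move=> hf hg; apply: smoothD => //; exact: smoothN. Qed.

Lemma smooth_sum (I : Type) (s : seq I) (f : I -> X -> R) :
  (forall i, smooth X (f i)) -> smooth X (fun y => \sum_(i <- s) f i y).
Proof.
move=> hf; elim: s => [|i s IH].
  by under eq_fun do rewrite big_nil; exact: smooth_cst.
by under eq_fun do rewrite big_cons; apply: smoothD.
Qed.

Lemma smooth_prod (I : Type) (s : seq I) (f : I -> X -> R) :
  (forall i, smooth X (f i)) -> smooth X (fun y => \prod_(i <- s) f i y).
Proof.
move=> hf; elim: s => [|i s IH].
  by under eq_fun do rewrite big_nil; exact: smooth_cst.
by under eq_fun do rewrite big_cons; apply: smoothM.
Qed.

Lemma near_pt_and x (P Q : X -> Prop) : near_pt x P -> near_pt x Q ->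
  near_pt x (fun y => P y /\ Q y).
Proof.
move=> [c [sc cx] cP] [d [sd dx] dQ]; exists (fun y => c y * d y).
  by split; [exact: smoothM | rewrite mulf_neq0].
move=> y; rewrite /nonzero /= mulf_eq0 negb_or => /andP[cy dy].
by split; [exact: cP | exact: dQ].
Qed.

Lemma near_pt_all x : near_pt x (fun=> True).
Proof. by exists (fun=> 1); [split; [exact: smooth_cst|exact: oner_neq0]|]. Qed.

Lemma near_pt_nonzero x chi : smooth X chi -> chi x != 0 -> near_pt x (nonzero chi).
Proof. by move=> ? ?; exists chi. Qed.

Lemma near_pt_box m (g : 'I_m -> X -> R) (e : R) x : (forall i, smooth X (g i)) -> 0 < e ->
  near_pt x (box g x e).
Proof.
move=> hg e0; have [b [r1 [hb r10 b1 b0]]] := bump (\row_i g i x) e0.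
exists (fun y => b (\row_i g i y)); first split.
- exact: smooth_comp.
- by rewrite b1 ?oner_neq0 // => i; rewrite subrr normr0.
- by move=> y /= hy i; have := b0 _ hy i; rewrite !mxE.
Qed.

Lemma smooth_local (f : X -> R) :
  (forall x, exists2 g, smooth X g & near_pt x (fun y => f y = g y)) -> smooth X f.
Proof.
move=> hf; apply: HX => x.
have [g hg [chi [schi chix] hchi]] := hf x.
(* [chi] is made a generator: in a box of radius |chi x| it cannot vanish, so [f] agrees with [g]
   there, and the outer function reads off the second coordinate. *)
exists 2, (fun i => if i == 0 then chi else g), `|chi x|, (fun z => z 0 1); split.
- by move=> i; case: ifP.
- by rewrite normr_gt0.
- by move=> k; apply: Ck_coord; exact: openT.
move=> y /(_ 0) /= hy; rewrite mxE /=; apply: hchi.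
by rewrite /nonzero /=; apply/eqP => c0; move: hy; rewrite c0 sub0r normrN ltxx.
Qed.

Lemma smooth_inv_near (f : X -> R) x : smooth X f -> f x != 0 ->
  exists2 g, smooth X g & near_pt x (fun y => g y = (f y)^-1).
Proof.
move=> hf fx; have [F hF [e e0 hFe]] := Cinfty_inv_germ fx.
exists (fun y => F (\row_(i < 1) f y)); first exact: (@smooth_comp 1 (fun=> f)).
apply: near_pt_sub (near_pt_box x (m := 1) (g := fun=> f) (fun=> hf) e0) => y /(_ 0) /= hy.
by rewrite hFe mxE.
Qed.

Section Tangent.
Variables (x : X) (v : functional R X).
Hypothesis tv : tangent x v.

Lemma tangentD f g : smooth X f -> smooth X g -> v (fun y => f y + g y) = v f + v g.
Proof.
move=> sf sg; case: tv => h _ _; have := h 1 _ _ sf sg.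
by rewrite mul1r; under eq_fun do rewrite mul1r.
Qed.

Lemma tangentM f g : smooth X f -> smooth X g -> v (fun y => f y * g y) = f x * v g + g x * v f.
Proof. by move=> sf sg; case: tv => _ h _; exact: h. Qed.

Lemma tangent_cst c : v (fun=> c) = 0.
Proof.
have v1 : v (fun=> 1) = 0.
  have := tangentM (smooth_cst 1) (smooth_cst 1); rewrite !mul1r.
  by move/eqP; rewrite -subr_eq0 opprD addrA subrr sub0r oppr_eq0 => /eqP.
case: tv => h _ _; have := h (c - 1) _ _ (smooth_cst 1) (smooth_cst 1).
by under eq_fun do rewrite mulr1 subrK; rewrite v1 mulr0 addr0.
Qed.

Lemma tangentZ c f : smooth X f -> v (fun y => c * f y) = c * v f.
Proof.
move=> sf; rewrite tangentM //; last exact: smooth_cst.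
by rewrite tangent_cst mulr0 addr0.
Qed.

Lemma tangentN f : smooth X f -> v (fun y => - f y) = - v f.
Proof.
by move=> sf; under eq_fun do rewrite -mulN1r; rewrite tangentZ // mulN1r.
Qed.

Lemma tangentB f g : smooth X f -> smooth X g -> v (fun y => f y - g y) = v f - v g.
Proof. by move=> sf sg; rewrite tangentD ?tangentN //; exact: smoothN. Qed.

Lemma tangent_sum (I : Type) (s : seq I) (f : I -> X -> R) : (forall i, smooth X (f i)) ->
  v (fun y => \sum_(i <- s) f i y) = \sum_(i <- s) v (f i).
Proof.
move=> hf; elim: s => [|i s IH].
  by under eq_fun do rewrite big_nil; rewrite tangent_cst big_nil.
under eq_fun do rewrite big_cons.
by rewrite tangentD ?IH ?big_cons //; exact: smooth_sum.
Qed.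

Lemma tangent_near f g : smooth X f -> smooth X g -> near_pt x (fun y => f y = g y) -> v f = v g.
Proof.
(* chi (f - g) vanishes identically, and chi x != 0. *)
move=> sf sg [chi [sc cx] hc]; apply/eqP; rewrite -subr_eq0 -tangentB //.
have : v (fun y => chi y * (f y - g y)) = v (fun=> 0).
  congr v; apply/funext => y; have [->|cy] := eqVneq (chi y) 0; first by rewrite mul0r.
  by rewrite (hc y cy) subrr mulr0.
have h0 : f x = g x by exact: hc.
rewrite tangent_cst tangentM //; last exact: smoothB.
rewrite h0 subrr mul0r addr0 => /eqP; rewrite mulf_eq0 => /orP[c0|//].
by rewrite c0 in cx.
Qed.

Lemma tangent_comp m (g : 'I_m -> X -> R) (F : 'rV[R]_m -> R) :
  (forall i, smooth X (g i)) -> Cinfty setT F ->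
  v (fun y => F (\row_i g i y)) = \sum_i 'D_(delta_mx 0 i) F (\row_i g i x) * v (g i).
Proof.
move=> hg hF; pose a : 'rV[R]_m := \row_i g i x.
have [Q hQ EQ] := hadamard a hF.
have sQ i : smooth X (fun y => Q i (\row_i g i y)) by exact: smooth_comp.
have sB i : smooth X (fun y => g i y - g i x) by apply: smoothB => //; exact: smooth_cst.
(* Each factor g_i - g_i(x) vanishes at [x], so the Leibniz rule leaves Q_i(a) v(g_i). *)
have -> : (fun y => F (\row_i g i y)) = (fun y => F a + \sum_i (g i y - g i x) * Q i (\row_i g i y)).
  by apply/funext => y; rewrite EQ; congr (_ + _); apply: eq_bigr => i _; rewrite !mxE.
rewrite tangentD; [|exact: smooth_cst|by apply: smooth_sum => i; exact: smoothM].
rewrite tangent_cst add0r tangent_sum; last by move=> i; exact: smoothM.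
apply: eq_bigr => i _; rewrite tangentM // subrr mul0r add0r tangentB //; last exact: smooth_cst.
rewrite tangent_cst subr0 (derive_remainder (fun k => Ck_cst k setT (F a)) hQ EQ).
rewrite derive_cst add0r big1 ?addr0 // => j _.
by rewrite mxE subrr mul0r.
Qed.

(** The double sum is the coordinate expression of a two-form on fields with components [p] and [q];
    its derivative serves both for the closedness of pullbacks and for the Lie derivative along the
    velocity. *)
Lemma tangent_bilinear n (p q : 'I_n -> X -> R) (w : 'I_n -> 'I_n -> X -> R) :
  (forall a, smooth X (p a)) -> (forall a, smooth X (q a)) ->
  (forall a b, smooth X (w a b)) ->
  v (fun z => \sum_a \sum_b p a z * q b z * w a b z) =
  \sum_a \sum_b ((v (p a) * q b x + p a x * v (q b)) * w a b x + p a x * q b x * v (w a b)).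
Proof.
move=> sp sq sw.
have spq a b : smooth X (fun z => p a z * q b z) by exact: smoothM.
have spqw a b : smooth X (fun z => p a z * q b z * w a b z) by exact: smoothM.
rewrite tangent_sum => [|a]; last exact: smooth_sum.
apply: eq_bigr => a _; rewrite tangent_sum //; apply: eq_bigr => b _.
by rewrite !tangentM //; ring.
Qed.

End Tangent.

Lemma tangent0 x : tangent x (0 : functional R X).
Proof.
by split=> [a f g _ _|f g _ _|f _]; rewrite ?[(0 : functional R X) _]/(0 : R) ?mulr0 ?addr0.
Qed.

Lemma tangent_lin x (a : R) (u v : functional R X) : tangent x u -> tangent x v ->
  tangent x (a *: u + v).
Proof.
move=> [u1 u2 u3] [v1 v2 v3]; have E f : (a *: u + v) f = a * u f + v f by [].
split=> [b f g sf sg|f g sf sg|f nf]; rewrite !E.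
- by rewrite u1 // v1 //; ring.
- by rewrite u2 // v2 //; ring.
- by rewrite u3 // v3 // mulr0 addr0.
Qed.

Lemma functional_sumE (I : Type) (s : seq I) (c : I -> R) (V : I -> functional R X) f :
  (\sum_(i <- s) c i *: V i) f = \sum_(i <- s) c i * V i f.
Proof. by rewrite fct_sumE. Qed.

Lemma tangent_comb x (I : Type) (s : seq I) (c : I -> R) (V : I -> functional R X) :
  (forall i, tangent x (V i)) -> tangent x (\sum_(i <- s) c i *: V i).
Proof.
move=> hV; elim: s => [|i s IH]; first by rewrite big_nil; exact: tangent0.
by rewrite big_cons; exact: tangent_lin.
Qed.

Lemma tangentZv x (a : R) (u : functional R X) : tangent x u -> tangent x (a *: u).
Proof. by move=> tu; rewrite -[_ *: _]addr0; apply: tangent_lin => //; exact: tangent0. Qed.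

Lemma tangentNv x (u : functional R X) : tangent x u -> tangent x (- u).
Proof. by move=> tu; rewrite -scaleN1r; exact: tangentZv. Qed.

Lemma tangentDv x (u v : functional R X) : tangent x u -> tangent x v -> tangent x (u + v).
Proof. by move=> tu tw; rewrite -[u]scale1r; exact: tangent_lin. Qed.

Lemma tangentBv x (u v : functional R X) : tangent x u -> tangent x v -> tangent x (u - v).
Proof. by move=> tu tw; apply: tangentDv => //; exact: tangentNv. Qed.

Lemma vfield_comb (I : Type) (s : seq I) (c : I -> X -> R) (V : I -> X -> functional R X) :
  (forall i, smooth X (c i)) -> (forall i, is_vfield (V i)) ->
  is_vfield (fun y => \sum_(i <- s) c i y *: V i y).
Proof.
move=> hc hV; split=> [y|f sf].
  by apply: (@tangent_comb y _ s (c^~ y) (V^~ y)) => i; case: (hV i).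
under eq_fun do rewrite functional_sumE.
by apply: smooth_sum => i; apply: smoothM => //; have [_] := hV i; exact.
Qed.

Lemma vfieldB (V W : X -> functional R X) : is_vfield V -> is_vfield W ->
  is_vfield (fun y => V y - W y).
Proof.
move=> [tV sV] [tW sW]; split=> [y|f sf]; first exact: tangentBv.
by apply: smoothB; [exact: sV|exact: sW].
Qed.

Lemma vfieldN (V : X -> functional R X) : is_vfield V -> is_vfield (fun y => - V y).
Proof.
by move=> [tV sV]; split=> [y|f sf]; [exact: tangentNv|apply: smoothN; exact: sV].
Qed.

Lemma vfield_bracket (V W : X -> functional R X) : is_vfield V -> is_vfield W ->
  is_vfield (bracket V W).
Proof.
move=> [tV sV] [tW sW]; split=> [y|f sf]; last first.
  by apply: smoothB; [exact: sV (sW _ sf)|exact: sW (sV _ sf)].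
split=> [a f g sf sg|f g sf sg|f nf]; rewrite /bracket.
- have E (U : X -> functional R X) (tU : forall y, tangent y (U y)) :
    (fun z => U z (fun y => a * f y + g y)) = (fun z => a * U z f + U z g).
    by apply/funext => z; case: (tU z) => h _ _; exact: h.
  rewrite (E W tW) (E V tV).
  have [h1 _ _] := tV y; have [h2 _ _] := tW y.
  by rewrite h1 ?h2; try (exact: sV || exact: sW); ring.
- have E (U : X -> functional R X) (tU : forall y, tangent y (U y)) :
    (fun z => U z (fun y => f y * g y)) = (fun z => f z * U z g + g z * U z f).
    by apply/funext => z; rewrite (tangentM (tU z)).
  rewrite (E W tW) (E V tV).
  have s1 U h k : is_vfield U -> smooth X h -> smooth X k -> smooth X (fun z => h z * U z k).
    by move=> [_ sU] sh sk; apply: smoothM => //; exact: sU.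
  have vV : is_vfield V by []. have vW : is_vfield W by [].
  rewrite (tangentD (tV y)) ?(tangentD (tW y)); try exact: s1.
  rewrite !(tangentM (tV y)) ?(tangentM (tW y)) //; try (exact: sV || exact: sW).
  ring.
- have -> : (fun z => W z f) = (fun=> 0).
    by apply/funext => z; case: (tW z) => _ _; apply.
  have -> : (fun z => V z f) = (fun=> 0).
    by apply/funext => z; case: (tV z) => _ _; apply.
  by rewrite (tangent_cst (tV y)) (tangent_cst (tW y)) subr0.
Qed.

(* Cut off coordinates and coordinate fields, so that they are defined on all of
   X. *)
Definition coords n (f : 'I_n -> X -> R) (V : 'I_n -> X -> functional R X) (D : set X) : Prop :=
  [/\ forall i, smooth X (f i), forall i, is_vfield (V i),
      forall y, D y -> forall i j, V i y (f j) = (i == j)%:R,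
      forall g, smooth X g -> exists2 F, Cinfty setT F &
        forall y, D y -> g y = F (\row_i f i y) &
      forall y z, D y -> D z -> (forall i, f i y = f i z) -> y = z].

Definition has_coords : Prop := forall x, exists n (f : 'I_n -> X -> R) V chi,
  [/\ smooth X chi, chi x != 0 & coords f V (nonzero chi)].

Definition smooth_form1 (th : form1 X) : Prop :=
  (forall x (a : R) u v, tangent x u -> tangent x v -> th x (a *: u + v) = a * th x u + th x v) /\
  (forall W, is_vfield W -> smooth X (fun x => th x (W x))).

Section Coordinates.
Variables (n : nat) (f : 'I_n -> X -> R) (V : 'I_n -> X -> functional R X) (chi : X -> R).
Hypotheses (schi : smooth X chi) (hc : coords f V (nonzero chi)).

(** Near [y] a smooth function is some F of the coordinates, and the chain rule for [v] and for each
    [V i] expresses both sides through the same partial derivatives of F. *)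
Lemma coords_tangent y v : nonzero chi y -> tangent y v -> v = \sum_i v (f i) *: V i y.
Proof.
move=> chiy tv; case: hc => sf vV dV cF _; apply/funext => g; rewrite functional_sumE.
have [sg|nsg] := pselect (smooth X g); last first.
  case: (tv) => _ _ ->//; rewrite big1 // => i _; case: (vV i) => tV _.
  by case: (tV y) => _ _ ->//; rewrite mulr0.
have [F hF EF] := cF _ sg.
have sgF : smooth X (fun z => F (\row_i f i z)) by exact: smooth_comp.
have nF : near_pt y (fun z => g z = F (\row_i f i z)).
  by apply: near_pt_sub (near_pt_nonzero schi chiy) => z; exact: EF.
rewrite (tangent_near tv sg sgF nF) (tangent_comp tv sf hF).
apply: eq_bigr => i _; case: (vV i) => tV _; rewrite mulrC; congr (_ * _).
rewrite (tangent_near (tV y) sg sgF nF) (tangent_comp (tV y) sf hF).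
rewrite (bigD1 i) //= dV // eqxx mulr1 big1 ?addr0 // => j ij.
by rewrite dV // eq_sym (negbTE ij) mulr0.
Qed.

Lemma coords_extend y v : nonzero chi y -> tangent y v ->
  exists2 W, is_vfield W & W y = v.
Proof.
move=> chiy tv; exists (fun z => \sum_i v (f i) *: V i z).
  apply: (@vfield_comb _ _ (fun i _ => v (f i)) V); last by case: hc.
  by move=> i; exact: smooth_cst.
by rewrite -coords_tangent.
Qed.

Lemma form1_comb (th : form1 X) y (I : Type) (s : seq I) (c : I -> R) (W : I -> functional R X) :
  smooth_form1 th -> (forall i, tangent y (W i)) ->
  th y (\sum_(i <- s) c i *: W i) = \sum_(i <- s) c i * th y (W i).
Proof.
move=> [lth _] tW; elim: s => [|i s IH]; last first.
  by rewrite !big_cons lth // ?IH //; exact: tangent_comb.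
rewrite !big_nil; have t0 := tangent0 y.
have := lth y (-1) _ _ t0 t0; by rewrite scaler0 addr0 mulN1r addNr.
Qed.

Lemma form1_coords (th : form1 X) y v : smooth_form1 th -> nonzero chi y -> tangent y v ->
  th y v = \sum_i v (f i) * th y (V i y).
Proof.
move=> sth chiy tv; rewrite {1}(coords_tangent chiy tv) form1_comb //.
by move=> i; case: hc => _ vV _ _ _; case: (vV i).
Qed.

(* The second derivatives of the f i cancel against the bracket, so the value at
   y depends on A y and B y only. *)
Lemma koszul1_coords (th : form1 X) y A B : smooth_form1 th -> nonzero chi y ->
  is_vfield A -> is_vfield B ->
  koszul1 th A B y = \sum_i (B y (f i) * A y (fun z => th z (V i z)) -
                             A y (f i) * B y (fun z => th z (V i z))).
Proof.
move=> sth chiy vA vB; case: (hc) => sf vV _ _ _.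
have st i : smooth X (fun z => th z (V i z)) by case: sth => _; apply.
have key W U : is_vfield W -> is_vfield U -> U y (fun z => th z (W z)) =
    \sum_i (W y (f i) * U y (fun z => th z (V i z)) + th y (V i y) * U y (fun z => W z (f i))).
  move=> vW vU; have [tU _] := vU; have [tW sW] := vW.
  have sWf i : smooth X (fun z => W z (f i) * th z (V i z)) by apply: smoothM => //; exact: sW.
  rewrite (@tangent_near _ _ (tU y) _ (fun z => \sum_i W z (f i) * th z (V i z))).
  - rewrite (tangent_sum (tU y)) //; apply: eq_bigr => i _.
    by rewrite (tangentM (tU y)) //; exact: sW.
  - by case: sth => _; apply.
  - exact: smooth_sum.
  - apply: near_pt_sub (near_pt_nonzero schi chiy) => z cz; exact: form1_coords.
have vAB := vfield_bracket vA vB.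
rewrite /koszul1 (key B A) // (key A B) // (form1_coords sth chiy); last by case: vAB.
rewrite -!sumrB; apply: eq_bigr => i _; rewrite /bracket; ring.
Qed.

(** This disposes of the choice in [dext]: extensions exist by [coords_extend], so the default is
    never taken, and by [koszul1_coords] all of them give the same value. *)
Lemma dext_coords (th : form1 X) y v w : smooth_form1 th -> nonzero chi y ->
  tangent y v -> tangent y w ->
  dext th y v w = \sum_i (w (f i) * v (fun z => th z (V i z)) -
                          v (f i) * w (fun z => th z (V i z))).
Proof.
move=> sth chiy tv tw; rewrite /dext; case: xgetP => [r _|].
  by move=> [A [B [vA vB Av Bw ->]]]; rewrite (koszul1_coords sth chiy) // Av Bw.
have [A vA Av] := coords_extend chiy tv; have [B vB Bw] := coords_extend chiy tw.
by move=> /(_ (koszul1 th A B y))[]; exists A, B; split.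
Qed.

End Coordinates.

Lemma dext_koszul (th : form1 X) A B y : has_coords -> smooth_form1 th ->
  is_vfield A -> is_vfield B -> dext th y (A y) (B y) = koszul1 th A B y.
Proof.
move=> HC sth vA vB; have [n [f [V [chi [schi chiy hc]]]]] := HC y.
rewrite (dext_coords schi hc sth chiy); [|by case: vA|by case: vB].
by rewrite (koszul1_coords schi hc sth chiy).
Qed.

End Differential_spaces.

(** * Manifolds *)

Section Manifolds.
Variables (R : realType) (M : manifold R).
Local Notation n := (@mdim R M).

Lemma manifold_hausdorff : hausdorff_space (mtop M). Proof. by case: M. Qed.

Lemma manifold_cover (x : mtop M) : exists2 c, @atlas R M c & chart_dom c x.
Proof. by move: x; case: M. Qed.

Lemma manifold_chart c : @atlas R M c ->
  [/\ open (chart_dom c), open (chart_map c @` chart_dom c),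
      {in chart_dom c, cancel (chart_map c) (chart_inv c)},
      {within chart_dom c, continuous (chart_map c)} &
      {within chart_map c @` chart_dom c, continuous (chart_inv c)}].
Proof. by move: c; case: M => T m A h1 h2 h3 h4 h5 c; exact: h4. Qed.

Lemma manifold_transition c c' : @atlas R M c -> @atlas R M c' -> forall i : 'I_n,
  Cinfty (chart_map c @` (chart_dom c `&` chart_dom c')) (fun u => chart_map c' (chart_inv c u) 0 i).
Proof. by move: c c'; case: M => T m A h1 h2 h3 h4 h5 c c'; exact: h5. Qed.

Section Chart.
Variable c : chart R (mtop M) n.
Hypothesis ac : @atlas R M c.
Let D := chart_dom c.
Let E := chart_map c @` D.

Lemma chart_dom_open : open D. Proof. by case: (manifold_chart ac). Qed.
Lemma chart_im_open : open E. Proof. by case: (manifold_chart ac). Qed.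
Lemma chart_mapK y : D y -> chart_inv c (chart_map c y) = y.
Proof. by case: (manifold_chart ac) => _ _ h _ _ Dy; apply: h; rewrite inE. Qed.
Lemma chart_inv_dom u : E u -> D (chart_inv c u).
Proof. by case=> y Dy <-; rewrite chart_mapK. Qed.
Lemma chart_invK u : E u -> chart_map c (chart_inv c u) = u.
Proof. by case=> y Dy <-; rewrite chart_mapK. Qed.
Lemma chart_map_im y : D y -> E (chart_map c y).
Proof. by move=> Dy; exists y. Qed.

Lemma chart_map_continuous y : D y -> {for y, continuous (chart_map c)}.
Proof.
move=> Dy; case: (manifold_chart ac) => oD _ _ h _.
by move: h; rewrite continuous_open_subspace // => h; apply: h; rewrite inE.
Qed.

Lemma chart_inv_continuous u : E u -> {for u, continuous (chart_inv c)}.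
Proof.
move=> Eu; case: (manifold_chart ac) => _ oE _ _ h.
by move: h; rewrite continuous_open_subspace // => h; apply: h; rewrite inE.
Qed.

Lemma open_chart_preimage (B : set (mtop M)) : open B -> open [set u | E u /\ B (chart_inv c u)].
Proof.
move=> oB; rewrite openE => u /= [Eu Bu].
have h1 : nbhs u E by exact: open_nbhs_nbhs (conj chart_im_open Eu).
have h2 : nbhs u (fun w => B (chart_inv c w)).
  by apply: (chart_inv_continuous Eu); exact: open_nbhs_nbhs (conj oB Bu).
exact: filterI h1 h2.
Qed.

End Chart.

Lemma smooth_continuous (g : M -> R) : smooth M g -> continuous (g : mtop M -> R).
Proof.
move=> sg x; have [c ac Dx] := manifold_cover x.
have [cg _] := sg c ac 0%N; have Ex := chart_map_im Dx.
have h1 := continuous_comp (chart_map_continuous ac Dx) (cg _ Ex).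
rewrite /continuous_at -[in nbhs (g x)](chart_mapK ac Dx).
apply: near_eq_cvg_to h1.
apply: (@filterS _ (nbhs x) _ (chart_dom c)) => [y Dy|]; last exact: open_nbhs_nbhs (conj (chart_dom_open ac) Dx).
by rewrite /= chart_mapK.
Qed.

Lemma manifold_Cinfty_closed : Cinfty_closed M.
Proof.
move=> g hg c ac k; apply: Ck_local => u Eu.
have [m [h [e [F [sh e0 hF EF]]]]] := hg (chart_inv c u).
pose B0 : set (mtop M) := box h (chart_inv c u) e.
have oB0 : open B0.
  rewrite openE => y /= By.
  apply: (@filter_forall _ _ (fun i => [set z | `|h i z - h i (chart_inv c u)| < e]) (nbhs y)) => i.
  have ci : {for y, continuous (fun z : mtop M => `|h i z - h i (chart_inv c u)|)}.
    apply: (@continuous_comp _ _ _ (fun z : mtop M => h i z - h i (chart_inv c u)) (fun z : R => `|z|)); last exact: norm_continuous.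
    by apply: continuousB; [exact: smooth_continuous|exact: cst_continuous].
  exact: (cvgr_lt _ ci _ (By i)).
pose B := [set w | (chart_map c @` chart_dom c) w /\ B0 (chart_inv c w)].
have oB : open B by exact: open_chart_preimage.
exists B; first by split=> // i; rewrite subrr normr0.
apply: (@Ck_eq _ _ _ _ (fun w => F (\row_i (h i \o chart_inv c) w))) => //.
  by move=> w [_ Bw] /=; rewrite EF.
apply: (@Ck_comp _ _ _ _ B setT F (fun i => h i \o chart_inv c)) => //; first exact: openT.
by move=> i; apply: (@Ck_sub _ _ _ (chart_map c @` chart_dom c)) (sh i c ac k) => w [].
Qed.

(** Functions in a chart are multiplied by a bump supported in a closed box [K] and extended by 0.
    The part of the manifold over [K] is compact, hence closed by the Hausdorff property, so the
    extension stays smooth across the boundary of the chart domain. *)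
Lemma manifold_has_coords : has_coords M.
Proof.
move=> x; have [c ac Dx] := manifold_cover x.
set D := chart_dom c in Dx; set E := chart_map c @` D; set phi := chart_map c; set inv := chart_inv c.
have oE : open E by exact: chart_im_open.
pose u0 := phi x; have Eu0 : E u0 by exact: chart_map_im.
have [r /= r0 hr] := (nbhs_ballP _ _).1 (open_nbhs_nbhs (conj oE Eu0)).
pose K := [set u : 'rV[R]_n | forall i, `|u 0 i - u0 0 i| <= r / 2].
have KE : K `<=` E.
  move=> u Ku; apply: hr; rewrite mx_norm_ball /ball_ /= [ltLHS]/Num.Def.normr /= mx_normrE.
  apply: bigmax_lt => // -[i j] _; rewrite !mxE ord1 /= distrC (le_lt_trans (Ku j)) //.
  by rewrite ltr_pdivrMr // ltr_pMr // ltr1n.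
have cK : compact K.
  have := @rV_compact _ n (fun i => `[u0 0 i - r / 2, u0 0 i + r / 2]%classic) (fun i => @segment_compact _ _ _).
  congr compact; rewrite eqEsubset; split=> u /= hu i; have := hu i.
    by rewrite in_itv /= ler_distl.
  by rewrite in_itv /= ler_distl.
have clK : closed K.
  by apply: compact_closed cK; exact: norm_hausdorff.
have cK' : compact (inv @` K).
  apply: continuous_compact cK; case: (manifold_chart ac) => _ _ _ _.
  exact: continuous_subspaceW.
have clK' : closed (inv @` K) by apply: compact_closed cK'; exact: manifold_hausdorff.
pose cut (b q : 'rV[R]_n -> R) (y : M) : R := if `[< D y >] then b (phi y) * q (phi y) else 0.
have smooth_cut b q : Cinfty setT b -> (forall u, b u != 0 -> K u) -> Cinfty E q -> smooth M (cut b q).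
  move=> hb bK hq c' ac' k; apply: Ck_local => u' Eu'.
  (* The chart domain and the complement of the image of [K] cover the manifold: on the first the
     transition maps give smoothness, on the second the function is 0. *)
  have [Dy|nDy] := pselect (D (chart_inv c' u')).
    have oB := open_chart_preimage ac' (chart_dom_open ac).
    exists [set u | (chart_map c' @` chart_dom c') u /\ D (chart_inv c' u)] => //.
    apply: (@Ck_eq _ _ _ _ (fun w => (fun u => b u * q u) (\row_i phi (chart_inv c' w) 0 i))) => //.
      move=> w [Ew Dw]; rewrite /cut /= asboolT //.
      have -> : \row_i phi (chart_inv c' w) 0 i = phi (chart_inv c' w) by apply/rowP => i; rewrite mxE.
      by [].
    apply: (@Ck_comp _ _ _ _ _ E (fun u => b u * q u) (fun i w => phi (chart_inv c' w) 0 i)) => //.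
    + move=> i; apply: Ck_sub (manifold_transition ac' ac i k) => w [Ew Dw].
      exists (chart_inv c' w); last by rewrite chart_invK.
      by split=> //; exact: chart_inv_dom.
    + by apply: Ck_mul => //; apply: Ck_sub (hb k).
    + move=> w [Ew Dw]; have -> : \row_i phi (chart_inv c' w) 0 i = phi (chart_inv c' w) by apply/rowP => i; rewrite mxE.
      exact: chart_map_im.
  have oB := open_chart_preimage ac' (closed_openC clK').
  exists [set u | (chart_map c' @` chart_dom c') u /\ (~` (inv @` K)) (chart_inv c' u)].
    split=> // -[u Ku Eu]; apply: nDy; rewrite -Eu; apply: chart_inv_dom => //; exact: KE.
  apply: Ck_eq oB _ (Ck_cst _ _ 0) => w [Ew nKw] /=; rewrite /cut.
  case: asboolP => // Dw; have [->|bw] := eqVneq (b (phi (chart_inv c' w))) 0; first by rewrite mul0r.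
  by exfalso; apply: nKw; exists (phi (chart_inv c' w)); [exact: bK|exact: chart_mapK].
(* b = 1 on a neighbourhood of every point where chi0 does not vanish. *)
have r2 : 0 < r / 2 by rewrite divr_gt0.
have [b [r1 [hb r10 b1 b0]]] := bump u0 r2.
have [chi0 [r3 [hchi r30 chi1 chi0K]]] := bump u0 r10.
have bK u : b u != 0 -> K u by move=> /b0 h i; apply: ltW.
have chib u : chi0 u != 0 -> \forall w \near u, b w = 1.
  move=> hu.
  have hn : nbhs u (fun w : 'rV[R]_n => forall i, `|w 0 i - u0 0 i| < r1).
    apply: (@filter_forall _ _ (fun i => [set w : 'rV[R]_n | `|w 0 i - u0 0 i| < r1]) (nbhs u)) => i.
    have ci : {for u, continuous (fun w : 'rV[R]_n => `|w 0 i - u0 0 i|)}.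
      apply: (@continuous_comp _ _ _ (fun w : 'rV[R]_n => w 0 i - u0 0 i) (fun z : R => `|z|)); last exact: norm_continuous.
      by apply: continuousB; [exact: coord_continuous|exact: cst_continuous].
    exact: (cvgr_lt _ ci _ (chi0K _ hu i)).
  by apply: filterS hn => w; exact: b1.
have chiK u : chi0 u != 0 -> K u.
  by move=> /chib/nbhs_singleton hu; apply: bK; rewrite hu oner_neq0.
have one_E : Cinfty E (fun=> 1 : R) by move=> k; exact: Ck_cst.
pose chi := cut chi0 (fun=> 1).
have chiP y : chi y != 0 -> D y /\ chi0 (phi y) != 0.
  by rewrite /chi /cut; case: asboolP => [Dy|_]; rewrite ?eqxx // mulr1.
pose f (i : 'I_n) := cut b (fun u => u 0 i).
have fE y i : chi y != 0 -> f i y = phi y 0 i.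
  move=> /chiP[Dy /chib/nbhs_singleton hb1]; rewrite /f /cut asboolT //.
  by rewrite hb1 mul1r.
have sf i : smooth M (f i).
  by apply: smooth_cut => // k; exact: Ck_coord.
(* The i-th coordinate derivation times [b]. Where [chi] does not vanish, [b] is 1 near the point,
   which makes these fields dual to the [f j]. *)
pose V (i : 'I_n) (y : M) : functional R M := fun g =>
  if `[< smooth M g >] then cut b ('D_(delta_mx 0 i) (g \o inv)) y else 0.
have HM := manifold_Cinfty_closed.
have vV i : is_vfield (V i).
  split; last first.
    move=> g sg; have -> : (fun y => V i y g) = cut b ('D_(delta_mx 0 i) (g \o inv)).
      by apply/funext => y; rewrite /V asboolT.
    apply: smooth_cut => // k; have [_ /(_ i)[_]] := sg c ac k.+1; exact.
  move=> y; have dg g : smooth M g -> D y -> derivable (g \o inv) (phi y) (delta_mx 0 i).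
    move=> sg Dy; have [_ /(_ i)[h _]] := sg c ac 1%N; apply: h; exact: chart_map_im.
  split=> [a g h sg sh|g h sg sh|g ng]; rewrite /V.
  - rewrite !asboolT //; last by apply: smoothD => //; apply: smoothM => //; exact: smooth_cst.
    rewrite /cut; case: asboolP => [Dy|_]; last by rewrite mulr0 addr0.
    have dgh : derivable (a *: (g \o inv)) (phi y) (delta_mx 0 i) by apply: derivableZ; exact: dg.
    have -> : 'D_(delta_mx 0 i) ((fun y => a * g y + h y) \o inv) (phi y) =
        a * 'D_(delta_mx 0 i) (g \o inv) (phi y) + 'D_(delta_mx 0 i) (h \o inv) (phi y).
      apply: etrans (deriveD dgh (dg h sh Dy)) _.
      by congr (_ + _); exact: deriveZ (dg g sg Dy).
    ring.
  - rewrite !asboolT //; last exact: smoothM.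
    rewrite /cut; case: asboolP => [Dy|_]; last by rewrite !mulr0 addr0.
    have -> : 'D_(delta_mx 0 i) ((fun y => g y * h y) \o inv) (phi y) =
        g y * 'D_(delta_mx 0 i) (h \o inv) (phi y) + h y * 'D_(delta_mx 0 i) (g \o inv) (phi y).
      by apply: etrans (deriveM (dg g sg Dy) (dg h sh Dy)) _; rewrite /= /inv chart_mapK.
    ring.
  - by rewrite asboolF.
exists n, f, V, chi; split.
- by apply: smooth_cut.
- rewrite /chi /cut asboolT // mulr1 chi1 ?oner_neq0 // => i; rewrite subrr normr0 //.
split=> //.
- move=> y cy i j; have [Dy /chib hb1] := chiP y cy.
  rewrite /V asboolT // /cut asboolT // (nbhs_singleton hb1) mul1r.
  have -> : 'D_(delta_mx 0 i) (f j \o inv) (phi y) = 'D_(delta_mx 0 i) (fun u : 'rV[R]_n => u 0 j) (phi y).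
    apply: near_eq_derive.
    have hE : nbhs (phi y) E by exact: open_nbhs_nbhs (conj oE (chart_map_im Dy)).
    apply: filterS2 hb1 hE => u bu Eu; rewrite /f /cut /= asboolT; last exact: chart_inv_dom.
    by rewrite /phi /inv chart_invK // bu mul1r.
  by case: (derive_coord i j (phi y)).
(* The chart expression of [g] is cut off by [b] so as to be smooth on the whole of R^n. *)
- move=> g sg; pose F u := if `[< E u >] then b u * g (inv u) else 0.
  exists F.
    move=> k; apply: Ck_local => u _.
    have [Eu|nEu] := pselect (E u).
      exists E => //; apply: (@Ck_eq _ _ _ _ (fun w => b w * (g \o inv) w)) => //.
        by move=> w Ew; rewrite /F asboolT.
      apply: Ck_mul => //; last exact: sg.
      by apply: Ck_sub (hb k).
    exists (~` K); first by move=> /KE.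
    apply: Ck_eq (closed_openC clK) _ (Ck_cst _ _ 0) => w nKw; rewrite /F.
    case: asboolP => // Ew; have [->|bw] := eqVneq (b w) 0; first by rewrite mul0r.
    by exfalso; apply: nKw; exact: bK.
  move=> y cy; have [Dy /chib/nbhs_singleton hb1] := chiP y cy.
  have -> : \row_i f i y = phi y by apply/rowP => i; rewrite mxE fE.
  rewrite /F asboolT; last exact: chart_map_im.
  by rewrite hb1 mul1r /inv chart_mapK.
- move=> y z cy cz fyz; have [Dy _] := chiP y cy; have [Dz _] := chiP z cz.
  rewrite -(chart_mapK ac Dy) -(chart_mapK ac Dz); congr (chart_inv c _).
  by apply/rowP => i; rewrite -!fE.
Qed.

End Manifolds.

(** * Two-forms *)

Section Two_forms.
Variables (R : realType) (X : dspace R).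
Hypotheses (HX : Cinfty_closed X) (HC : has_coords X).

Section Pointwise.
Variables (s : form2 X) (hs : is_form2 s) (x : X).

Lemma form2C v w : tangent x v -> tangent x w -> s x v w = - s x w v.
Proof. by case: hs => _ h _; exact: h. Qed.

Lemma form2_linl a u v w : tangent x u -> tangent x v -> tangent x w ->
  s x (a *: u + v) w = a * s x u w + s x v w.
Proof. by case: hs => h _ _; exact: h. Qed.

Lemma form2_linr a u v w : tangent x u -> tangent x v -> tangent x w ->
  s x w (a *: u + v) = a * s x w u + s x w v.
Proof.
move=> tu tv tw; have tuv := tangent_lin a tu tv.
by rewrite form2C // form2_linl // (form2C tw tu) (form2C tw tv); ring.
Qed.

Lemma form2_0l w : tangent x w -> s x 0 w = 0.
Proof.
move=> tw; have t0 := tangent0 x; have := form2_linl (-1) t0 t0 tw.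
by rewrite scaler0 addr0 mulN1r addNr.
Qed.

Lemma form2_0r w : tangent x w -> s x w 0 = 0.
Proof. by move=> tw; rewrite form2C ?form2_0l ?oppr0 //; exact: tangent0. Qed.

Lemma form2Dl u v w : tangent x u -> tangent x v -> tangent x w ->
  s x (u + v) w = s x u w + s x v w.
Proof. by move=> tu tv tw; rewrite -[u]scale1r form2_linl // mul1r scale1r. Qed.

Lemma form2Nl u w : tangent x u -> tangent x w -> s x (- u) w = - s x u w.
Proof.
move=> tu tw; rewrite -scaleN1r -[_ *: _]addr0 form2_linl ?form2_0l ?addr0 ?mulN1r //.
exact: tangent0.
Qed.

Lemma form2Bl u v w : tangent x u -> tangent x v -> tangent x w ->
  s x (u - v) w = s x u w - s x v w.
Proof. by move=> tu tv tw; rewrite form2Dl ?form2Nl //; exact: tangentNv. Qed.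

Lemma form2_suml (I : Type) (r : seq I) (c : I -> R) (A : I -> functional R X) w :
  (forall i, tangent x (A i)) -> tangent x w ->
  s x (\sum_(i <- r) c i *: A i) w = \sum_(i <- r) c i * s x (A i) w.
Proof.
move=> tA tw; elim: r => [|i r IH]; first by rewrite !big_nil form2_0l.
by rewrite !big_cons form2_linl ?IH //; exact: tangent_comb.
Qed.

Lemma form2_sumr (I : Type) (r : seq I) (c : I -> R) (A : I -> functional R X) w :
  (forall i, tangent x (A i)) -> tangent x w ->
  s x w (\sum_(i <- r) c i *: A i) = \sum_(i <- r) c i * s x w (A i).
Proof.
move=> tA tw; elim: r => [|i r IH]; first by rewrite !big_nil form2_0r.
by rewrite !big_cons form2_linr ?IH //; exact: tangent_comb.
Qed.

Lemma form2_coords n (f : 'I_n -> X -> R) V chi v w :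
  smooth X chi -> coords f V (nonzero chi) -> nonzero chi x -> tangent x v -> tangent x w ->
  s x v w = \sum_i \sum_j v (f i) * w (f j) * s x (V i x) (V j x).
Proof.
move=> schi hc chix tv tw; have [_ vV _ _ _] := hc.
have tV i : tangent x (V i x) by case: (vV i).
rewrite {1}(coords_tangent HX schi hc chix tv) form2_suml //; apply: eq_bigr => i _.
rewrite {1}(coords_tangent HX schi hc chix tw) form2_sumr // mulr_sumr.
by apply: eq_bigr => j _; rewrite mulrA.
Qed.

Lemma kernel2l v w : kernel2 s x v -> tangent x w -> s x v w = 0.
Proof. by case=> _; exact. Qed.

Lemma kernel2r v w : kernel2 s x v -> tangent x w -> s x w v = 0.
Proof. by move=> kv tw; rewrite form2C ?kernel2l ?oppr0 //; case: kv. Qed.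

Lemma kernel2_lin a u v : kernel2 s x u -> kernel2 s x v -> kernel2 s x (a *: u + v).
Proof.
move=> ku kv; have [tu _] := ku; have [tv _] := kv.
split; first exact: tangent_lin.
by move=> w tw; rewrite form2_linl // !kernel2l // mulr0 addr0.
Qed.

Lemma kernel2_0 : kernel2 s x 0.
Proof. by split=> [|w tw]; [exact: tangent0|rewrite form2_0l]. Qed.

Lemma kernel2Z a v : kernel2 s x v -> kernel2 s x (a *: v).
Proof. by move=> kv; rewrite -[_ *: _]addr0; apply: kernel2_lin => //; exact: kernel2_0. Qed.

Lemma kernel2N v : kernel2 s x v -> kernel2 s x (- v).
Proof. by move=> kv; rewrite -scaleN1r; exact: kernel2Z. Qed.

Lemma kernel2D u v : kernel2 s x u -> kernel2 s x v -> kernel2 s x (u + v).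
Proof. by move=> ku kv; rewrite -[u]scale1r; exact: kernel2_lin. Qed.

Lemma kernel2B u v : kernel2 s x u -> kernel2 s x v -> kernel2 s x (u - v).
Proof. by move=> ku kv; apply: kernel2D => //; exact: kernel2N. Qed.

End Pointwise.

(** In the closedness identity for [V], [W] and an extension of [w], every term has an argument in
    the kernel except the one with the bracket of [V] and [W]. *)
Lemma kernel2_involutive (s : form2 X) V W x : is_form2 s -> closed2_at s x ->
  dsection (kernel2 s) V -> dsection (kernel2 s) W -> kernel2 s x (bracket V W x).
Proof.
move=> hs cs [vV kV] [vW kW]; have [tVW _] := vfield_bracket HX vV vW.
split=> // w tw.
have [n [f [U [chi [schi chix hc]]]]] := HC x.
have [Z vZ <-] := coords_extend HX schi hc chix tw.
have := cs V W Z vV vW vZ.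
have tZ y : tangent y (Z y) by case: vZ.
have zero (A B : X -> functional R X) : (forall y, tangent y (A y)) -> (forall y, tangent y (B y)) ->
    (forall y, s y (A y) (B y) = 0) -> forall u, tangent x u -> u (fun y => s y (A y) (B y)) = 0.
  move=> _ _ AB u tu; have -> : (fun y => s y (A y) (B y)) = (fun=> 0) by exact/funext.
  exact: (tangent_cst HX tu).
have tV y : tangent y (V y) by case: vV.
have tW y : tangent y (W y) by case: vW.
rewrite !zero //; do ?by move=> y; first [exact: kernel2l | exact: kernel2r].
rewrite (kernel2r hs (kV x)); last by case: (vfield_bracket HX vW vZ).
rewrite (kernel2r hs (kW x)); last by case: (vfield_bracket HX vZ vV).
by rewrite !addr0 sub0r !subr0 => /eqP; rewrite oppr_eq0 => /eqP.
Qed.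

End Two_forms.

(** * Pullbacks of two-forms and their closedness *)

Section Pullback.
Variables (R : realType) (X Y : dspace R).
Hypotheses (HX : Cinfty_closed X) (HY : Cinfty_closed Y) (CY : has_coords Y).
Variable phi : X -> Y.
Hypothesis sphi : smooth_map phi.

Lemma pushE (v : functional R X) g : smooth Y g -> push phi v g = v (g \o phi).
Proof. by move=> sg; rewrite /push asboolT. Qed.

Lemma push_lin a (u v : functional R X) : push phi (a *: u + v) = a *: push phi u + push phi v.
Proof.
apply/funext => g; rewrite -[RHS]/(a * push phi u g + push phi v g) /push.
by case: asboolP => // _; rewrite mulr0 addr0.
Qed.

Lemma push_tangent x v : tangent x v -> tangent (phi x) (push phi v).
Proof.
move=> tv; split=> [a f g sf sg|f g sf sg|f nf]; last by rewrite /push asboolF.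
- have sa : smooth Y (fun y => a * f y) by apply: smoothM => //; exact: smooth_cst.
  rewrite !pushE //; last exact: smoothD.
  by case: tv => h _ _; rewrite -h //; exact: sphi.
- rewrite !pushE //; last exact: smoothM.
  by case: tv => _ h _; rewrite -h //; exact: sphi.
Qed.

Lemma near_pt_preimage x (P : Y -> Prop) : near_pt (phi x) P -> near_pt x (P \o phi).
Proof.
move=> [chi [schi chix] hP]; exists (chi \o phi); first by split=> //; exact: sphi.
by move=> y; exact: hP.
Qed.

Variable s : form2 Y.
Hypothesis hs : is_form2 s.

Lemma pullback2_coords x n (f : 'I_n -> Y -> R) V chi v w :
  smooth Y chi -> coords f V (nonzero chi) -> nonzero chi (phi x) -> tangent x v -> tangent x w ->
  pullback2 phi s x v w =
    \sum_i \sum_j v (f i \o phi) * w (f j \o phi) * s (phi x) (V i (phi x)) (V j (phi x)).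
Proof.
move=> schi hc chix tv tw; rewrite /pullback2.
rewrite (form2_coords HY hs schi hc chix (push_tangent tv) (push_tangent tw)).
by case: hc => sf _ _ _ _; under eq_bigr do under eq_bigr do rewrite !pushE //.
Qed.

Lemma pullback2_form2 : is_form2 (pullback2 phi s).
Proof.
split.
- move=> x a u v w tu tv tw; rewrite /pullback2 push_lin.
  by case: hs => h _ _; rewrite h //; exact: push_tangent.
- by move=> x v w tv tw; rewrite /pullback2; apply: form2C => //; exact: push_tangent.
- move=> A B vA vB; apply: (smooth_local HX) => x.
  have [n [f [V [chi [schi chix hc]]]]] := CY (phi x).
  exists (fun y => \sum_i \sum_j A y (f i \o phi) * B y (f j \o phi) * s (phi y) (V i (phi y)) (V j (phi y))).
    have [sf vV _ _ _] := hc; apply: (smooth_sum HX) => i; apply: (smooth_sum HX) => j.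
    apply: (smoothM HX); first apply: (smoothM HX).
    + by case: vA => _; apply; exact: sphi.
    + by case: vB => _; apply; exact: sphi.
    + have := sphi (g := fun y => s y (V i y) (V j y)); apply.
      by case: hs => _ _; apply.
  apply: near_pt_sub (near_pt_preimage (near_pt_nonzero schi chix)) => y /= cy.
  by apply: (pullback2_coords schi hc cy); [case: vA|case: vB].
Qed.

Lemma sum_cycle n (T : 'I_n -> 'I_n -> 'I_n -> R) :
  \sum_a \sum_b \sum_c T a b c = \sum_a \sum_b \sum_c T b c a.
Proof.
rewrite [RHS]exchange_big /=; apply: eq_bigr => a _; rewrite exchange_big /=.
by apply: eq_bigr => b _.
Qed.

Lemma sum_skew n (w T : 'I_n -> 'I_n -> R) : (forall a b, w a b = - w b a) ->
  (forall a b, T a b = T b a) -> \sum_a \sum_b w a b * T a b = 0.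
Proof.
move=> hw hT; set S := \sum_a _.
suff : S = - S by lra.
rewrite {1}/S exchange_big /= /S -sumrN; apply: eq_bigr => a _; rewrite -sumrN.
by apply: eq_bigr => b _; rewrite hw hT mulNr.
Qed.

(** Vector fields cannot be pushed forward along [phi], so naturality of d is checked in coordinates
    of the target. The derivatives of the coefficients add up to 0 because [s] is closed; the second
    derivatives left over are symmetric in two indices and contracted with skew coefficients. *)
Lemma pullback2_closed x : closed2_at s (phi x) -> closed2_at (pullback2 phi s) x.
Proof.
move=> cs V1 V2 V3 v1 v2 v3.
have [n [f [V [chi [schi chix hc]]]]] := CY (phi x).
have [sf vV dV _ _] := hc.
have tV i y : tangent y (V i y) by case: (vV i).
pose y_ a := f a \o phi.
have sy a : smooth X (y_ a) by exact: sphi.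
pose w_ a b := fun y => s y (V a y) (V b y).
have sw a b : smooth Y (w_ a b) by case: hs => _ _; apply.
have swp a b : smooth X (w_ a b \o phi) by exact: sphi.
pose w a b := w_ a b (phi x).
have skew a b : w a b = - w b a by apply: form2C.
have lieq (P Q S : X -> functional R X) : is_vfield P -> is_vfield Q -> is_vfield S ->
  P x (fun y => pullback2 phi s y (Q y) (S y)) =
  \sum_a \sum_b ((P x (fun z => Q z (y_ a)) * S x (y_ b) + Q x (y_ a) * P x (fun z => S z (y_ b))) * w a b +
    Q x (y_ a) * S x (y_ b) * P x (w_ a b \o phi)).
  move=> vP vQ vS; have [tP _] := vP; have [tQ sQ] := vQ; have [tS sS] := vS.
  have sQy a : smooth X (fun z => Q z (y_ a)) by exact: sQ.
  have sSy a : smooth X (fun z => S z (y_ a)) by exact: sS.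
  rewrite (@tangent_near _ _ HX _ _ (tP x) _ (fun z => \sum_a \sum_b Q z (y_ a) * S z (y_ b) * (w_ a b \o phi) z)).
  - exact: (tangent_bilinear HX (tP x) sQy sSy swp).
  - by have [_ _ h] := pullback2_form2; exact: h.
  - by apply: (smooth_sum HX) => a; apply: (smooth_sum HX) => b; do 2!apply: smoothM => //.
  - apply: near_pt_sub (near_pt_preimage (near_pt_nonzero schi chix)) => z cz.
    exact: (pullback2_coords schi hc cz).
have brack (P Q S : X -> functional R X) : is_vfield P -> is_vfield Q -> is_vfield S ->
  pullback2 phi s x (bracket P Q x) (S x) =
  \sum_a \sum_b (w a b * ((P x (fun z => Q z (y_ a)) - Q x (fun z => P z (y_ a))) * S x (y_ b))).
  move=> vP vQ vS; rewrite (pullback2_coords schi hc chix); last by case: vS.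
    by apply: eq_bigr => a _; apply: eq_bigr => b _; rewrite mulrC.
  by case: (vfield_bracket HX vP vQ).
pose dw c a b := V c (phi x) (w_ a b).
have dwE P a b : is_vfield P -> P x (w_ a b \o phi) = \sum_c P x (y_ c) * dw c a b.
  move=> [tP _]; rewrite -(pushE _ (sw a b)).
  rewrite (coords_tangent HY schi hc chix (push_tangent (tP x))) functional_sumE.
  by apply: eq_bigr => c _; rewrite pushE.
(* Coordinate fields commute at the point because each [V b] applied to [f c] is constant near
   it. *)
have bracket0 a b : bracket (V a) (V b) (phi x) = 0.
  have [tab _] := vfield_bracket HY (vV a) (vV b).
  rewrite (coords_tangent HY schi hc chix (tab (phi x))) big1 // => c _.
  suff -> : bracket (V a) (V b) (phi x) (f c) = 0 by rewrite scale0r.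
  have h a' b' : V a' (phi x) (fun y => V b' y (f c)) = 0.
    rewrite (@tangent_near _ _ HY _ _ (tV a' (phi x)) _ (fun=> (b' == c)%:R)).
    - exact: (tangent_cst HY (tV a' _)).
    - by case: (vV b') => _; apply.
    - exact: smooth_cst.
    - by apply: near_pt_sub (near_pt_nonzero schi chix) => z cz; exact: dV.
  by rewrite /bracket !h subrr.
have dw0 a b c : dw c a b + dw a b c + dw b c a = 0.
  have := cs (V c) (V a) (V b) (vV c) (vV a) (vV b).
  by rewrite !bracket0 !(form2_0l hs) // !subr0.
rewrite !lieq // !brack //.
rewrite -!big_split -!sumrB /=.
under eq_bigr do rewrite -!big_split -!sumrB /=.
pose X1 := V1 x; pose X2 := V2 x; pose X3 := V3 x.
(* What remains of the second derivatives after cancellation against the bracket terms, grouped into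
   symmetric pairs. *)
pose T (a b : 'I_n) := 
   (X2 (y_ a) * X1 (fun z => V3 z (y_ b)) + X1 (fun z => V3 z (y_ a)) * X2 (y_ b)) +
   (X3 (y_ a) * X2 (fun z => V1 z (y_ b)) + X2 (fun z => V1 z (y_ a)) * X3 (y_ b)) +
   (X1 (y_ a) * X3 (fun z => V2 z (y_ b)) + X3 (fun z => V2 z (y_ a)) * X1 (y_ b)).
pose S (a b c : 'I_n) := X2 (y_ a) * X3 (y_ b) * X1 (y_ c).
have E0 : \sum_a \sum_b X2 (y_ a) * X3 (y_ b) * X1 (w_ a b \o phi) +
   \sum_a \sum_b X3 (y_ a) * X1 (y_ b) * X2 (w_ a b \o phi) +
   \sum_a \sum_b X1 (y_ a) * X2 (y_ b) * X3 (w_ a b \o phi) +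
   \sum_a \sum_b w a b * T a b = 0.
  rewrite (sum_skew skew); last by move=> a b; rewrite /T; ring.
  rewrite addr0.
  have -> : \sum_a \sum_b X2 (y_ a) * X3 (y_ b) * X1 (w_ a b \o phi) =
            \sum_a \sum_b \sum_c S a b c * dw c a b.
    apply: eq_bigr => a _; apply: eq_bigr => b _; rewrite /X1 (dwE _ _ _ v1) mulr_sumr.
    by apply: eq_bigr => c _; rewrite /S /X1 /X2 /X3; ring.
  have -> : \sum_a \sum_b X3 (y_ a) * X1 (y_ b) * X2 (w_ a b \o phi) =
            \sum_a \sum_b \sum_c S a b c * dw a b c.
    rewrite [RHS](_ : _ = \sum_a \sum_b \sum_c X3 (y_ b) * X1 (y_ c) * (X2 (y_ a) * dw a b c)); last first.
      by apply: eq_bigr => a _; apply: eq_bigr => b _; apply: eq_bigr => c _; rewrite /S /X1 /X2 /X3; ring.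
    rewrite -(sum_cycle (fun a b c => X3 (y_ a) * X1 (y_ b) * (X2 (y_ c) * dw c a b))).
    by apply: eq_bigr => a _; apply: eq_bigr => b _; rewrite /X2 (dwE _ _ _ v2) mulr_sumr.
  have -> : \sum_a \sum_b X1 (y_ a) * X2 (y_ b) * X3 (w_ a b \o phi) =
            \sum_a \sum_b \sum_c S a b c * dw b c a.
    rewrite [RHS](_ : _ = \sum_a \sum_b \sum_c X1 (y_ c) * X2 (y_ a) * (X3 (y_ b) * dw b c a)); last first.
      by apply: eq_bigr => a _; apply: eq_bigr => b _; apply: eq_bigr => c _; rewrite /S /X1 /X2 /X3; ring.
    rewrite -(sum_cycle (fun a b c => X1 (y_ b) * X2 (y_ c) * (X3 (y_ a) * dw a b c))).
    rewrite -(sum_cycle (fun a b c => X1 (y_ a) * X2 (y_ b) * (X3 (y_ c) * dw c a b))).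
    by apply: eq_bigr => a _; apply: eq_bigr => b _; rewrite /X3 (dwE _ _ _ v3) mulr_sumr.
  rewrite -!big_split big1 // => a _; rewrite -!big_split big1 // => b _.
  by rewrite -!big_split big1 // => c _ /=; rewrite -!mulrDr dw0 mulr0.
rewrite -[RHS]E0.
rewrite -!big_split; apply: eq_bigr => a _; rewrite -!big_split /=; apply: eq_bigr => b _.
rewrite /T /X1 /X2 /X3; ring.
Qed.

End Pullback.

(** * Projection along the kernel of a two-form *)

Section Projection.
Variables (R : realType) (X : dspace R).
Hypothesis HX : Cinfty_closed X.
Variables (s : form2 X) (hs : is_form2 s) (G : tdistribution X).
Hypothesis hG : complement (kernel2 s) G.

Lemma subbundle_tangent x v : G x v -> tangent x v.
Proof. by case: hG => [[h _ _] _ _]; exact: h. Qed.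

Lemma subbundle_lin x a v w : G x v -> G x w -> G x (a *: v + w).
Proof. by case: hG => [[_ /(_ x)[_ h] _] _ _]; exact: h. Qed.

Lemma subbundle0 x : G x 0.
Proof. by case: hG => [[_ /(_ x)[h _] _] _ _]. Qed.

Lemma subbundleN x v : G x v -> G x (- v).
Proof. by move=> Gv; rewrite -scaleN1r -[_ *: _]addr0; apply: subbundle_lin => //; exact: subbundle0. Qed.

Lemma subbundle_comb x (I : Type) (r : seq I) (c : I -> R) (A : I -> functional R X) :
  (forall i, G x (A i)) -> G x (\sum_(i <- r) c i *: A i).
Proof.
move=> hA; elim: r => [|i r IH]; first by rewrite big_nil; exact: subbundle0.
by rewrite big_cons; exact: subbundle_lin.
Qed.

Lemma proj_alongP x v : tangent x v ->
  G x (proj_along (kernel2 s) G x v) /\ kernel2 s x (v - proj_along (kernel2 s) G x v).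
Proof.
move=> tv; rewrite /proj_along; case: xgetP => [g _ [Gg kg] //|h].
case: hG => _ /(_ x v tv)[u [w [ku Gw vE]]] _.
by exfalso; apply: (h w); split=> //; rewrite vE addrK.
Qed.

Lemma proj_along_unique x v g : G x g -> kernel2 s x (v - g) -> proj_along (kernel2 s) G x v = g.
Proof.
move=> Gg kg; have tv : tangent x v.
  by rewrite -(subrK g v); apply: tangentDv ; [case: kg|exact: subbundle_tangent].
have [Gp kp] := proj_alongP tv; case: hG => _ _ h.
apply/eqP; rewrite -subr_eq0; apply/eqP; apply: (h x).
  set p := proj_along _ _ _ _ in Gp kp *.
  have -> : p - g = (v - g) - (v - p) by rewrite opprB addrCA [v - g]addrC addrK.
  exact: kernel2B.
by rewrite -[proj_along _ _ _ _]scale1r; apply: subbundle_lin => //; exact: subbundleN.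
Qed.

Lemma proj_along_congr x v w : tangent x v -> kernel2 s x (w - v) ->
  proj_along (kernel2 s) G x w = proj_along (kernel2 s) G x v.
Proof.
move=> tv k; have [Gp kp] := proj_alongP tv; apply: proj_along_unique => //.
by rewrite -(subrK v w) -addrA; exact: kernel2D.
Qed.

Lemma proj_alongN x v : tangent x v ->
  proj_along (kernel2 s) G x (- v) = - proj_along (kernel2 s) G x v.
Proof.
move=> tv; have [Gp kp] := proj_alongP tv; apply: proj_along_unique; first exact: subbundleN.
by rewrite -opprD; exact: kernel2N.
Qed.

Lemma form2_proj x v w : tangent x v -> tangent x w ->
  s x (proj_along (kernel2 s) G x v) w = s x v w.
Proof.
move=> tv tw; have [Gp kp] := proj_alongP tv.
have tp := subbundle_tangent Gp.
rewrite -{2}(subrK (proj_along (kernel2 s) G x v) v) form2Dl //; last by case: kp.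
by rewrite (kernel2l kp) // add0r.
Qed.

(** A vector orthogonal to [G] is orthogonal to kernel + [G], the whole tangent space; if it lies in
    [G] it is in the intersection of [G] with the kernel. *)
Lemma complement_nondegenerate x g : G x g -> (forall z, G x z -> s x g z = 0) -> g = 0.
Proof.
move=> Gg h; have tg := subbundle_tangent Gg; case: (hG) => _ dec h0; apply: (h0 x) => //.
split=> // w tw; have [u [z [ku Gz ->]]] := dec x w tw.
have tu : tangent x u by case: ku.
have tz := subbundle_tangent Gz.
rewrite form2C //; last exact: tangentDv.
by rewrite form2Dl // (kernel2l ku) // add0r -form2C // h.
Qed.

Section Frame.
Variables (r : nat) (V : 'I_r -> X -> functional R X).
Hypothesis hV : forall i, dsection G (V i).

(** The Gram matrix of the form in a local frame of [G]. Its inverse makes the projection along the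
    kernel smooth and provides the values of [wC_sharp]. *)
Definition gram (y : X) : 'M[R]_r := \matrix_(i, j) s y (V i y) (V j y).

Definition is_frame (y : X) : Prop :=
  (forall v, G y v -> exists c : 'I_r -> R, v = \sum_(i < r) c i *: V i y) /\
  (forall c : 'I_r -> R, \sum_(i < r) c i *: V i y = 0 -> forall i, c i = 0).

(** A row in the left kernel of the Gram matrix gives a combination of the frame that is orthogonal
    to [G]; it is 0 by nondegeneracy, so the row is 0 by freeness. *)
Lemma gram_unit y : is_frame y -> gram y \in unitmx.
Proof.
move=> [hspan hfree]; rewrite unitmxE unitfE; apply/negP => /det0P[c c0 hc].
have GV i : G y (V i y) by case: (hV i).
have tV i : tangent y (V i y) by exact: subbundle_tangent.
have Gc : G y (\sum_i c 0 i *: V i y) by exact: subbundle_comb.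
suff hz : \sum_i c 0 i *: V i y = 0.
  by case/eqP: c0; apply/rowP => i; rewrite mxE; exact: hfree hz i.
apply: (complement_nondegenerate Gc) => z /hspan[d ->].
rewrite (form2_sumr hs) //; last exact: (subbundle_tangent Gc).
rewrite big1 // => j _; rewrite (form2_suml hs) //.
have := congr1 (fun w : 'rV[R]_r => w 0 j) hc; rewrite !mxE => h.
by rewrite (eq_bigr (fun i => c 0 i * gram y i j)) ?h ?mulr0 // => i _; rewrite mxE.
Qed.

Definition gram_coef (y : X) (b : 'I_r -> R) (i : 'I_r) : R :=
  ((\row_j b j) *m invmx (gram y)) 0 i.

Lemma gram_solve y (b : 'I_r -> R) j : is_frame y ->
  s y (\sum_i gram_coef y b i *: V i y) (V j y) = b j.
Proof.
move=> fy; have GV i : G y (V i y) by case: (hV i).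
have tV i : tangent y (V i y) by exact: subbundle_tangent.
rewrite (form2_suml hs) //.
have h : ((\row_j b j) *m invmx (gram y) *m gram y) 0 j = b j.
  by rewrite mulmxKV ?gram_unit // mxE.
by rewrite -h [RHS]mxE; apply: eq_bigr => i _; rewrite [gram y i j]mxE.
Qed.

(** The right-hand side is the vector of [G] with the same pairings against the frame as [v]. The
    difference pairs to 0 with [G] and with the kernel, so it lies in the kernel. *)
Lemma proj_along_frame y v : is_frame y -> tangent y v ->
  proj_along (kernel2 s) G y v = \sum_i gram_coef y (fun j => s y v (V j y)) i *: V i y.
Proof.
move=> fy tv; set g := \sum_i _.
have GV i : G y (V i y) by case: (hV i).
have Gg : G y g by exact: subbundle_comb.
have tg := subbundle_tangent Gg.
apply: proj_along_unique => //; split; first exact: tangentBv.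
have tvg : tangent y (v - g) by exact: tangentBv.
move=> w tw; case: hG => _ /(_ y w tw)[u [z [ku Gz ->]]] _.
have tu : tangent y u by case: ku.
have tz := subbundle_tangent Gz.
have tuz : tangent y (u + z) by exact: tangentDv.
rewrite form2C // form2Dl // (kernel2l ku) // add0r -form2C //.
have [/(_ z Gz)[d ->] _] := fy.
rewrite (form2_sumr hs) //; last by move=> i; exact: subbundle_tangent.
rewrite big1 // => j _; rewrite form2Bl //; last exact: subbundle_tangent.
by rewrite gram_solve // subrr mulr0.
Qed.

Lemma smooth_det n (A : X -> 'M[R]_n) : (forall i j, smooth X (fun y => A y i j)) ->
  smooth X (fun y => \det (A y)).
Proof.
move=> hA; rewrite /determinant; apply: (smooth_sum HX) => t.
apply: (smoothM HX); first exact: smooth_cst.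
by apply: (smooth_prod HX) => i.
Qed.

Lemma smooth_gram i j : smooth X (fun y => gram y i j).
Proof.
under eq_fun do rewrite mxE; case: hs => _ _ h.
by apply: h; [case: (hV i)|case: (hV j)].
Qed.

Lemma smooth_adj i j : smooth X (fun y => (\adj (gram y)) i j).
Proof.
have -> : (fun y => (\adj (gram y)) i j) =
    (fun y => (-1) ^+ (j + i) * \det (row' j (col' i (gram y)))).
  by apply/funext => y; rewrite mxE.
apply: (smoothM HX); first exact: smooth_cst.
apply: smooth_det => k l.
have -> : (fun y => (row' j (col' i (gram y))) k l) = (fun y => gram y (lift j k) (lift i l)).
  by apply/funext => y; rewrite !mxE.
exact: smooth_gram.
Qed.

(** By the adjugate formula: the determinant is nonzero at [x], and [d] is a globally smooth
    function that is its inverse near [x]. *)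
Lemma smooth_gram_coef (b : 'I_r -> X -> R) i x : (forall j, smooth X (b j)) -> is_frame x ->
  near_pt x is_frame ->
  exists2 c, smooth X c & near_pt x (fun y => gram_coef y (b^~ y) i = c y).
Proof.
move=> sb fx nf.
have dx : \det (gram x) != 0 by rewrite -unitfE -unitmxE gram_unit.
have [d sd hd] := smooth_inv_near HX (smooth_det smooth_gram) dx.
exists (fun y => \sum_j b j y * (d y * (\adj (gram y)) j i)).
  apply: (smooth_sum HX) => j; apply: (smoothM HX) => //; apply: (smoothM HX) => //.
  exact: smooth_adj.
apply: near_pt_sub (near_pt_and HX nf hd) => y [fy dy].
rewrite /gram_coef mxE; apply: eq_bigr => j _.
by rewrite mxE /invmx gram_unit // mxE dy.
Qed.

End Frame.

Lemma dopen_near (A : set X) x : dopen A -> A x -> near_pt x A.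
Proof.
move=> oA Ax; have [m [g [e [sg e0 hA]]]] := oA x Ax.
exact: near_pt_sub hA (near_pt_box HX x sg e0).
Qed.

Lemma near_frame x : exists r (V : 'I_r -> X -> functional R X),
  (forall i, dsection G (V i)) /\ near_pt x (is_frame V).
Proof.
case: hG => [[_ _ /(_ x)[r [V [A [oA Ax hV hA]]]]] _ _].
by exists r, V; split=> //; apply: near_pt_sub (dopen_near oA Ax).
Qed.

Lemma dsection_proj V : is_vfield V -> dsection G (fun y => proj_along (kernel2 s) G y (V y)).
Proof.
move=> [tV sV]; split; last by move=> x; case: (proj_alongP (tV x)).
split=> [x|g sg]; first by apply: subbundle_tangent; case: (proj_alongP (tV x)).
apply: (smooth_local HX) => x.
have [r [W [hW nf]]] := near_frame x.
have fx := near_pt_self nf.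
have sb j : smooth X (fun y => s y (V y) (W j y)).
  by case: hs => _ _ h; apply: h => //; case: (hW j).
have /choice[c hc] : forall i, exists c, smooth X c /\
    near_pt x (fun y => gram_coef W y (fun j => s y (V y) (W j y)) i = c y).
  by move=> i; have [c] := smooth_gram_coef hW i sb fx nf; exists c.
exists (fun y => \sum_i c i y * W i y g).
  apply: (smooth_sum HX) => i; apply: (smoothM HX); first by case: (hc i).
  by case: (hW i) => -[_ sW] _; exact: sW.
have nall : forall (m : nat) (P : 'I_m -> X -> Prop), (forall i, near_pt x (P i)) ->
    near_pt x (fun y => forall i, P i y).
  elim=> [|m IH] P hP; first by apply: near_pt_sub (near_pt_all HX x) => y _ [].
  apply: near_pt_sub (near_pt_and HX (hP ord0) (IH _ (fun i => hP (lift ord0 i)))) => y [h0 h1] i.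
  by case: (unliftP ord0 i) => [j|] ->.
have nc := nall _ _ (fun i => proj2 (hc i)).
apply: near_pt_sub (near_pt_and HX nf nc) => y [fy cy].
rewrite (proj_along_frame hW) // functional_sumE; apply: eq_bigr => i _.
by rewrite cy.
Qed.

Lemma dsection_ker_proj V : is_vfield V ->
  dsection (kernel2 s) (fun y => V y - proj_along (kernel2 s) G y (V y)).
Proof.
move=> vV; have [tV sV] := vV; split; last by move=> x; case: (proj_alongP (tV x)).
by apply: (vfieldB HX) => //; case: (dsection_proj vV).
Qed.

(** A solution has to be exhibited to exclude the default of [xget]; the Gram matrix of a frame at
    [x] gives one. *)
Lemma wC_sharpP x b : is_covector (G x) b ->
  G x (wC_sharp s G x b) /\ forall Z, G x Z -> s x (wC_sharp s G x b) Z = b Z.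
Proof.
move=> [lb _]; rewrite /wC_sharp; case: xgetP => [Y _ //|h].
have [r [W [hW /near_pt_self fx]]] := near_frame x.
have GV i : G x (W i x) by case: (hW i).
have Gg : G x (\sum_i gram_coef W x (fun j => b (W j x)) i *: W i x) by exact: subbundle_comb.
exfalso; apply: (h _); split; first exact: Gg.
move=> Z GZ; have [/(_ Z GZ)[d ->] _] := fx.
rewrite (form2_sumr hs) //; [|by move=> i; exact: subbundle_tangent|exact: subbundle_tangent].
have bsum (t : seq 'I_r) : b (\sum_(i <- t) d i *: W i x) = \sum_(i <- t) d i * b (W i x).
  elim: t => [|i t IH].
    rewrite !big_nil; have := lb (-1) 0 0 (subbundle0 x) (subbundle0 x).
    by rewrite scaler0 addr0 mulN1r addNr.
  by rewrite !big_cons lb ?IH //; exact: subbundle_comb.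
by rewrite bsum; apply: eq_bigr => j _; rewrite (gram_solve hW).
Qed.

(** The pairings of the form with the vectors [z] of [G], set to 0 off [G], are covectors, and by
    nondegeneracy there are enough of them. *)
Lemma covector_separates x Y Y' : G x Y -> G x Y' ->
  (forall b, is_covector (G x) b -> b Y = b Y') -> Y = Y'.
Proof.
move=> GY GY' h; apply/eqP; rewrite -subr_eq0; apply/eqP.
have GB : G x (Y - Y').
  by rewrite -[Y]scale1r; apply: subbundle_lin => //; exact: subbundleN.
apply: (complement_nondegenerate GB) => z Gz.
have tY := subbundle_tangent GY; have tY' := subbundle_tangent GY'; have tz := subbundle_tangent Gz.
rewrite form2Bl //.
pose b v := if `[< G x v >] then s x v z else 0.
have := h b; rewrite /b !asboolT // => ->; first by rewrite subrr.
split=> [a v w Gv Gw|v nGv]; last by rewrite asboolF.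
rewrite !asboolT //; last exact: subbundle_lin.
by rewrite form2_linl //; exact: subbundle_tangent.
Qed.

End Projection.

(** * Derivatives in the time variable *)

Section Time_derivative.
Variables (R : realType) (J : set R).

(** A derivative at 0 that sees only the times in [J], one-sided when 0 is an endpoint; it is the
    limit used in [derivative_at_0]. *)
Definition has_rate (u : R -> R) (l : R) : Prop :=
  t^-1 * (u t - u 0) @[t --> within J 0^'] --> l.

Lemma within_dnbhsP (P : R -> Prop) (e : R) : 0 < e ->
  (forall t, J t -> t != 0 -> `|t| < e -> P t) -> \forall t \near within J 0^', P t.
Proof.
move=> e0 hP; apply/nbhs_ballP; exists e => //= t.
by rewrite /ball /= sub0r normrN => te t0 Jt; exact: hP.
Qed.

Lemma within_dnbhs_cvg0 : (fun t : R => t) @ within J 0^' --> (0 : R).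
Proof.
apply/cvgrPdist_lt => e e0; apply: (within_dnbhsP e0) => t _ _.
by rewrite sub0r normrN.
Qed.

Lemma has_rate_is_derive (phi u : R -> R) (l e : R) : 0 < e -> is_derive (0 : R) 1 phi l ->
  (forall t, J t -> `|t| < e -> u t = phi t) -> J 0 -> has_rate u l.
Proof.
move=> e0 [dphi <-] hu J0.
have h1 : h^-1 *: (phi (h *: 1 + 0) - phi 0) @[h --> 0^'] --> 'D_1 phi 0.
  exact: dphi.
have h2 : h^-1 *: (phi (h *: 1 + 0) - phi 0) @[h --> within J 0^'] --> 'D_1 phi 0.
  by apply: cvg_trans h1; apply: cvg_app; exact: cvg_within.
apply: near_eq_cvg_to h2; apply: (within_dnbhsP e0) => t Jt t0 te.
by rewrite addr0 [t *: 1]mulr1 -[_ *: _]/(_ * _) hu // [u 0]hu // normr0.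
Qed.

Hypotheses (hJ : is_interval J) (J0 : J 0) (hJne : exists2 t, J t & t != 0).

(** This is what makes limits at 0 within [J] unique. A nonzero time of [J] is scaled towards 0 and
    stays in [J] because [J] is an interval. *)
Instance within_dnbhs_proper : ProperFilter (within J (0 : R)^').
Proof.
apply: Build_ProperFilter_ex => P /nbhs_ballP[e /= e0 hP].
have [t Jt t0] := hJne.
pose s := Num.min 1 (e / 2 / `|t|).
have nt : 0 < `|t| by rewrite normr_gt0.
have s0 : 0 < s by rewrite lt_min ltr01 !divr_gt0.
have s1 : s <= 1 by rewrite ge_min lexx.
have st : s * `|t| < e.
  apply: (@le_lt_trans _ _ (e / 2)); last by rewrite ltr_pdivrMr // ltr_pMr // ltr1n.
  by rewrite -ler_pdivlMr // ge_min lexx orbT.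
exists (s * t); apply: hP.
- by rewrite /ball /= sub0r normrN normrM gtr0_norm.
- by rewrite mulf_neq0 // gt_eqF.
- have [tp|tn] := leP 0 t.
    by apply: (hJ J0 Jt); rewrite mulr_ge0 ?(ltW s0) //= ler_piMl.
  apply: (hJ Jt J0); rewrite mulr_ge0_le0 ?(ltW s0) ?(ltW tn) // andbT.
  by rewrite -subr_ge0 -[X in _ - X]mul1r -mulrBl mulr_le0 ?subr_le0 // ltW.
Qed.

Lemma has_rate_unique u l l' : has_rate u l -> has_rate u l' -> l = l'.
Proof. by move=> h h'; apply: (cvg_unique _ h h'); exact: norm_hausdorff. Qed.

Lemma has_rate_cvg u l : has_rate u l -> u t @[t --> within J 0^'] --> u 0.
Proof.
move=> hu; have h1 : t * (t^-1 * (u t - u 0)) + u 0 @[t --> within J 0^'] --> 0 * l + u 0.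
  exact: (cvgD (cvgM within_dnbhs_cvg0 hu) (cvg_cst (u 0))).
rewrite mul0r add0r in h1; apply: near_eq_cvg_to h1.
by apply: (within_dnbhsP ltr01) => t _ t0 _; rewrite mulVKf // subrK.
Qed.

Lemma has_rateD u v l m : has_rate u l -> has_rate v m -> has_rate (fun t => u t + v t) (l + m).
Proof.
move=> hu hv; rewrite /has_rate.
have -> : (fun t => t^-1 * (u t + v t - (u 0 + v 0))) =
    (fun t => t^-1 * (u t - u 0)) + (fun t => t^-1 * (v t - v 0)).
  by apply/funext => t; rewrite -[RHS]/(_ * _ + _ * _); ring.
exact: cvgD hu hv.
Qed.

Lemma has_rate_cst c : has_rate (fun=> c) 0.
Proof.
apply: near_eq_cvg_to (cvg_cst 0); apply: nearW => t; by rewrite subrr mulr0.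
Qed.

Lemma has_rateM u v l m : has_rate u l -> has_rate v m ->
  has_rate (fun t => u t * v t) (l * v 0 + u 0 * m).
Proof.
move=> hu hv.
have h1 : (t^-1 * (u t - u 0)) * v t @[t --> within J 0^'] --> l * v 0.
  by apply: cvgM => //; exact: has_rate_cvg hv.
have h2 : u 0 * (t^-1 * (v t - v 0)) @[t --> within J 0^'] --> u 0 * m.
  by apply: cvgM => //; exact: cvg_cst.
rewrite /has_rate.
have -> : (fun t => t^-1 * (u t * v t - u 0 * v 0)) =
    (fun t => (t^-1 * (u t - u 0)) * v t) + (fun t => u 0 * (t^-1 * (v t - v 0))).
  by apply/funext => t; rewrite -[RHS]/(_ * _ + _ * _); ring.
exact: cvgD h1 h2.
Qed.

Lemma has_rate_sum (I : Type) (r : seq I) (u : I -> R -> R) (l : I -> R) :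
  (forall i, has_rate (u i) (l i)) -> has_rate (fun t => \sum_(i <- r) u i t) (\sum_(i <- r) l i).
Proof.
move=> hu; elim: r => [|i r IH].
  by rewrite big_nil; under eq_fun do rewrite big_nil; exact: has_rate_cst.
by rewrite big_cons; under eq_fun do rewrite big_cons; exact: has_rateD.
Qed.

Lemma has_rate_near u v l e : 0 < e -> (forall t, J t -> `|t| < e -> u t = v t) ->
  has_rate u l -> has_rate v l.
Proof.
move=> e0 uv; apply: near_eq_cvg_to; apply: (within_dnbhsP e0) => t Jt t0 te.
by rewrite uv // [u 0]uv // normr0.
Qed.

Variable X : dspace R.
Hypotheses (HX : Cinfty_closed X).

Definition cyl_smooth (h : R -> X -> R) : Prop :=
  smooth (cylinder J X) (fun q => h (sval q.1) q.2).

Definition time_row m (b : 'I_m -> bool) (f : 'I_m -> X -> R) (t : R) (y : X) : 'rV[R]_m :=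
  \row_i (if b i then t else f i y).

(** Unfolds [generated] at (0, x): each generator is either the time or a function on [X], and [b]
    tells which. The function [F] makes sense for all times, also outside [J]. *)
Lemma cyl_smooth_local h x : cyl_smooth h ->
  exists m (b : 'I_m -> bool) (f : 'I_m -> X -> R) e (F : 'rV[R]_m -> R),
  [/\ forall i, smooth X (f i), 0 < e, Cinfty setT F &
      forall t y, J t -> `|t| < e -> box f x e y -> h t y = F (time_row b f t y)].
Proof.
move=> /(_ (exist _ 0 J0, x))[m [g [e [F [Sg e0 hF hE]]]]].
have /choice[b hb] : forall i, exists b : bool * (X -> R),
    smooth X b.2 /\ g i = fun q => if b.1 then sval q.1 else b.2 q.2.
  move=> i; case: (Sg i) => [->|[f sf ->]].
    by exists (true, fun=> 0); split=> //; exact: smooth_cst.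
  by exists (false, f).
exists m, (fun i => (b i).1), (fun i => (b i).2), e, F; split=> //.
  by move=> i; case: (hb i).
move=> t y Jt te hy.
have := hE (exist _ t Jt, y); rewrite /= => ->; last first.
  move=> i; case: (hb i) => _ -> /=; case: ((b i).1); first by rewrite subr0.
  exact: hy.
congr F; apply/rowP => i; rewrite !mxE; by case: (hb i) => _ ->.
Qed.

Lemma time_row_derive m (b : 'I_m -> bool) f (F : 'rV[R]_m -> R) y (s : R) : Cinfty setT F ->
  is_derive s 1 (fun t => F (time_row b f t y))
    (\sum_i (b i)%:R * 'D_(delta_mx 0 i) F (time_row b f s y)).
Proof.
move=> hF; pose g (i : 'I_m) (t : R) := if b i then t else f i y.
have dg i : is_derive s 1 (g i) ((b i)%:R).
  by rewrite /g; case: (b i); [exact: is_derive_id|exact: is_derive_cst].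
have dF : differentiable F (\row_i g i s) by exact: Ck1_differentiable openT I (hF 1%N).
have := chain_rule dF (fun i => (let: DeriveDef h _ := dg i in h) : derivable (g i) s 1).
rewrite (eq_bigr (fun i => (b i)%:R * 'D_(delta_mx 0 i) F (time_row b f s y))) // => i _.
by congr (_ * _); case: (dg i).
Qed.

Definition tdot (h : R -> X -> R) (x : X) : R := xget 0 [set l | has_rate (h^~ x) l].

Lemma tdotE h x l : has_rate (h^~ x) l -> tdot h x = l.
Proof.
move=> hl; rewrite /tdot; case: xgetP => [l' _ hl'|/(_ l)//].
exact: has_rate_unique hl' hl.
Qed.

Lemma tdot_local h x m (b : 'I_m -> bool) f e (F : 'rV[R]_m -> R) : 
  0 < e -> Cinfty setT F ->
  (forall t y, J t -> `|t| < e -> box f x e y -> h t y = F (time_row b f t y)) ->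
  forall y, box f x e y ->
    has_rate (h^~ y) (\sum_i (b i)%:R * 'D_(delta_mx 0 i) F (time_row b f 0 y)).
Proof.
move=> e0 hF hE y hy; apply: (has_rate_is_derive e0 (time_row_derive _ _ y 0 hF)) => // t Jt te.
exact: hE.
Qed.

Lemma box_self m (f : 'I_m -> X -> R) x e : 0 < e -> box f x e x.
Proof. by move=> e0 i; rewrite subrr normr0. Qed.

Lemma tdot_rate h x : cyl_smooth h -> has_rate (h^~ x) (tdot h x).
Proof.
move=> sh; have [m [b [f [e [F [sf e0 hF hE]]]]]] := cyl_smooth_local x sh.
have H := tdot_local e0 hF hE (box_self f x e0); by rewrite (tdotE H).
Qed.

Lemma Cinfty_derive n (F : 'rV[R]_n -> R) i : Cinfty setT F -> Cinfty setT ('D_(delta_mx 0 i) F).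
Proof. by move=> hF k; have [_ /(_ i)[]] := hF k.+1. Qed.

Lemma smooth_time_row m (b : 'I_m -> bool) f (F : 'rV[R]_m -> R) (t : R) :
  (forall i, smooth X (f i)) -> Cinfty setT F -> smooth X (fun y => F (time_row b f t y)).
Proof.
move=> sf hF; apply: (smooth_comp HX (g := fun i y => if b i then t else f i y)) => // i.
by case: (b i) => //; exact: smooth_cst.
Qed.

Lemma tdot_smooth h : cyl_smooth h -> smooth X (tdot h).
Proof.
move=> sh; apply: (smooth_local HX) => x.
have [m [b [f [e [F [sf e0 hF hE]]]]]] := cyl_smooth_local x sh.
exists (fun y => \sum_i (b i)%:R * 'D_(delta_mx 0 i) F (time_row b f 0 y)).
  apply: (smooth_sum HX) => i; apply: (smoothM HX); first exact: smooth_cst.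
  exact: (@smooth_time_row _ b f _ 0 sf (Cinfty_derive i hF)).
apply: near_pt_sub (near_pt_box HX x sf e0) => y hy.
by apply: tdotE; exact: (tdot_local e0 hF hE hy).
Qed.

Lemma tangent_time_row m (b : 'I_m -> bool) f (F : 'rV[R]_m -> R) (t : R) x v : tangent x v ->
  (forall i, smooth X (f i)) -> Cinfty setT F ->
  v (fun y => F (time_row b f t y)) =
    \sum_i (if b i then 0 else v (f i)) * 'D_(delta_mx 0 i) F (time_row b f t x).
Proof.
move=> tv sf hF; rewrite (tangent_comp HX tv (g := fun i y => if b i then t else f i y)) //.
  apply: eq_bigr => i _; rewrite mulrC; congr (_ * _); case: (b i) => //.
  exact: (tangent_cst HX tv).
by move=> i; case: (b i) => //; exact: smooth_cst.
Qed.

(* Derivations in the space variable commute with d/dt: this is the symmetry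
   of second partial derivatives. *)
Lemma tdot_tangent h x v : cyl_smooth h -> (forall t, J t -> smooth X (h t)) -> tangent x v ->
  has_rate (fun t => v (h t)) (v (tdot h)).
Proof.
move=> sh sht tv; have [m [b [f [e [F [sf e0 hF hE]]]]]] := cyl_smooth_local x sh.
have hD i := Cinfty_derive i hF.
pose c i := if b i then 0 else v (f i).
have vh t : J t -> `|t| < e -> v (h t) = \sum_i c i * 'D_(delta_mx 0 i) F (time_row b f t x).
  move=> Jt te; rewrite -(tangent_time_row _ _ tv sf hF).
  apply: (tangent_near HX tv); [exact: sht|exact: (@smooth_time_row _ b f _ t sf hF)|].
  by apply: near_pt_sub (near_pt_box HX x sf e0) => y; exact: hE.
have sD i : smooth X (fun y => 'D_(delta_mx 0 i) F (time_row b f 0 y)) by exact: (@smooth_time_row _ b f _ 0 sf (hD i)).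
have -> : v (tdot h) = \sum_i c i * \sum_k (b k)%:R *
    'D_(delta_mx 0 k) ('D_(delta_mx 0 i) F) (time_row b f 0 x).
  rewrite (tangent_near HX tv (g := fun y => \sum_i (b i)%:R * 'D_(delta_mx 0 i) F (time_row b f 0 y))).
  - rewrite (tangent_sum HX tv); last by move=> i; apply: (smoothM HX) => //; exact: smooth_cst.
    rewrite (eq_bigr (fun k => \sum_i (b k)%:R * (c i * 'D_(delta_mx 0 k) ('D_(delta_mx 0 i) F) (time_row b f 0 x)))).
      rewrite exchange_big /=; apply: eq_bigr => i _; rewrite mulr_sumr.
      by apply: eq_bigr => k _; rewrite mulrCA.
    move=> k _; rewrite (tangentZ HX tv) // (tangent_time_row _ _ tv sf (hD k)) mulr_sumr.
    by apply: eq_bigr => i _; rewrite clairaut.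
  - exact: tdot_smooth.
  - by apply: (smooth_sum HX) => i; apply: (smoothM HX) => //; exact: smooth_cst.
  - apply: near_pt_sub (near_pt_box HX x sf e0) => y hy.
    by apply: tdotE; exact: (tdot_local e0 hF hE hy).
apply: (has_rate_near e0 (u := fun t => \sum_i c i * 'D_(delta_mx 0 i) F (time_row b f t x))).
  by move=> t Jt te; rewrite vh.
apply: has_rate_sum => i.
have := has_rateM (has_rate_cst (c i)) (has_rate_is_derive ltr01 (time_row_derive b f x 0 (hD i)) (fun _ _ _ => erefl) J0).
by rewrite mul0r add0r.
Qed.

(** Joint continuity at (0, x), used to keep [phi t x] in a coordinate domain and to identify
    cluster points in the compactness argument. *)
Lemma cyl_smooth_continuous h x : cyl_smooth h -> forall eps : R, 0 < eps ->
  exists2 d, 0 < d & near_pt x (fun y => forall t, J t -> `|t| < d -> `|h t y - h 0 x| < eps).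
Proof.
move=> sh eps eps0; have [m [b [f [e [F [sf e0 hF hE]]]]]] := cyl_smooth_local x sh.
have cF : F z @[z --> time_row b f 0 x] --> F (time_row b f 0 x).
  exact: (@Ck_continuous R m 0 F (hF 0%N)).
have hn := (@cvgrPdist_lt _ _ _ _ (nbhs_filter _) _ _).1 cF _ eps0.
have [d /= d0 hd] := (nbhs_ballP _ _).1 hn.
pose d' := Num.min d e; have d'0 : 0 < d' by rewrite lt_min d0 e0.
exists d' => //; apply: near_pt_sub (near_pt_box HX x sf d'0) => y hy t Jt.
rewrite lt_min => /andP[td te].
have hye : box f x e y by move=> i; have := hy i; rewrite lt_min => /andP[].
rewrite hE // (hE 0) //; [|by rewrite normr0|exact: box_self].
rewrite distrC; apply: hd; rewrite mx_norm_ball /ball_ /= [ltLHS]/Num.Def.normr /= mx_normrE.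
apply: bigmax_lt => // -[i j] _; rewrite !mxE /=; case: (b j).
  by rewrite sub0r normrN.
by rewrite distrC; have := hy j; rewrite lt_min => /andP[].
Qed.

(** As [h 0] is 0, the motion of the point does not count to first order. The mean value theorem in
    time, at the fixed point [y t], writes [h t (y t)] as t times a time derivative at an
    intermediate time, whose limit requires only continuity of [y] at 0. *)
Lemma tdot_moving h x (y : R -> X) : cyl_smooth h -> (forall z, h 0 z = 0) ->
  (forall f, smooth X f -> f (y t) @[t --> within J 0^'] --> f x) ->
  t^-1 * h t (y t) @[t --> within J 0^'] --> tdot h x.
Proof.
move=> sh h0 hy; have [m [b [f [e [F [sf e0 hF hE]]]]]] := cyl_smooth_local x sh.
have -> : tdot h x = \sum_i (b i)%:R * 'D_(delta_mx 0 i) F (time_row b f 0 x).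
  by apply: tdotE; exact: (tdot_local e0 hF hE (box_self f x e0)).
pose phi z (t : R) := F (time_row b f t z).
have /choice[xi hxi] : forall t : R, exists xi, `|xi| <= `|t| /\
    phi (y t) t - phi (y t) 0 = t * \sum_i (b i)%:R * 'D_(delta_mx 0 i) F (time_row b f xi (y t)).
  move=> t; have dphi s := time_row_derive b f (y t) s hF.
  have dd (s : R) : `|s| <= `|t| -> derivable (phi (y t)) (0 + s *: 1) 1 by case: (dphi (0 + s *: 1)).
  have [s hs E] := mvt_line dd; exists s; split=> //.
  move: E; rewrite !add0r [t *: 1]mulr1 [s *: 1]mulr1 => ->; congr (_ * _).
  by case: (dphi s).
have xi0 : xi t @[t --> within J 0^'] --> (0 : R).
  apply/cvgrPdist_lt => d d0; apply: (within_dnbhsP d0) => t _ _ td.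
  by rewrite sub0r normrN; case: (hxi t) => hx _; exact: le_lt_trans hx td.
have rowc : time_row b f (xi t) (y t) @[t --> within J 0^'] --> time_row b f 0 x.
  apply: (@cvg_row _ _ (within J 0^') _ _ (fun i t => if b i then xi t else f i (y t)) (fun i => if b i then 0 else f i x)) => i.
  by case: (b i) => //; exact: hy.
pose G z := \sum_i (b i)%:R * 'D_(delta_mx 0 i) F z.
have cG : continuous G.
  apply: (@Ck_continuous R m 0); refine (Ck_sum openT _) => i; apply: Ck_mul openT (Ck_cst _ _ _) _.
  exact: (Cinfty_derive i hF 0%N).
have GL := cvg_comp _ _ rowc (cG _).
apply: near_eq_cvg_to GL.
have nb : \forall t \near within J 0^', box f x e (y t).
  apply: (@filter_forall _ _ (fun i => [set t | `|f i (y t) - f i x| < e])) => i.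
  have := (@cvgrPdist_lt _ _ _ _ _ _ _).1 (hy _ (sf i)) _ e0.
  by move=> /(_ _); apply: filterS => t; rewrite distrC.
have ns : \forall t \near within J 0^', [/\ J t, t != 0 & `|t| < e] by exact: within_dnbhsP e0 _.
apply: filterS2 nb ns => t bt [Jt t0 te] /=.
case: (hxi t) => _; rewrite /phi -(hE t) // -(hE 0) ?normr0 // h0 subr0 => ->.
by rewrite mulKf.
Qed.

End Time_derivative.

(** * Paths of deformations *)

Section Bundle.
Variables (R : realType) (C : dspace R).
Hypothesis HX : Cinfty_closed C.

Lemma generated_sub (T : Type) (S : set (T -> R)) : S `<=` generated S.
Proof.
move=> g Sg x; exists 1, (fun=> g), 1, (fun z : 'rV[R]_1 => z 0 0); split=> //.
  by move=> k; apply: Ck_coord; exact: openT.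
by move=> y _; rewrite mxE.
Qed.

Variable D : tdistribution C.

Lemma smooth_base f : smooth C f -> smooth (dual_bundle D) (fun e => f (base e)).
Proof. by move=> sf; apply: generated_sub; left; exists f. Qed.

Lemma smooth_eval V : dsection D V -> smooth (dual_bundle D) (fun e => cov e (V (base e))).
Proof. by move=> sV; apply: generated_sub; right; exists V. Qed.

Lemma smooth_map_dual_bundle (a : C -> dual_bundle D) :
  (forall f, smooth C f -> smooth C (fun x => f (base (a x)))) ->
  (forall V, dsection D V -> smooth C (fun x => cov (a x) (V (base (a x))))) -> smooth_map a.
Proof.
move=> hb hV g sg; apply: (smooth_local HX) => x.
have [m [h [e [F [Sh e0 hF hE]]]]] := sg (a x).
have sh i : smooth C (h i \o a).
  by case: (Sh i) => [[f sf ->]|[V sV ->]]; [exact: hb|exact: hV].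
exists (fun y => F (\row_i (h i \o a) y)); first exact: smooth_comp.
apply: near_pt_sub (near_pt_box HX x sh e0) => y hy; exact: hE.
Qed.

End Bundle.

(** * First-order variation of a path of deformations *)

Section Deformation.
Variables (R : realType) (C : dspace R).
Hypotheses (HX : Cinfty_closed C) (HC : has_coords C).
Variable wC : form2 C.
Hypotheses (hs : is_form2 wC) (cs : forall x, closed2_at wC x).
Local Notation TF := (kernel2 wC).
Variable G : tdistribution C.
Hypothesis hG : complement TF G.
Variable j : dual_bundle TF -> cotangent C.
Hypothesis hj : extension_by_zero G j.

Definition leaf_part (V : C -> functional R C) (x : C) : functional R C :=
  V x - proj_along TF G x (V x).

Lemma dsection_leaf_part V : is_vfield V -> dsection TF (leaf_part V).
Proof. exact: dsection_ker_proj. Qed.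

Lemma proj_along_ker x v : TF x v -> proj_along TF G x v = 0.
Proof.
by move=> kv; apply: (proj_along_unique hs hG); [exact: (subbundle0 hG)|rewrite subr0].
Qed.

Lemma ker_extend x v : TF x v -> exists2 V, dsection TF V & V x = v.
Proof.
move=> kv; have [n [f [V [chi [schi chix hc]]]]] := HC x.
have [tv _] := kv; have [W vW Wx] := coords_extend HX schi hc chix tv.
exists (leaf_part W); first exact: dsection_leaf_part.
by rewrite /leaf_part Wx proj_along_ker // subr0.
Qed.

(** Extension by zero on [G] is precomposition with the projection to T F along [G]; smoothness of
    [jform] is thereby reduced to evaluations on sections of T F. *)
Lemma jform_leaf (a : C -> dual_bundle TF) x v : base (a x) = x -> tangent x v ->
  jform j a x v = cov (a x) (v - proj_along TF G x v).
Proof.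
move=> bx tv; have [Gp kp] := proj_alongP hG tv.
have [b1 b2 b3] := hj (a x); rewrite bx in b1 b2 b3.
have := svalP (j (a x)); rewrite -/(base (j (a x))) -/(cov (j (a x))) b1 => -[lc _].
have tp : tangent x (proj_along TF G x v) := subbundle_tangent hG Gp.
have tk : tangent x (v - proj_along TF G x v) by exact: tangentBv.
have E : jform j a x v = cov (j (a x)) (1 *: (v - proj_along TF G x v) + proj_along TF G x v).
  by rewrite scale1r subrK.
by rewrite E lc // (b3 _ Gp) addr0 mul1r b2.
Qed.

Lemma cov_lin x (e : dual_bundle TF) a u v : base e = x -> TF x u -> TF x v ->
  cov e (a *: u + v) = a * cov e u + cov e v.
Proof. by move=> <-; case: (svalP e) => h _; exact: h. Qed.

Lemma smooth_jform (a : C -> dual_bundle TF) : is_section a -> smooth_form1 (jform j a).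
Proof.
move=> [sa ba]; split.
  move=> x c u v tu tv; rewrite !jform_leaf //; last exact: tangent_lin.
  have [Gu ku] := proj_alongP hG tu; have [Gv kv] := proj_alongP hG tv.
  rewrite -(cov_lin c (ba x) ku kv); congr (cov _ _).
  rewrite (_ : proj_along TF G x (c *: u + v) = c *: proj_along TF G x u + proj_along TF G x v).
    by rewrite scalerBr opprD addrACA.
  apply: (proj_along_unique hs hG); first exact: (subbundle_lin hG).
  by rewrite opprD addrACA -scalerBr; exact: kernel2_lin.
move=> W vW; have [tW _] := vW.
have -> : (fun x => jform j a x (W x)) = (fun e => cov e (leaf_part W (base e))) \o a.
  by apply/funext => x; rewrite jform_leaf //= ba.
apply: sa; apply: smooth_eval; exact: dsection_leaf_part.
Qed.

Variable J : set R.
Hypotheses (hJ : is_interval J) (J0 : J 0) (hJne : exists2 t, J t & t != 0).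
Variables (alpha Phi : R -> C -> dual_bundle TF).
Hypothesis sec_alpha : forall t, J t -> is_section (alpha t).
Hypothesis alpha0 : forall x v, cov (alpha 0 x) v = 0.
Hypothesis sPhi : smooth_family J Phi.
Local Notation phi := (fun t x => base (Phi t x)).
Hypothesis sPhit : forall t, J t -> smooth_map (Phi t).
Hypothesis range_Phi : forall t, J t -> range (alpha t) = range (Phi t).
Hypothesis fol_phi : forall t, J t -> foliated_diffeo TF (twisted_kernel j (alpha t)) (phi t).
(** The inverses of the maps [phi t]. Their weak continuity at t = 0, assumed in [psi_cvg], is
    proved for compact [C] by [psi_continuous]. *)
Variable psi : R -> C -> C.
Hypothesis spsi : forall t, J t -> smooth_map (psi t).
Hypothesis phiK : forall t, J t -> cancel (phi t) (psi t).
Hypothesis psiK : forall t, J t -> cancel (psi t) (phi t).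
Hypothesis psi_cvg : forall x f, smooth C f -> f (psi t x) @[t --> within J 0^'] --> f (psi 0 x).

Local Notation tdot := (@tdot R J C).
Local Notation has_rate := (@has_rate R J).

(** The point [Phi t x] lies on the graph of a section, hence is the value of that section at its
    own base point. *)
Lemma alpha_phi t x : J t -> alpha t (phi t x) = Phi t x.
Proof.
move=> Jt; have [_ ba] := sec_alpha Jt.
have : range (alpha t) (Phi t x) by rewrite range_Phi //; exists x.
by case=> y _ <-; rewrite ba.
Qed.

Definition moved (f : C -> R) (t : R) (x : C) : R := f (phi t x).
Definition evaluated (V : C -> functional R C) (t : R) (x : C) : R :=
  cov (Phi t x) (V (phi t x)).

Lemma cyl_moved f : smooth C f -> cyl_smooth J (moved f).
Proof. by move=> sf; exact: (sPhi (@smooth_base _ _ TF _ sf)). Qed.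

Lemma cyl_evaluated V : dsection TF V -> cyl_smooth J (evaluated V).
Proof. move=> sV; exact: (sPhi (smooth_eval sV)). Qed.

Lemma smooth_phi t : J t -> smooth_map (phi t).
Proof. by move=> Jt f sf; exact: (sPhit Jt (@smooth_base _ _ TF _ sf)). Qed.

Lemma smooth_evaluated V t : dsection TF V -> J t -> smooth C (evaluated V t).
Proof. by move=> sV Jt; exact: (sPhit Jt (smooth_eval sV)). Qed.

Lemma evaluated0 V x : evaluated V 0 x = 0.
Proof. by rewrite /evaluated -alpha_phi // alpha0. Qed.

(** The velocity of [phi t] composed with the inverse of [phi 0], as [phi 0] need not be the
    identity. The value 0 on non-smooth functions is the convention of [tangent]. *)
Definition velocity (y : C) : functional R C := fun f =>
  if `[< smooth C f >] then tdot (moved f) (psi 0 y) else 0.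

Lemma velocityE f y : smooth C f -> velocity y f = tdot (moved f) (psi 0 y).
Proof. by move=> sf; rewrite /velocity asboolT. Qed.

Lemma velocity_rate f x : smooth C f -> has_rate (fun t => f (phi t x)) (velocity (phi 0 x) f).
Proof.
move=> sf; rewrite velocityE // phiK //.
exact: (tdot_rate hJ J0 hJne HX (cyl_moved sf)).
Qed.

Arguments velocity_rate {f} x _.

Lemma velocity_vfield : is_vfield velocity.
Proof.
split; last first.
  move=> f sf; have -> : (fun y => velocity y f) = tdot (moved f) \o psi 0.
    by apply/funext => y; rewrite velocityE.
  apply: spsi => //; exact: (tdot_smooth hJ J0 hJne HX (cyl_moved sf)).
move=> y; rewrite -(psiK J0 y); set x := psi 0 y.
split=> [a f g sf sg|f g sf sg|f nf]; last by rewrite /velocity asboolF.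
- have saf : smooth C (fun y => a * f y) by apply: (smoothM HX) => //; exact: smooth_cst.
  apply: (has_rate_unique hJ J0 hJne (velocity_rate x (smoothD HX saf sg))).
  apply: has_rateD; last exact: velocity_rate.
  have := has_rateM (has_rate_cst J a) (velocity_rate x sf).
  by rewrite mul0r add0r.
- apply: (has_rate_unique hJ J0 hJne (velocity_rate x (smoothM HX sf sg))).
  have := has_rateM (velocity_rate x sf) (velocity_rate x sg).
  by rewrite addrC [velocity _ f * _]mulrC.
Qed.

(** [alpha t y] is [Phi t] at the moving point [psi t y], so [tdot_moving] applies. *)
Lemma alpha_rate V y : dsection TF V ->
  has_rate (fun t => cov (alpha t y) (V y)) (tdot (evaluated V) (psi 0 y)).
Proof.
move=> sV; have h := tdot_moving hJ J0 hJne HX (x := psi 0 y) (y := psi^~ y) (cyl_evaluated sV)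
  (evaluated0 V) (@psi_cvg y).
apply: near_eq_cvg_to h; apply: (within_dnbhsP ltr01) => t Jt _ _.
have pE : base (Phi t (psi t y)) = y := psiK Jt y.
by rewrite alpha0 subr0 /evaluated pE -[in RHS]pE alpha_phi ?pE.
Qed.

Arguments alpha_rate {V} y _.

(** The limit is chosen vector by vector; it exists because every vector of T F extends to a section
    of T F, to which [alpha_rate] applies. The value 0 off T F is required by [is_covector]. *)
Definition adot_form (y : C) (v : functional R C) : R :=
  if `[< TF y v >] then xget 0 [set l | has_rate (fun t => cov (alpha t y) v) l] else 0.

Lemma adot_formE V y : dsection TF V -> adot_form y (V y) = tdot (evaluated V) (psi 0 y).
Proof.
move=> sV; rewrite /adot_form asboolT; last by case: sV.
have h := alpha_rate y sV.
by case: xgetP => [l _ hl|/(_ _ h)//]; exact: (has_rate_unique hJ J0 hJne hl h).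
Qed.

Lemma adot_form_rate y v : TF y v -> has_rate (fun t => cov (alpha t y) v) (adot_form y v).
Proof.
by move=> /ker_extend[V sV <-]; rewrite adot_formE //; exact: alpha_rate.
Qed.

Lemma adot_covector y : is_covector (TF y) (adot_form y).
Proof.
split=> [a v w kv kw|v nv]; last by rewrite /adot_form asboolF.
apply: (has_rate_unique hJ J0 hJne (adot_form_rate (kernel2_lin hs a kv kw))).
have h : has_rate (fun t => a * cov (alpha t y) v + cov (alpha t y) w) (a * adot_form y v + adot_form y w).
  apply: has_rateD; last exact: adot_form_rate.
  have := has_rateM (has_rate_cst J a) (adot_form_rate kv).
  by rewrite mul0r add0r.
apply: (has_rate_near J0 ltr01 _ h) => t Jt _.
by rewrite (cov_lin a _ kv kw) //; case: (sec_alpha Jt).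
Qed.

Definition adot (y : C) : dual_bundle TF := exist _ (y, adot_form y) (adot_covector y).

Lemma adot_section : is_section adot.
Proof.
split=> //; apply: (smooth_map_dual_bundle HX) => [f sf //|V sV].
have -> : (fun x => cov (adot x) (V (base (adot x)))) = tdot (evaluated V) \o psi 0.
  by apply/funext => x; exact: adot_formE.
apply: spsi => //; exact: (tdot_smooth hJ J0 hJne HX (cyl_evaluated sV)).
Qed.

(** The form d j(alpha_0) is 0. Together with [fol_phi] at time 0 this shows that [phi 0] preserves
    T F. *)
Lemma twisted_kernel0 x : twisted_kernel j (alpha 0) x = TF x.
Proof.
have d0 y v w : tangent y v -> tangent y w -> dext (jform j (alpha 0)) y v w = 0.
  move=> tv tw; have [n [f [V [chi [schi chix hc]]]]] := HC y.
  rewrite (dext_coords HX schi hc (smooth_jform (sec_alpha J0)) chix tv tw) big1 // => i _.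
  have -> : (fun z => jform j (alpha 0) z (V i z)) = (fun=> 0).
    apply/funext => z; have [_ b] := sec_alpha J0; rewrite jform_leaf ?alpha0 //.
    by case: hc => _ /(_ i)[tV _] _ _ _.
  by rewrite (tangent_cst HX tv) (tangent_cst HX tw) !mulr0 subr0.
rewrite eqEsubset; split=> v [tv hv]; split=> // w tw.
  by have := hv w tw; rewrite d0 // subr0.
by rewrite d0 // subr0; exact: hv.
Qed.

Lemma push_psi y (w : functional R C) : tangent y w -> push (phi 0) (push (psi 0) w) = w.
Proof.
move=> tw; apply/funext => g; have [sg|ng] := pselect (smooth C g).
  rewrite !pushE //; last exact: smooth_phi.
  by congr (w _); apply/funext => z; rewrite /= psiK.
by rewrite /push asboolF //; case: tw => _ _ ->.
Qed.

Lemma push_velocity x (v : functional R C) f : tangent x v -> smooth C f ->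
  push (phi 0) v (fun y => velocity y f) = v (tdot (moved f)).
Proof.
move=> tv sf; rewrite pushE; last by case: velocity_vfield => _; apply.
by congr (v _); apply/funext => z; rewrite /= velocityE // phiK.
Qed.

Lemma push_adot x (v : functional R C) V : tangent x v -> is_vfield V ->
  push (phi 0) v (fun y => jform j adot y (V y)) = v (tdot (evaluated (leaf_part V))).
Proof.
move=> tv vV; rewrite pushE; last by case: (smooth_jform adot_section) => _; apply.
congr (v _); apply/funext => z; rewrite /= jform_leaf //; last by case: vV.
by rewrite -[LHS]/(adot_form _ (leaf_part V _)) adot_formE ?phiK //; exact: dsection_leaf_part.
Qed.

Section Variation.
Variables (n : nat) (f : 'I_n -> C -> R) (V : 'I_n -> C -> functional R C) (chi : C -> R).
Hypotheses (schi : smooth C chi) (hc : coords f V (nonzero chi)).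
Variables (x : C) (v w : functional R C).
Hypotheses (kv : TF x v) (tw : tangent x w) (chix : nonzero chi (phi 0 x)).
Let w_ a b := fun y => wC y (V a y) (V b y).

(* The leaves are mapped to ker (wC - d j alpha_t): this is that condition in
   coordinates. *)
Lemma twisted_identity t : J t -> nonzero chi (phi t x) ->
  \sum_a \sum_b v (moved (f a) t) * w (moved (f b) t) * moved (w_ a b) t x =
  \sum_a (w (moved (f a) t) * v (evaluated (leaf_part (V a)) t) -
          v (moved (f a) t) * w (evaluated (leaf_part (V a)) t)).
Proof.
move=> Jt chit; have sp := smooth_phi Jt; have [tv _] := kv.
have [sf vV _ _ _] := hc.
have tv' := push_tangent HX sp tv; have tw' := push_tangent HX sp tw.
have [_ fol] := fol_phi Jt.
have kv' : twisted_kernel j (alpha t) (phi t x) (push (phi t) v) by rewrite -fol; exists v.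
have [_ /(_ _ tw')/eqP] := kv'; rewrite subr_eq0 => /eqP.
rewrite (form2_coords HX hs schi hc chit tv' tw').
rewrite (dext_coords HX schi hc (smooth_jform (sec_alpha Jt)) chit tv' tw').
have E1 a u : push (phi t) u (f a) = u (moved (f a) t) by rewrite pushE.
have E2 a u : push (phi t) u (fun z => jform j (alpha t) z (V a z)) = u (evaluated (leaf_part (V a)) t).
  rewrite pushE; last by case: (smooth_jform (sec_alpha Jt)) => _; apply.
  congr (u _); apply/funext => z; have [_ b] := sec_alpha Jt.
  rewrite /= jform_leaf //; last by case: (vV a).
  by rewrite /evaluated -alpha_phi // b.
move=> E; transitivity (\sum_i \sum_j push (phi t) v (f i) * push (phi t) w (f j) *
   wC (phi t x) (V i (phi t x)) (V j (phi t x))).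
  by apply: eq_bigr => a _; apply: eq_bigr => b _; rewrite !E1.
by rewrite E; apply: eq_bigr => a _; rewrite !E1 !E2.
Qed.

(** Both sides of [twisted_identity] are differentiated at t = 0. The left one becomes the Lie
    derivative of [wC] along [velocity] in coordinates. On the right [evaluated] is 0 at t = 0, so
    only its own derivative survives in each product, and this is d j(adot). *)
Lemma variation_identity :
  let v' := push (phi 0) v in let w' := push (phi 0) w in let y := phi 0 x in
  \sum_a \sum_b ((v' (fun z => velocity z (f a)) * w' (f b) +
       v' (f a) * w' (fun z => velocity z (f b))) * w_ a b y + v' (f a) * w' (f b) * velocity y (w_ a b)) =
  dext (jform j adot) y v' w'.
Proof.
move=> v' w' y; have sp := smooth_phi J0; have [tv _] := kv.
have [sf vV _ _ _] := hc.
have tv' : tangent y v' := push_tangent HX sp tv.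
have tw' : tangent y w' := push_tangent HX sp tw.
rewrite (dext_coords HX schi hc (smooth_jform adot_section) chix tv' tw').
have sw a b : smooth C (w_ a b) by case: hs => _ _; apply.
have mr u a : tangent x u -> has_rate (fun t => u (moved (f a) t)) (push (phi 0) u (fun z => velocity z (f a))).
  move=> tu; rewrite (push_velocity tu) //.
  apply: (tdot_tangent hJ J0 hJne HX (cyl_moved (sf a)) _ tu) => t Jt.
  exact: (smooth_phi Jt (sf a)).
have er u a : tangent x u -> has_rate (fun t => u (evaluated (leaf_part (V a)) t))
    (push (phi 0) u (fun z => jform j adot z (V a z))).
  move=> tu; rewrite (push_adot tu) //; have sl := dsection_leaf_part (vV a).
  apply: (tdot_tangent hJ J0 hJne HX (cyl_evaluated sl) _ tu) => t Jt.
  exact: smooth_evaluated.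
have E0 u a : tangent x u -> u (evaluated (leaf_part (V a)) 0) = 0.
  move=> tu; have -> : evaluated (leaf_part (V a)) 0 = (fun=> 0) by apply/funext => z; exact: evaluated0.
  exact: (tangent_cst HX tu).
have M0 u a : push (phi 0) u (f a) = u (moved (f a) 0) by rewrite pushE.
have LR : has_rate (fun t => \sum_a \sum_b v (moved (f a) t) * w (moved (f b) t) * moved (w_ a b) t x)
  (\sum_a \sum_b ((v' (fun z => velocity z (f a)) * w' (f b) +
       v' (f a) * w' (fun z => velocity z (f b))) * w_ a b y + v' (f a) * w' (f b) * velocity y (w_ a b))).
  apply: has_rate_sum => a; apply: has_rate_sum => b; rewrite /v' /w' !M0.
  exact: has_rateM (has_rateM (mr v a tv) (mr w b tw)) (velocity_rate x (sw a b)).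
have RR : has_rate (fun t => \sum_a (w (moved (f a) t) * v (evaluated (leaf_part (V a)) t) -
          v (moved (f a) t) * w (evaluated (leaf_part (V a)) t)))
  (\sum_i (w' (f i) * v' (fun z => jform j adot z (V i z)) -
           v' (f i) * w' (fun z => jform j adot z (V i z)))).
  apply: has_rate_sum => a.
  have h1 := has_rateM (mr w a tw) (er v a tv).
  have h2 := has_rateM (has_rate_cst J (-1)) (has_rateM (mr v a tv) (er w a tw)).
  have := has_rateD h1 h2; rewrite !E0 // !(mulr0, mul0r, add0r) -!M0 mulN1r.
  by under eq_fun do rewrite mulN1r.
(* [twisted_identity] is available only while [phi t x] stays in the coordinate domain, which it
   does for small times. *)
have [d d0 hd] := cyl_smooth_continuous J0 HX x (cyl_moved schi) (eps := `|chi y|)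
  (ltac:(by rewrite normr_gt0)).
apply: (has_rate_unique hJ J0 hJne LR); apply: (has_rate_near J0 d0 _ RR) => t Jt td.
apply/esym; apply: twisted_identity => //.
have := near_pt_self hd t Jt td; rewrite /moved -/y => h.
by rewrite /nonzero /=; apply/eqP => c0; move: h; rewrite c0 sub0r normrN ltxx.
Qed.

End Variation.

(** With Z the velocity, [variation_identity] turns the left-hand side into (L_Z wC)(A, B) = Z(wC(A,
    B)) - wC([Z, A], B) - wC(A, [Z, B]); the first and last terms vanish because A takes values in
    the kernel. *)
Lemma dext_adot A B y : dsection TF A -> is_vfield B ->
  dext (jform j adot) y (A y) (B y) = wC y (bracket A velocity y) (B y).
Proof.
move=> [vA kA] vB; have [n [f [V [chi [schi chiy hc]]]]] := HC y.
have [tA sA] := vA; have [tB sB] := vB; have [tZ sZ] := velocity_vfield.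
have [sf vV _ _ _] := hc.
pose w_ a b := fun y => wC y (V a y) (V b y).
have sw a b : smooth C (w_ a b) by case: hs => _ _; apply.
pose x := psi 0 y; have yE : y = phi 0 x by rewrite /x psiK.
have [_ fol] := fol_phi J0.
(* [variation_identity] speaks of vectors pushed forward from [x]; since [phi 0] preserves T F,
   [A y] comes from a vector of T F at [x]. *)
have [v kv vE] : exists2 v, TF x v & push (phi 0) v = A y.
  have : TF (phi 0 x) (A y) by rewrite -yE.
  rewrite -twisted_kernel0 -fol => -[v kv vE]; by exists v.
pose w := push (psi 0) (B y).
have tw : tangent x w by exact: (push_tangent HX (spsi J0) (tB y)).
have chix : nonzero chi (phi 0 x) by rewrite -yE.
have := variation_identity schi hc kv tw chix; rewrite /= vE (push_psi (tB y)) -yE => <-.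
have AB0 : velocity y (fun z => wC z (A z) (B z)) = 0.
  have -> : (fun z => wC z (A z) (B z)) = (fun=> 0).
    by apply/funext => z; exact: (kernel2l (kA z)).
  exact: (tangent_cst HX (tZ y)).
have sAf a : smooth C (fun z => A z (f a)) by exact: sA.
have sBf a : smooth C (fun z => B z (f a)) by exact: sB.
have Leib : velocity y (fun z => wC z (A z) (B z)) =
  \sum_a \sum_b ((velocity y (fun z => A z (f a)) * B y (f b) +
       A y (f a) * velocity y (fun z => B z (f b))) * w_ a b y + A y (f a) * B y (f b) * velocity y (w_ a b)).
  rewrite (tangent_near HX (tZ y) (g := fun z => \sum_a \sum_b A z (f a) * B z (f b) * w_ a b z)).
  - exact: (tangent_bilinear HX (tZ y) sAf sBf sw).
  - by case: hs => _ _; apply.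
  - by apply: (smooth_sum HX) => a; apply: (smooth_sum HX) => b; do 2!apply: (smoothM HX) => //.
  - apply: near_pt_sub (near_pt_nonzero schi chiy) => z cz.
    exact: (form2_coords HX hs schi hc cz).
have vAZ := vfield_bracket HX vA velocity_vfield; have vBZ := vfield_bracket HX vB velocity_vfield.
have [tAZ _] := vAZ; have [tBZ _] := vBZ.
have z2 : wC y (A y) (bracket B velocity y) = 0 by exact: (kernel2l (kA y)).
(* The two vanishing terms are inserted so that the Leibniz expansion and the brackets match term by
   term. *)
rewrite -[LHS]subr0 -[X in _ - X = _]AB0 Leib -[RHS]addr0 -[X in _ = _ + X]z2.
rewrite (form2_coords HX hs schi hc chiy (tAZ y) (tB y)) (form2_coords HX hs schi hc chiy (tA y) (tBZ y)).
rewrite -sumrB -big_split /=; apply: eq_bigr => a _; rewrite -sumrB -big_split /=; apply: eq_bigr => b _.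
rewrite /bracket /w_; ring.
Qed.

Lemma ker_bracket A B x : dsection TF A -> dsection TF B -> TF x (bracket A B x).
Proof. by move=> sA sB; exact: (kernel2_involutive HX HC hs (cs x) sA sB). Qed.

(** T F is involutive, so on it [form_of adot] and its extension by zero have the same Koszul
    expression; [dext_adot] then pairs with a vector of the kernel. *)
Lemma adot_closed : leafwise_closed adot.
Proof.
move=> A B sA sB x; have [vA kA] := sA; have [vB kB] := sB.
have jE y v : TF y v -> jform j adot y v = form_of adot y v.
  move=> kv; have [tv _] := kv.
  by rewrite jform_leaf // proj_along_ker // subr0.
have -> : koszul1 (form_of adot) A B x = koszul1 (jform j adot) A B x.
  rewrite /koszul1 jE; last exact: ker_bracket.
  congr (_ - _ - _); congr (_ x _); apply/funext => y; exact/esym/jE.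
rewrite -(dext_koszul HX x HC (smooth_jform adot_section) vA vB) dext_adot //.
by apply: (kernel2r hs (kB x)); case: (vfield_bracket HX vA velocity_vfield).
Qed.

(** The primitive is minus the projection of the velocity to [G]; the sign comes from the skewness
    of [wC] in [key]. *)
Lemma adot_exact : nabla_exact wC G (PhiG G j adot).
Proof.
have [tZ sZ] := velocity_vfield.
have [vP GP] := dsection_proj HX hs hG velocity_vfield.
exists (fun y => - proj_along TF G y (velocity y)).
  by split; [exact: vfieldN|move=> x; exact: (subbundleN hG)].
move=> A sA x; have [vA kA] := sA.
have vAZ := vfield_bracket HX vA velocity_vfield; have [tAZ _] := vAZ.
have [Gp kp] := proj_alongP hG (tAZ x).
set p := proj_along TF G x (bracket A velocity x) in Gp kp.
have tp := subbundle_tangent hG Gp.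
(* Replacing the velocity by its projection changes the bracket by that of [A] with the leaf part of
   the velocity, which lies in T F by involutivity and is killed by the projection. *)
have -> : nabla wC G A (fun y => - proj_along TF G y (velocity y)) x = - p.
  rewrite /nabla /p -(proj_alongN hs hG (tAZ x)).
  apply: (proj_along_congr hs hG); first exact: tangentNv.
  rewrite (_ : _ - _ = bracket A (leaf_part velocity) x).
    apply: ker_bracket => //; exact: dsection_leaf_part velocity_vfield.
  have [tA sA'] := vA; have [tP sP] := vP; apply/funext => g.
  rewrite -[LHS]/(bracket A (fun y => - proj_along TF G y (velocity y)) x g - - bracket A velocity x g).
  rewrite /bracket /leaf_part.
  have -> : (fun y => (- proj_along TF G y (velocity y)) g) = (fun y => - proj_along TF G y (velocity y) g) by [].
  have -> : (fun y => (velocity y - proj_along TF G y (velocity y)) g) =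
    (fun y => velocity y g - proj_along TF G y (velocity y) g) by [].
  rewrite -[(- _) (fun y => A y g)]/(- _) -[(velocity x - _) (fun y => A y g)]/(_ - _).
  (* Equality of functionals is tested on all functions; on the non-smooth ones tangent vectors are
     0. *)
  have [sg|ng] := pselect (smooth C g).
    rewrite (tangentN HX (tA x)) ?(tangentB HX (tA x)); [|exact: sZ|exact: sP|exact: sP].
    ring.
  have zero (U : C -> functional R C) : (forall y, tangent y (U y)) -> forall y, U y g = 0.
    by move=> tU y; case: (tU y) => _ _; exact.
  have zf (U : C -> functional R C) : (forall y, tangent y (U y)) -> (fun y => U y g) = (fun=> 0).
    by move=> tU; apply/funext => y; exact: zero.
  have zs : (fun y => velocity y g - proj_along TF G y (velocity y) g) = (fun=> 0).
    by apply/funext => y; rewrite (zero _ tZ) (zero _ tP) subr0.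
  have zn : (fun y => - proj_along TF G y (velocity y) g) = (fun=> 0).
    by apply/funext => y; rewrite (zero _ tP) oppr0.
  rewrite zs zn (zf _ tA) (zf _ tZ) !(tangent_cst HX (tA x)) !(tangent_cst HX (tZ x)) (tangent_cst HX (tP x)).
  ring.
(* With Z the velocity and Y the sharp of b: d j(adot)(A, Y) = wC([A, Z], Y) = wC(p, Y) = - wC(Y, p)
   = - b(p). *)
have key b : is_covector (G x) b -> b (- p) = dext (jform j adot) x (A x) (wC_sharp wC G x b).
  move=> hb; have [Gs hsharp] := wC_sharpP HX hs hG hb.
  set Y := wC_sharp wC G x b in Gs hsharp *.
  have tY := subbundle_tangent hG Gs.
  have [n [f [V [chi [schi chix hc]]]]] := HC x.
  have [B vB BY] := coords_extend HX schi hc chix tY.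
  rewrite -BY dext_adot // BY.
  rewrite -(form2_proj hs hG (tAZ x) tY) -/p (form2C hs tp tY) hsharp //.
  have [lb _] := hb; have G0 := subbundle0 hG x.
  have b0 : b 0 = 0 by have := lb (-1) 0 0 G0 G0; rewrite scaler0 addr0 mulN1r addNr.
  by rewrite -scaleN1r -[_ *: p]addr0 lb // b0 addr0 mulN1r.
rewrite /PhiG; case: xgetP => [Y _ [GY hY]|/(_ (- p))[]]; last first.
  by split; [exact: (subbundleN hG)|exact: key].
apply: (covector_separates hs hG GY (subbundleN hG Gp)) => b hb.
by rewrite hY // key.
Qed.

End Deformation.

(** Applied to the cut-off [chi] at [a], the hypothesis puts [b] into the same coordinate domain,
    where the coordinates are injective. *)
Lemma smooth_separate (R : realType) (X : dspace R) (HC : has_coords X) (a b : X) :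
  (forall g, smooth X g -> g a = g b) -> a = b.
Proof.
move=> h; have [n [f [V [chi [schi chia [sf _ _ _ inj]]]]]] := HC a.
by apply: inj => // [|i]; [rewrite /nonzero /= -h | exact: h].
Qed.

(** * Continuity in time of the inverse diffeomorphisms *)

Section Compactness.
Variables (R : realType) (C : manifold R).
Hypothesis hcpt : compact [set: mtop C].
Variables (J : set R) (h : R -> C -> C) (psi : R -> C).
Hypotheses (hJ : is_interval J) (J0 : J 0) (hJne : exists2 t, J t & t != 0).
Variable x : C.
Hypothesis ch : forall g, smooth C g -> cyl_smooth J (fun t z => g (h t z)).
Hypothesis hpsi : forall t, J t -> h t (psi t) = x.
Hypothesis h0_inj : injective (h 0).

Lemma near_pt_nbhs (z : C) P : near_pt z P -> nbhs (z : mtop C) P.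
Proof.
move=> [chi [schi chiz] hP]; apply: filterS hP _.
have c : {for (z : mtop C), continuous (fun y : mtop C => `|chi y|)}.
  apply: (@continuous_comp _ _ _ (chi : mtop C -> R) (fun r : R => `|r|)); last exact: norm_continuous.
  exact: smooth_continuous.
have nz : 0 < `|chi z| by rewrite normr_gt0.
by apply: filterS (cvgr_gt _ c _ nz) => y; rewrite normr_gt0.
Qed.

(* Every cluster point z of psi t as t -> 0 satisfies h 0 z = x, so z = psi 0
   by injectivity; this replaces the inverse function theorem. *)
Lemma psi_continuous f : smooth C f -> f (psi t) @[t --> within J 0^'] --> f (psi 0).
Proof.
move=> sf.
have PF := within_dnbhs_proper hJ J0 hJne.
pose F := (psi : R -> mtop C) @ within J 0^'.
have PFF : ProperFilter F by exact: fmap_proper_filter.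
have cl z : cluster F z -> z = psi 0.
  move=> clz; apply: h0_inj; rewrite hpsi //.
  apply: (smooth_separate (@manifold_has_coords R C)) => g sg.
  apply/eqP; rewrite -subr_eq0 -normr_le0; apply/ler_addgt0Pr => eps eps0; rewrite add0r.
  have [d d0 hd] := cyl_smooth_continuous J0 (@manifold_Cinfty_closed R C) z (ch sg) eps0.
  (* The values of [psi] at small times form a member of the filter, so they meet the neighbourhood
     of [z] on which g o h_t is close to g(h_0(z)); at [psi t] that function equals g(x). *)
  pose A := [set psi t | t in [set t | J t /\ `|t| < d]].
  have FA : F A.
    apply: (within_dnbhsP d0) => t Jt _ td; by exists t.
  have [y [[t [Jt td] <-] /(_ t Jt td)]] := clz _ _ FA (near_pt_nbhs hd).
  by rewrite hpsi // distrC => /ltW.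
have clE : cluster F = [set psi 0].
  rewrite eqEsubset; split=> [z /cl //|z ->].
  have [z0 [_ clz0]] := hcpt PFF filterT.
  by rewrite -(cl z0 clz0).
have Fcvg : F --> (psi 0 : mtop C).
  apply: (compact_cluster_set1 (@manifold_hausdorff R C) hcpt _ PFF filterT clE).
  exact: filterT.
have cf : (f : mtop C -> R) @ nbhs (psi 0 : mtop C) --> f (psi 0) by exact: smooth_continuous.
by move=> A /cf /Fcvg.
Qed.

End Compactness.

(** Smoothness of the path is expressed through the embeddings, so the derivative of [alpha] is not
    given in advance; its existence and smoothness are part of the conclusion. *)
Theorem lemma2p6 (R : realType) (M C : manifold R)
  (* (M, omega) is symplectic *)
  (omega : form2 M) (hM : symplectic_on setT omega)
  (* C is a compact coisotropic submanifold *)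
  (iota : C -> M) (hemb : embedding iota) (hcpt : compact [set: mtop C])
  (hcois : coisotropic omega iota)
  (* the Gotay local model *)
  (wC : form2 C) (hwC : wC = pullback2 iota omega)
  (G : tdistribution C) (hG : complement (kernel2 wC) G)
  (j : dual_bundle (kernel2 wC) -> cotangent C) (hj : extension_by_zero G j)
  (U : set (dual_bundle (kernel2 wC))) (hU : local_model j U)
  (* a smooth curve in Def_F^U(C) through C at time 0 *)
  (J : set R) (hJ : is_interval J) (hJ0 : J 0)
  (hJne : exists2 t, J t & t != 0)
  (alpha : R -> C -> dual_bundle (kernel2 wC))
  (halpha : smooth_path j U J alpha)
  (halpha0 : forall x v, cov (alpha 0 x) v = 0) :
  exists adot : C -> dual_bundle (kernel2 wC),
    [/\ is_section adot, derivative_at_0 J alpha adot,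
        leafwise_closed adot & nabla_exact wC G (PhiG G j adot)].
Proof.
have HM := @manifold_Cinfty_closed R M; have CM := @manifold_has_coords R M.
have HC := @manifold_Cinfty_closed R C; have CC := @manifold_has_coords R C.
have [siota _ _ _] := hemb; have [fom com _] := hM.
have hs : is_form2 wC by rewrite hwC; exact: pullback2_form2.
have cs x : closed2_at wC x by rewrite hwC; apply: pullback2_closed => //; exact: com.
have [hDef [Phi [sPhi hPhi]]] := halpha.
have sec t : J t -> is_section (alpha t) by move=> /hDef[h _ _ _].
have sPhit t : J t -> smooth_map (Phi t) by move=> /hPhi[[h _ _ _] _ _ _].
have rPhi t : J t -> range (alpha t) = range (Phi t) by move=> /hPhi[_ _ h _].
have fol t : J t -> foliated_diffeo (kernel2 wC) (twisted_kernel j (alpha t))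
    (fun x => base (Phi t x)) by move=> /hPhi[_ _ _ h].
(* Every time in [J] provides an inverse; outside [J] the identity is an arbitrary value. *)
have /choice[psi hpsi] : forall t, exists psi : C -> C, J t ->
    [/\ smooth_map psi, cancel (fun x => base (Phi t x)) psi &
        cancel psi (fun x => base (Phi t x))].
  move=> t; have [Jt|nJt] := pselect (J t); last by exists id.
  by have [[_ [p hp]] _] := fol t Jt; exists p.
have spsi t : J t -> smooth_map (psi t) by move=> /hpsi[h _ _].
have phiK t : J t -> cancel (fun x => base (Phi t x)) (psi t) by move=> /hpsi[_ h _].
have psiK t : J t -> cancel (psi t) (fun x => base (Phi t x)) by move=> /hpsi[_ _ h].
have psi_cvg x f : smooth C f -> f (psi t x) @[t --> within J 0^'] --> f (psi 0 x).
  apply: (psi_continuous hcpt (h := fun t x => base (Phi t x)) hJ hJ0 hJne (x := x)).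
  - move=> g sg; exact: (sPhi _ (@smooth_base _ _ (kernel2 wC) _ sg)).
  - by move=> t Jt; exact: psiK.
  - exact: can_inj (phiK 0 hJ0).
exists (adot HC CC hs hG hJ hJ0 hJne sec halpha0 sPhi rPhi psiK psi_cvg); split.
- exact: adot_section.
- move=> x v kv. exact: (adot_form_rate HC CC hs hG hJ hJ0 hJne sec halpha0 sPhi rPhi psiK psi_cvg kv).
- exact: adot_closed.
- exact: adot_exact.
Qed.
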